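(* Let $p_\Delta\in(0,1)$, $\alpha\in(0,1)$ and $\Delta>0$ be fixed constants, independent of $n$. In the random network with $n$ nodes described in the context, Scheme $\Pi$ achieves throughput $T_\Pi(n)=\Theta(1)$. That is, there is a function $T_\Pi(n)=\Theta(1)$ such that the event \[A_\Pi(n)=\Big\{\min_{1\le i\le n/2}\liminf_{t\to\infty}\tfrac1t B_{\Pi_n}(i,t)\ge T_\Pi(n)\Big\}\] satisfies $P(A_\Pi(n))\to 1$ as $n\to\infty$, where $B_{\Pi_n}(i,t)$ is the number of bits of source-destination pair $i$ delivered to its destination in the first $t$ time-slots, and the probability is over the random network and the randomness of the policy.
   Context: Random network model: $S^2$ is the sphere in $\mathbb R^3$ of unit surface area (radius $1/(2\sqrt\pi)$). For $x\in S^2$, the great circle $G(x)$ is the intersection of $S^2$ with the plane through the center perpendicular to the diameter through $x$; a uniformly random great circle is $G(x)$ with $x$ uniform on $S^2$. There are $n$ nodes, randomly split into $n/2$ distinct source-destination (S-D) pairs. Each node $i$ has an independent uniformly random great circle $G_i$, on which $\sqrt n$ equidistant lattice points (spacing $\sqrt{\pi/n}$) labelled $0,\dots,\sqrt n-1$ are placed, forming a discrete torus of size $\sqrt n$. Time is slotted. Each node moves independently according to a natural random walk on its lattice points: its initial position is uniform, and at each step the next position is equally likely to be the current position, the current position $-1 \bmod \sqrt n$, or $+1\bmod\sqrt n$. Distances $d(\cdot,\cdot)$ are measured on the sphere. Relaxed Protocol model: a transmission from node $i$ to node $j$ is successful if every other simultaneously transmitting node $k$ satisfies $d(k,j)\ge(1+\Delta)d(i,j)$;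 a successful transmission in a slot delivers a packet of $W$ bits (a constant). For each pair $i\ne j$, let $z_{ij}$ be one of the two intersection points of $G_i$ and $G_j$ chosen uniformly at random, and ${\cal C}_{ij}$ the disk on the sphere centered at $z_{ij}$ of radius $(2+\Delta)\sqrt{\pi/n}$. A configuration is typical if the number of great circles passing through each ${\cal C}_{ij}$ is $\Theta(\sqrt n)$. Nodes $i,j$ are neighbors at time $t$ if both are at the lattice points of their respective great circles closest to $z_{ij}$. Scheme $\Pi$: if the configuration is not typical, each source transmits directly to its destination in round-robin time-division. If it is typical, Policy $\Sigma_n$ is used: each time-slot is split into sub-slots A and B. In sub-slot A, each source node independently becomes active with probability $p_\Delta$; an active source that has at least one neighbor, with probability $\alpha$, chooses one neighbor uniformly at random (the relay) and transmits to it a packet destined for its own destination. In sub-slot B, each node independently becomes active with probability $p_\Delta$; an active node having one or more neighbors that are destination nodes chooses one such destination uniformly at random and, if it holds any packet for that destination, transmits one to it in FIFO order. Each node keeps a separate relay queue for each S-D pair. *)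

(* Defs.v *)
From mathcomp Require Import all_boot all_order all_algebra.
From mathcomp Require Import all_classical all_reals all_analysis.
Set Implicit Arguments. Unset Strict Implicit. Unset Printing Implicit Defensive.
Import Order.TTheory GRing.Theory Num.Theory.
Local Open Scope ring_scope.
Local Open Scope classical_set_scope.

(* Randomness.  All random quantities of the model are measurable functions
   of a family of i.i.d. Uniform[0,1] random variables ("seeds") indexed by
   labels (tag, a, b, c) : nat * nat * nat * nat.                           *)
Definition label := (nat * nat * nat * nat)%type.

Definition iid_uniform_seeds (R : realType) (d : measure_display)
  (Omega : measurableType d) (P : probability Omega R)
  (U : label -> Omega -> R) : Prop :=
  (forall l, measurable_fun setT (U l)) /\
  forall (s : seq label) (a : label -> R),
    uniq s -> (forall l, 0 <= a l <= 1) ->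
    P (\bigcap_(l in [set x | x \in s]) [set w | U l w <= a l]) =
    (\prod_(l <- s) a l)%:E.

Definition tag_z := 0%N.      (* (tag_z, i, 0, 0): height of pole x_i      *)
Definition tag_phi := 1%N.    (* (tag_phi, i, 0, 0): longitude of pole x_i *)
Definition tag_pos0 := 2%N.   (* (tag_pos0, i, 0, 0): initial lattice pos. *)
Definition tag_step := 3%N.   (* (tag_step, i, t, 0): random-walk step     *)
Definition tag_pair := 4%N.   (* (tag_pair, i, 0, 0): S-D pairing key      *)
Definition tag_sign := 5%N.   (* (tag_sign, i, j, 0), i<j: choice of z_ij  *)
Definition tag_actA := 6%N.   (* (tag_actA, t, i, 0): activity, sub-slot A *)
Definition tag_alpha := 7%N.  (* (tag_alpha, t, i, 0): the alpha-coin      *)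
Definition tag_relay := 8%N.  (* (tag_relay, t, i, 0): choice of relay     *)
Definition tag_actB := 9%N.   (* (tag_actB, t, i, 0): activity, sub-slot B *)
Definition tag_dest := 10%N.  (* (tag_dest, t, i, 0): choice of dest.      *)

Section Model.
Variable R : realType.

(* uniform choice of an index in {0,..,c-1} from a Uniform[0,1] seed x *)
Definition pickidx (c : nat) (x : R) : nat := minn (Num.truncn (c%:R * x)) c.-1.

Definition vec := (R * R * R)%type.
Definition vx (v : vec) := v.1.1.
Definition vy (v : vec) := v.1.2.
Definition vz (v : vec) := v.2.
Definition mkv (a b c : R) : vec := (a, b, c).
Definition vadd (v w : vec) : vec := mkv (vx v + vx w) (vy v + vy w) (vz v + vz w).
Definition vscale (a : R) (v : vec) : vec := mkv (a * vx v) (a * vy v) (a * vz v).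
Definition vdot (v w : vec) : R := vx v * vx w + vy v * vy w + vz v * vz w.
Definition vcross (v w : vec) : vec :=
  mkv (vy v * vz w - vz v * vy w) (vz v * vx w - vx v * vz w)
      (vx v * vy w - vy v * vx w).
Definition vnorm (v : vec) : R := Num.sqrt (vdot v v).

(* radius of the sphere of unit surface area *)
Definition rad : R := 1 / (2 * Num.sqrt pi).

Definition sdist (a b : vec) : R := rad * acos (vdot a b / (rad ^+ 2)).

(* the point of S^2 with normalized height 2*s-1 and longitude 2*pi*s';
   for s, s' independent Uniform[0,1] it is uniform on S^2 (Archimedes) *)
Definition sphere_pt (s s' : R) : vec :=
  let z := 2 * s - 1 in let r := Num.sqrt (1 - z ^+ 2) in
  vscale rad (mkv (r * cos (2 * pi * s')) (r * sin (2 * pi * s')) z).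

(* The placement of the lattice on a great circle: frame e : R*R -> vec
   maps the seeds of the pole to a unit vector orthogonal to the pole.
   Any measurable such choice is allowed. *)
Definition frame_ok (e : (R * R)%type -> vec) : Prop :=
  (forall s s', 0 <= s <= 1 -> 0 <= s' <= 1 ->
     vdot (e (s, s')) (e (s, s')) = 1 /\ vdot (e (s, s')) (sphere_pt s s') = 0) /\
  measurable_fun setT (fun p => vx (e p)) /\
  measurable_fun setT (fun p => vy (e p)) /\
  measurable_fun setT (fun p => vz (e p)).

Variables (e : (R * R)%type -> vec) (k : nat) (u : label -> R).

Definition msz : nat := (k.+1).*2.
Definition nn : nat := (msz * msz)%N.
Definition npairs : nat := (nn./2)%N.

Definition node := 'I_nn.

Definition pole (i : node) : vec :=
  sphere_pt (u (tag_z, val i, 0, 0)%N) (u (tag_phi, val i, 0, 0)%N).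
Definition frame1 (i : node) : vec :=
  e (u (tag_z, val i, 0, 0)%N, u (tag_phi, val i, 0, 0)%N).
Definition frame2 (i : node) : vec := vcross (vscale (1 / rad) (pole i)) (frame1 i).

(* lattice point number l on G_i (spacing 2*pi*rad/m = sqrt(pi/n)) *)
Definition lattice (i : node) (l : nat) : vec :=
  vscale rad (vadd (vscale (cos (2 * pi * l%:R / msz%:R)) (frame1 i))
                   (vscale (sin (2 * pi * l%:R / msz%:R)) (frame2 i))).

(* lazy random walk on Z_m: stay, -1 or +1 w.p. 1/3 each *)
Fixpoint pos (i : node) (t : nat) : nat :=
  match t with
  | 0 => pickidx msz (u (tag_pos0, val i, 0, 0)%N)
  | t'.+1 => ((pos i t' + pickidx 3 (u (tag_step, val i, t', 0)%N) + msz.-1) %% msz)%N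
  end.

Definition loc (i : node) (t : nat) : vec := lattice i (pos i t).

(* random S-D pairing: rank the nodes by their pairing keys; ranks 2p and
   2p+1 form pair p, the node of rank 2p is the source, 2p+1 the dest. *)
Definition rank (i : node) : nat :=
  #|[set j : node | u (tag_pair, val j, 0, 0)%N < u (tag_pair, val i, 0, 0)%N]|.
Definition is_source (i : node) : bool := ~~ odd (rank i).
Definition is_dest (i : node) : bool := odd (rank i).
Definition pair_of (i : node) : nat := (rank i)./2.

(* z_ij: one of the two intersection points of G_i and G_j, chosen by a
   fair coin (the same point for (i,j) and (j,i)) *)
Definition zpt_ord (i j : node) : vec :=
  let c := vcross (pole i) (pole j) in
  let sgn : R := if u (tag_sign, val i, val j, 0)%N < 1 / 2 then 1 else -1 in
  vscale (sgn * rad / vnorm c) c.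
Definition zpt (i j : node) : vec :=
  if (val i < val j)%N then zpt_ord i j else zpt_ord j i.

Definition closest (i : node) (l : nat) (z : vec) : bool :=
  [forall l' : 'I_msz, sdist (lattice i l) z <= sdist (lattice i l') z].

Definition nbr (t : nat) (i j : node) : bool :=
  (i != j) && closest i (pos i t) (zpt i j) && closest j (pos j t) (zpt i j).

Definition crosses (l : node) (z : vec) (rho : R) : Prop :=
  exists y : vec, vdot y y = rad ^+ 2 /\ vdot y (pole l) = 0 /\ sdist y z <= rho.
Definition typical (Delta c1 c2 : R) : Prop :=
  forall i j : node, i != j ->
    let cnt := #|[set l : node | `[< crosses l (zpt i j)
                      ((2 + Delta) * Num.sqrt (pi / nn%:R)) >] ]| in
    c1 * Num.sqrt nn%:R <= cnt%:R <= c2 * Num.sqrt nn%:R.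

Definition success (Delta : R) (t : nat) (TX : {set node}) (i j : node) : bool :=
  [forall l : node, ((l \in TX) && (l != i)) ==>
     ((1 + Delta) * sdist (loc i t) (loc j t) <= sdist (loc l t) (loc j t))].

Variables (pD alpha Delta : R).

(* state: relay-queue lengths (node, pair) and delivered packets per pair *)
Definition state := ((node -> nat -> nat) * (nat -> nat))%type.

Definition nbr_list (t : nat) (s : node) : seq node := [seq j <- enum 'I_nn | nbr t s j].
Definition relayA (t : nat) (s : node) : option node :=
  let N := nbr_list t s in
  if [&& is_source s, u (tag_actA, t, val s, 0)%N < pD, (0 < size N)%N
       & u (tag_alpha, t, val s, 0)%N < alpha]
  then Some (nth s N (pickidx (size N) (u (tag_relay, t, val s, 0)%N)))
  else None.
Definition TXA (t : nat) : {set node} := [set s | relayA t s != None].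
Definition okA (t : nat) (s : node) : bool :=
  if relayA t s is Some r then success Delta t (TXA t) s r else false.
Definition to_dest (s r : node) : bool := rank r == (rank s).+1.

Definition dest_list (t : nat) (v : node) : seq node :=
  [seq j <- enum 'I_nn | nbr t v j && is_dest j].
Definition chooseB (t : nat) (v : node) : option node :=
  let D := dest_list t v in
  if (u (tag_actB, t, val v, 0)%N < pD) && (0 < size D)%N
  then Some (nth v D (pickidx (size D) (u (tag_dest, t, val v, 0)%N)))
  else None.
Definition sendB (t : nat) (Q : node -> nat -> nat) (v : node) : option node :=
  if chooseB t v is Some d then (if (0 < Q v (pair_of d))%N then Some d else None)
  else None.
Definition TXB t Q : {set node} := [set v | sendB t Q v != None].
Definition okB t Q (v : node) : bool :=
  if sendB t Q v is Some d then success Delta t (TXB t Q) v d else false.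
Definition targetB t Q (v : node) : nat :=
  if sendB t Q v is Some d then pair_of d else 0%N.

Definition stepSigma (t : nat) (st : state) : state :=
  let: (Q, D) := st in
  let Q1 := fun (v : node) (p : nat) =>
    (Q v p + #|[set s | okA t s && (relayA t s == Some v) && ~~ to_dest s v
                        && (pair_of s == p)]|)%N in
  let D1 := fun p =>
    (D p + #|[set s | okA t s &&
                 (if relayA t s is Some r then to_dest s r else false)
                 && (pair_of s == p)]|)%N in
  let Q2 := fun (v : node) (p : nat) =>
    (Q1 v p - (okB t Q1 v && (targetB t Q1 v == p)))%N in
  let D2 := fun p => (D1 p + #|[set v | okB t Q1 v && (targetB t Q1 v == p)]|)%N in
  (Q2, D2).

Fixpoint stateSigma (t : nat) : state :=
  match t with
  | 0 => (fun _ _ => 0%N, fun _ => 0%N)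
  | t'.+1 => stepSigma t' (stateSigma t')
  end.

Variables (c1 c2 W : R).
Definition bits_Pi (p t : nat) : R :=
  if `[< typical Delta c1 c2 >] then W * ((stateSigma t).2 p)%:R
  else W * (count (fun s => s %% npairs == p)%N (iota 0 t))%:R.

Definition event_A (T : R) : Prop :=
  forall p : nat, (p < npairs)%N ->
    (T%:E <= limn_einf (fun t => (bits_Pi p t / t%:R)%:E))%E.

End Model.

(* Main.v *)
Require Import Defs.
From mathcomp Require Import all_boot all_order all_algebra.
From mathcomp Require Import all_classical all_reals all_analysis.
From mathcomp Require Import measurable_realfun ring lra zify.
Set Implicit Arguments. Unset Strict Implicit. Unset Printing Implicit Defensive.
Import Order.TTheory GRing.Theory Num.Theory.
Import numFieldNormedType.Exports.
Local Open Scope ring_scope.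
Local Open Scope classical_set_scope.

(** Write m = sqrt n.  A great circle passes through the disk C_ij only if its pole lies in a
    strip of width O(1/m) around the plane orthogonal to z_ij, and does so if the pole lies in a
    slightly thinner one.  A strip of width r carries a fraction of order r of the sphere, so by
    Chernoff bounds and a union bound over a net of O(m^3) strips all strips contain Theta(m) of
    the n poles with probability tending to 1: the configuration is typical.

    On a typical configuration, only O(m) circles pass through C_ij, and each of the nodes on
    them is near z_ij with stationary probability O(1/m); hence with stationary probability at
    least c/n the nodes i and j are alone at z_ij and draw prescribed coins, in which case the
    transmission between them succeeds.  The walks form a finite connected chain with doubly
    stochastic kernel; Poisson's equation, Chebyshev's inequality and Borel-Cantelli along the
    times 2^j show that almost every path exhibits these frequencies.  Between the times 2^j and
    2^(j+1) a relay delivers at least the minimum of what it received before 2^j and of its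
    service opportunities after 2^j, and summing over the n - 2 relays of a pair gives a number
    of delivered packets which is linear in time, uniformly in n. *)

(** * Independent uniform seeds *)

(** The seeds are real numbers, but quantitative estimates look only at the cell of a seed in an
    equal subdivision of [0, 1]: laws become uniform on finite sets and probabilities become ratios
    of cardinalities. For the walks the number of cells is a multiple of 3, so that a cell
    determines a step exactly; the thresholds [pD] and [alpha] need not be cell boundaries, so a
    coin is asked to fall into an extreme cell. The queues of all pairs are coupled, since a node
    transmits only if it holds a packet and then interferes with others. No stationary law of the
    queues is sought: the meetings that are counted are described by positions and coins alone, and
    they force the transmission to succeed whatever the other nodes hold. Arrivals and service
    opportunities at a relay have lower bounds of the same order, with no drift in favour of
    service; this is harmless because arrivals before 2^j are compared with services after 2^j. The
    throughput event is not shown to be measurable; it is bounded from below by a measurable subset.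
    Configurations that are not typical enter only through their vanishing probability. *)

Lemma measurable_rays (R : realType) :
  @measurable _ (measurableTypeR R) =
  <<s [set A | exists a : R, A = `]-oo, a]] >>.
Proof.
rewrite [LHS](RGenOInfty.measurableE R); apply/seteqP; split.
  apply: smallest_sub; first exact: smallest_sigma_algebra.
  move=> _ [a ->]; rewrite -setCitvl; apply: (@measurableC _ (g_sigma_algebraType _)).
  by apply: sub_sigma_algebra; exists a.
apply: smallest_sub; first exact: smallest_sigma_algebra.
move=> _ [a ->]; rewrite -setCitvr; apply: (@measurableC _ (g_sigma_algebraType _)).
by apply: sub_sigma_algebra; exists a.
Qed.

(** Rays form a pi-system that generates the Borel sets, and they exhaust the line with finite
    measure. *)
Lemma ray_measure_unique (R : realType) (m1 m2 : measure (measurableTypeR R) R) :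
  (forall a, m1 `]-oo, a] = m2 `]-oo, a]) -> (m1 setT < +oo)%E ->
  forall B, measurable B -> m1 B = m2 B.
Proof.
move=> h1 fin1 B mB.
have := @measure_unique _ R (measurableTypeR R) [set A | exists a : R, A = `]-oo, a]]
  (fun k : nat => `]-oo, k%:R]) (measurable_rays R).
move=> /(_ _ _ _ m1 m2) h; apply: h => //.
- move=> _ _ [a ->] [b ->]; exists (Num.min a b).
  by apply/seteqP; split=> x; rewrite /= !in_itv/= le_min => /andP.
- by move=> k; exists k%:R.
- apply/seteqP; split=> // x _; exists (Num.truncn x).+1 => //.
  by rewrite /= in_itv/= ltW// truncnS_gt.
- by move=> _ [a ->]; exact: h1.
- by move=> k; apply: le_lt_trans fin1; apply: le_measure; rewrite ?inE.
Qed.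

Lemma bigcap_cons (T : choiceType) (V : Type) (x : T) (s : seq T) (F : T -> set V) :
  \bigcap_(t in [set` x :: s]) F t = F x `&` \bigcap_(t in [set` s]) F t.
Proof. by rewrite !bigcap_seq big_cons. Qed.

Section Independence.
Variables (R : realType) (d : measure_display) (Omega : measurableType d).
Variables (P : probability Omega R) (U : label -> Omega -> R).
Hypothesis iidU : iid_uniform_seeds P U.

Let mU l : measurable_fun setT (U l) := iidU.1 l.

(** The law of the seeds is given for thresholds in [0, 1]; truncation to this interval extends the
    formula to all real thresholds. *)
Let clamp (a : R) : R := Num.max 0 (Num.min a 1).

Lemma seed_measurable l (B : set R) : measurable B -> measurable (U l @^-1` B).
Proof. by move=> mB; rewrite -[X in measurable X]setTI; exact: mU. Qed.

Lemma seeds_measurable (s : seq label) (B : label -> set R) :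
  (forall l, measurable (B l)) -> measurable (\bigcap_(l in [set` s]) (U l @^-1` B l)).
Proof.
move=> mB; rewrite bigcap_seq; elim/big_rec: _ => [|l x _ mx]; first exact: measurableT.
by apply: measurableI => //; exact: seed_measurable.
Qed.

Lemma seed_le l a : 0 <= a <= 1 -> P (U l @^-1` `]-oo, a]) = a%:E.
Proof.
move=> a01; have := iidU.2 [:: l] (fun=> a) erefl (fun=> a01).
rewrite big_seq1 => <-; congr (P _); apply/seteqP; split=> w /=; rewrite in_itv/=.
  by move=> h x /=; rewrite inE => /eqP ->.
by apply; rewrite /= inE.
Qed.

Lemma seed_le0 l : P (U l @^-1` `]-oo, 0]) = 0%E.
Proof. by rewrite seed_le// lexx ler01. Qed.

Lemma seed_gt1 l : P (U l @^-1` `]1, +oo[) = 0%E.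
Proof.
rewrite -setCitvl preimage_setC probability_setC; last first.
  by apply: (@seed_measurable l `]-oo, 1]); exact: measurable_itv.
by rewrite seed_le ?subee// ler01 lexx.
Qed.

(** A negative threshold makes both sides vanish. Otherwise truncating the thresholds at 1 changes
    the event only inside the null event [N] that some seed exceeds 1. *)
Lemma seeds_le (s : seq label) (a : label -> R) : uniq s ->
  P (\bigcap_(l in [set` s]) (U l @^-1` `]-oo, a l])) = (\prod_(l <- s) clamp (a l))%:E.
Proof.
move=> us.
have mA b : measurable (\bigcap_(l in [set` s]) (U l @^-1` `]-oo, b l])).
  exact: seeds_measurable.
have [[l [ls al]]|a0] := pselect (exists l, l \in s /\ a l < 0).
  rewrite (bigD1_seq l)//= {1}/clamp max_l ?mul0r; last first.
    by rewrite ge_min (ltW al).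
  apply/eqP; rewrite eq_le measure_ge0 andbT -[leRHS](seed_le0 l).
  apply: le_measure; rewrite ?inE//; first exact: seed_measurable.
  by move=> w /(_ l ls); rewrite /= !in_itv/= => /le_trans -> //; exact: ltW.
have a0' l : l \in s -> 0 <= a l.
  by move=> ls; rewrite leNgt; apply/negP => al; apply: a0; exists l.
pose N := \big[setU/set0]_(l <- s) (U l @^-1` `]1, +oo[).
have mN : measurable N.
  by rewrite /N; elim/big_rec: _ => // l x _ mx; apply: measurableU => //; exact: seed_measurable.
have N0 : P N = 0%E.
  rewrite /N; elim: (s) => [|l' s' ih]; first by rewrite big_nil measure0.
  rewrite big_cons setUC measureU0//; last exact: seed_gt1.
  - by elim/big_rec: _ => // l2 x _ mx; apply: measurableU => //; exact: seed_measurable.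
  - exact: seed_measurable.
have cl01 l' : 0 <= clamp (a l') <= 1.
  by rewrite /clamp le_max lexx /= ge_max ler01 ge_min lexx orbT.
rewrite -(iidU.2 s (clamp \o a) us cl01).
rewrite (_ : \bigcap_(_ in _) [set _ | _] =
   \bigcap_(l in [set` s]) (U l @^-1` `]-oo, clamp (a l)])); last first.
  by apply: eq_bigcapr => l _; apply/seteqP; split => w; rewrite /= in_itv.
apply/eqP; rewrite eq_le; apply/andP; split; last first.
  apply: le_measure; rewrite ?inE// => w h l ls; have := h l ls.
  rewrite /= !in_itv/= => /le_trans -> //; rewrite ge_max a0'//.
  by rewrite ge_min lexx.
apply: (@le_trans _ _ (P ((\bigcap_(l in [set` s]) (U l @^-1` `]-oo, clamp (a l)])) `|` N))).
  apply: le_measure; rewrite ?inE//; first by apply: measurableU.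
  move=> w h; have [[l ls wl]|nN] := pselect (exists2 l, l \in s & 1 < U l w).
    right; rewrite /N (bigD1_seq l)//=; left => /=.
    by rewrite in_itv/= wl.
  left => l ls /=; rewrite in_itv/= le_max le_min; apply/orP; right.
  have := h l ls; rewrite /= in_itv/= => -> /=.
  by rewrite leNgt; apply/negP => wl; apply: nN; exists l.
by rewrite (@measureU0 _ _ _ P).
Qed.


(** Rays are replaced by Borel sets one label at a time. For the label [l], [m1] is its law
    restricted to the event [C] fixed by the other labels and [m2] its full law weighted by the
    probability of [C]; on rays they agree by the induction hypothesis with [l] moved to [s2], hence
    on all Borel sets. *)
Lemma seeds_indep_mixed (s1 s2 : seq label) (B : label -> set (measurableTypeR R))
    (a : label -> R) :
  uniq (s1 ++ s2) -> (forall l, measurable (B l)) ->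
  P (\bigcap_(l in [set` s1]) (U l @^-1` B l) `&`
     \bigcap_(l in [set` s2]) (U l @^-1` `]-oo, a l])) =
  (\prod_(l <- s1) fine (P (U l @^-1` B l)) * \prod_(l <- s2) clamp (a l))%:E.
Proof.
elim: s1 s2 B a => [|l s1 ih] s2 B a /= us mB.
  by rewrite big_nil mul1r set_nil bigcap_set0 setTI; exact: seeds_le.
case/andP: us; rewrite mem_cat negb_or => /andP[ls1 ls2] us.
pose C := \bigcap_(l in [set` s1]) (U l @^-1` B l) `&`
     \bigcap_(l in [set` s2]) (U l @^-1` `]-oo, a l]).
have mC : measurable C by apply: measurableI; exact: seeds_measurable.
pose c := fine (P C).
have c0 : 0 <= c by rewrite fine_ge0.
pose f : Omega -> measurableTypeR R := U l.
have mf : measurable_fun [set: Omega] f by exact: mU.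
pose m1 : measure (measurableTypeR R) R := pushforward (mrestr P mC) f.
pose m2 : measure (measurableTypeR R) R := mscale (NngNum c0) (pushforward P f).
rewrite bigcap_cons.
have -> : U l @^-1` B l `&` \bigcap_(l in [set` s1]) (U l @^-1` B l) `&`
     \bigcap_(l in [set` s2]) (U l @^-1` `]-oo, a l]) = U l @^-1` B l `&` C.
  by rewrite setIA.
have PE (A : set Omega) : measurable A -> P A = (fine (P A))%:E.
  by move=> mA; rewrite fineK ?fin_num_measure.
transitivity (m1 mf (B l)); first by [].
rewrite (@ray_measure_unique _ (m1 mf) (m2 mf)) //.
- rewrite /m2 /= /mscale /= /pushforward big_cons [P (f @^-1` B l)]PE; last first.
    by rewrite -[X in measurable X]setTI; exact: mf.
  by rewrite /= /c /C ih//= -EFinM mulrC mulrA.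
- move=> x; rewrite /m1 /m2 /= /mscale /mrestr /pushforward /= -/C.
  have -> : f @^-1` `]-oo, x] `&` C = \bigcap_(l in [set` s1]) (U l @^-1` B l) `&`
     \bigcap_(l' in [set` l :: s2]) (U l' @^-1` `]-oo, if l' == l then x else a l']).
    rewrite bigcap_cons eqxx setICA; congr (_ `&` _).
    congr (_ `&` _); apply: eq_bigcapr => l' /= l's2; case: eqVneq => // e.
    by rewrite -e l's2 in ls2.
  rewrite ih//; last first.
    by rewrite -cat1s uniq_catCA /= mem_cat negb_or ls1 ls2.
  rewrite big_cons eqxx /c /C ih//=.
  have /= := @seeds_le [:: l] (fun=> x) erefl.
  rewrite bigcap_seq !big_seq1 => h.
  rewrite (_ : pushforward P f _ = (clamp x)%:E)// -EFinM; congr (_%:E).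
  rewrite -mulrA; congr (_ * _); rewrite mulrC; congr (_ * _).
  apply: eq_big_seq => l' l's2; case: eqVneq => // e.
  by rewrite -e l's2 in ls2.
- rewrite /m1 /= /pushforward /mrestr preimage_setT setTI.
  by rewrite -ge0_fin_numE ?fin_num_measure.
Qed.

Lemma seeds_indep (s : seq label) (B : label -> set (measurableTypeR R)) :
  uniq s -> (forall l, measurable (B l)) ->
  P (\bigcap_(l in [set` s]) (U l @^-1` B l)) =
  (\prod_(l <- s) fine (P (U l @^-1` B l)))%:E.
Proof.
move=> us mB; have := @seeds_indep_mixed s [::] B (fun=> 0).
by rewrite cats0 set_nil bigcap_set0 setIT big_nil mulr1 => ->.
Qed.

Lemma seed_lt l a : 0 <= a <= 1 -> P (U l @^-1` `]-oo, a[) = a%:E.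
Proof.
case/andP=> a0 a1.
have mI (i : interval R) : measurable (U l @^-1` [set` i]).
  by apply: seed_measurable; exact: measurable_itv.
apply/eqP; rewrite eq_le; apply/andP; split.
  rewrite -[leRHS](@seed_le l) ?a0//; apply: le_measure; rewrite ?inE//.
  by move=> w /=; rewrite !in_itv/=; exact: ltW.
apply/lee_addgt0Pr => e e0; rewrite -leeBlDr//.
have [ea|ea] := leP a e.
  by apply: (@le_trans _ _ 0%E) => //; rewrite -EFinB lee_fin subr_le0.
rewrite -EFinB -[leLHS](@seed_le l); last by rewrite subr_ge0 (ltW ea)/=; lra.
apply: le_measure; rewrite ?inE//.
by move=> w /=; rewrite !in_itv/= => h; lra.
Qed.

(* Values of [x] outside [0, 1] go to the extreme cells. *)
Definition cell (M : nat) (x : R) : 'I_M.+1 := inord (pickidx M.+1 x).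

Lemma val_cell M x : cell M x = pickidx M.+1 x :> nat.
Proof. by rewrite inordK// ltnS geq_minr. Qed.

Lemma cell_le M x (q : nat) : (q < M)%N ->
  (cell M x <= q)%N = (x < q.+1%:R / M.+1%:R).
Proof.
move=> qM; rewrite val_cell /pickidx geq_min [(M <= q)%N]leqNgt qM orbF/=.
by rewrite truncn_le_nat ltr_pdivlMr ?ltr0n// mulrC.
Qed.

Lemma cell_prob M l (q : 'I_M.+1) :
  P [set w | cell M (U l w) = q] = (M.+1%:R^-1)%:E.
Proof.
have mle (r : nat) : measurable [set w | (cell M (U l w) <= r)%N] /\
    ((r < M.+1)%N -> P [set w | (cell M (U l w) <= r)%N] = (r.+1%:R / M.+1%:R)%:E).
  have [rM|Mr] := ltnP r M; last first.
    rewrite (_ : [set _ | _] = setT).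
      split=> // rM; have -> : r = M by apply/eqP; rewrite eqn_leq Mr -ltnS rM.
      by rewrite probability_setT divff.
    by apply/seteqP; split=> // w _ /=; rewrite (leq_trans _ Mr)// -ltnS.
  rewrite (_ : [set _ | _] = U l @^-1` `]-oo, r.+1%:R / M.+1%:R[).
    split; first by apply: seed_measurable; exact: measurable_itv.
    rewrite ltnS => rM'; rewrite seed_lt// divr_ge0//= ler_pdivrMr// mul1r ler_nat.
    by rewrite ltnS.
  by apply/seteqP; split => w; rewrite /= in_itv/= cell_le.
case: q => -[|q] qM.
  rewrite (_ : [set _ | _] = [set w | (cell M (U l w) <= 0)%N]).
    by rewrite (mle 0%N).2// mul1r.
  apply/seteqP; split => w /= ; first by move=> ->.
  by rewrite leqn0 => /eqP h; apply/val_inj.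
rewrite (_ : [set _ | _] = [set w | (cell M (U l w) <= q.+1)%N] `\`
   [set w | (cell M (U l w) <= q)%N]).
  rewrite measureD; [|exact: (mle q.+1).1|exact: (mle q).1|]; last first.
    by rewrite -ge0_fin_numE ?fin_num_measure//; exact: (mle q.+1).1.
  rewrite setIidr; last by move=> w /= /leqW.
  rewrite /= (mle q.+1).2// (mle q).2 ?(ltnW qM)// -EFinB -mulrBl -natrB// subSn// subnn mul1r.
  by [].
apply/seteqP; split => w /= ; first by move=> ->; rewrite leqnn ltnn.
by case=> h1 h2; apply/val_inj => /=; apply/eqP; rewrite eqn_leq h1 ltnNge; apply/negP.
Qed.

(** * Joint law of the cells of finitely many seeds *)

Section Cells.
Variables (I J : finType) (M : nat) (lab : I -> J -> label).
Hypothesis lab_inj : injective (fun p : I * J => lab p.1 p.2).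

(** The two index levels serve both uses: times and the seeds of a slot for the walks, nodes and the
    two coordinates of a pole for the configuration. *)
Definition cells (w : Omega) : {ffun I -> {ffun J -> 'I_M.+1}} :=
  [ffun i => [ffun j => cell M (U (lab i j) w)]].

Lemma cells1 (z : {ffun I -> {ffun J -> 'I_M.+1}}) :
  measurable [set w | cells w = z] /\
  P [set w | cells w = z] = ((M.+1%:R ^+ (#|I| * #|J|))^-1)%:E.
Proof.
pose s := [seq lab p.1 p.2 | p <- enum {: I * J}].
have us : uniq s by rewrite map_inj_uniq ?enum_uniq.
(* [q] inverts [lab]; a label outside its range gets [None], which no cell matches. *)
pose q (l : label) : option 'I_M.+1 :=
  omap (fun p : I * J => z p.1 p.2) [pick p : I * J | lab p.1 p.2 == l].
have qE i j : q (lab i j) = Some (z i j).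
  rewrite /q; case: pickP => [[i' j'] /= /eqP e|/(_ (i, j))]; last by rewrite /= eqxx.
  by have /= [-> ->] := @lab_inj (i', j') (i, j) e.
pose B (l : label) : set (measurableTypeR R) := [set x | Some (cell M x) = q l].
have mB l : measurable (B l).
  rewrite /B; case: (q l) => [c|]; last first.
    by rewrite (_ : [set _ | _] = set0)//; apply/seteqP; split.
  have mle (r : nat) : measurable [set x : measurableTypeR R | (cell M x <= r)%N].
    have [rM|Mr] := ltnP r M; last first.
      rewrite (_ : [set _ | _] = setT)//; apply/seteqP; split=> // w _ /=.
      by rewrite (leq_trans _ Mr)// -ltnS.
    rewrite (_ : [set _ | _] = `]-oo, r.+1%:R / M.+1%:R[); first exact: measurable_itv.
    by apply/seteqP; split => w; rewrite /= in_itv/= cell_le.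
  case: c => -[|c] cM.
    rewrite (_ : [set _ | _] = [set x | (cell M x <= 0)%N])//.
    apply/seteqP; split => w /= ; first by move=> [->].
    by rewrite leqn0 => /eqP h; congr Some; apply/val_inj.
  rewrite (_ : [set _ | _] = [set w | (cell M w <= c.+1)%N] `\`
     [set w | (cell M w <= c)%N]); first exact: measurableD.
  apply/seteqP; split => w /= ; first by move=> [->]; rewrite leqnn ltnn.
  case=> h1 h2; congr Some; apply/val_inj => /=; apply/eqP.
  by rewrite eqn_leq h1 ltnNge; apply/negP.
have E : [set w | cells w = z] = \bigcap_(l in [set` s]) (U l @^-1` B l).
  apply/seteqP; split => w /=.
    move=> wz l /= /mapP[[i j] _ ->{l}]; rewrite /B /= qE -wz !ffunE//.
  move=> h; apply/ffunP => i; apply/ffunP => j; rewrite !ffunE.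
  have /= := h (lab i j); rewrite /B /= qE => hh.
  suff [] : Some (cell M (U (lab i j) w)) = Some (z i j) by [].
  by apply: hh; apply/mapP; exists (i, j) => //; rewrite mem_enum.
rewrite E; split; first exact: seeds_measurable.
rewrite seeds_indep//; congr (_%:E); rewrite /s big_map big_enum /=.
under eq_bigr => p _.
  rewrite (_ : U _ @^-1` _ = [set w | cell M (U (lab p.1 p.2) w) = z p.1 p.2]); last first.
    by apply/seteqP; split => w; rewrite /B /= qE; [case|move=> ->].
  rewrite cell_prob /=; over.
by rewrite prodr_const card_prod exprVn.
Qed.

Lemma cells_measurable (A : {set {ffun I -> {ffun J -> 'I_M.+1}}}) :
  measurable [set w | cells w \in A].
Proof.
have -> : [set w | cells w \in A] = \bigcup_(z in [set` A]) [set w | cells w = z].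
  by apply/seteqP; split => w /=; [move=> h; exists (cells w)|case=> z /= zA ->].
by apply: fin_bigcup_measurable => // z _; exact: (cells1 z).1.
Qed.

Lemma cells_prob (A : {set {ffun I -> {ffun J -> 'I_M.+1}}}) :
  P [set w | cells w \in A] = (#|A|%:R / #|{: {ffun I -> {ffun J -> 'I_M.+1}}}|%:R)%:E.
Proof.
have -> : [set w | cells w \in A] = \bigcup_(z in [set` A]) [set w | cells w = z].
  by apply/seteqP; split => w /=; [move=> h; exists (cells w)|case=> z /= zA ->].
rewrite measure_fin_bigcup//; last 2 first.
- by move=> z1 z2 _ _ [w /= []] -> ->.
- by move=> z _; exact: (cells1 z).1.
rewrite (@fsbigE _ _ _ _ _ (enum A)) ?enum_uniq//; last 2 first.
- by move=> z /=; rewrite mem_enum.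
- by move=> z /=; rewrite mem_enum => ->.
rewrite (eq_bigr (fun=> ((M.+1%:R ^+ (#|I| * #|J|))^-1)%:E)) => [|z _]; last exact: (cells1 z).2.
rewrite big_enum_cond/= sumEFin (eq_bigl (mem A)); last first.
  by move=> z /=; rewrite andb_idr// => zA; rewrite inE.
by rewrite sumr_const !card_ffun card_ord !natrX -exprM mulnC mulr_natl.
Qed.
End Cells.
End Independence.

(** * Frequencies in finite chains with doubly stochastic kernel *)

Section Trajectories.
Variables (S Y : Type) (f : S -> Y -> S) (h : S -> Y -> bool).

Fixpoint trajectory (s : S) (x : nat -> Y) (t : nat) : S :=
  if t is t'.+1 then f (trajectory s x t') (x t') else s.

Fixpoint hits (s : S) (x : nat -> Y) (t : nat) : nat :=
  if t is t'.+1 then (hits s x t' + h (trajectory s x t') (x t'))%N else 0%N.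

Lemma eq_trajectory s x x' t :
  (forall i, (i < t)%N -> x i = x' i) -> trajectory s x t = trajectory s x' t.
Proof.
by elim: t => //= t ih e; rewrite ih ?e// => i it; apply: e; rewrite ltnS ltnW.
Qed.

Lemma eq_hits s x x' t :
  (forall i, (i < t)%N -> x i = x' i) -> hits s x t = hits s x' t.
Proof.
elim: t => //= t ih e; have e' i : (i < t)%N -> x i = x' i.
  by move=> it; apply: e; rewrite ltnS ltnW.
by rewrite ih ?e// (eq_trajectory _ e').
Qed.

End Trajectories.

Section FinSeq.
Variables (Y : finType) (y0 : Y).

(** The default [y0] pads the sequence; the state and the count at time [T] read only the first [T]
    entries. *)
Definition extend (T : nat) (x : {ffun 'I_T -> Y}) (t : nat) : Y :=
  if insub t is Some i then x i else y0.

Definition ffun_rcons (T : nat) (x : {ffun 'I_T -> Y}) (y : Y) : {ffun 'I_T.+1 -> Y} :=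
  [ffun i => if unlift ord_max i is Some j then x j else y].

Lemma extend_rcons_lt T (x : {ffun 'I_T -> Y}) y t :
  (t < T)%N -> extend (ffun_rcons x y) t = extend x t.
Proof.
move=> tT; rewrite /extend insubT ?(leqW tT)// => h; rewrite insubT ffunE.
have -> : Sub t h = lift ord_max (Ordinal tT).
  by apply: val_inj; rewrite /= /bump leqNgt tT.
by rewrite liftK; congr (x _); apply: val_inj.
Qed.

Lemma extend_rcons_last T (x : {ffun 'I_T -> Y}) y : extend (ffun_rcons x y) T = y.
Proof.
rewrite /extend insubT ?leqnn// => h; rewrite ffunE.
have -> : Sub T h = ord_max by apply: val_inj.
by rewrite unlift_none.
Qed.

Lemma sum_ffun_rcons (V : nmodType) T (F : {ffun 'I_T.+1 -> Y} -> V) :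
  \sum_x F x = \sum_x \sum_y F (ffun_rcons x y).
Proof.
rewrite pair_big /= (reindex (fun p => ffun_rcons p.1 p.2)) //=.
exists (fun x => ([ffun i => x (lift ord_max i)], x ord_max)) => [[x y] _|x _] /=.
  rewrite !ffunE unlift_none; congr (_, _); apply/ffunP => i.
  by rewrite !ffunE liftK.
apply/ffunP => i; rewrite ffunE; case: unliftP => [j ->|->] //.
by rewrite ffunE.
Qed.
End FinSeq.

Section Ergodic.
Variables (R : realFieldType) (S Y : finType) (f : S -> Y -> S) (y0 : Y).
(** Injectivity for each input makes the kernel doubly stochastic, so the uniform law is stationary;
    [f_conn] is irreducibility in the form that invariant functions are constant. *)
Hypothesis f_inj : forall y, injective (f^~ y).
Hypothesis f_conn : forall c : S -> R,
  (forall s y, c (f s y) = c s) -> forall s s', c s = c s'.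

(* For a doubly stochastic kernel, expanding [\sum (c (f s y) - c s)^2] for a
   stationary [c] gives 0. *)
Lemma stationary_invariant (c : S -> R) :
  (forall s', \sum_s \sum_y (f s y == s')%:R * c s = #|Y|%:R * c s') ->
  forall s y, c (f s y) = c s.
Proof.
move=> cst.
have E1 : \sum_s \sum_y c (f s y) ^+ 2 = #|Y|%:R * \sum_s c s ^+ 2.
  rewrite exchange_big /= (eq_bigr (fun=> \sum_s c s ^+ 2)).
    by rewrite sumr_const mulr_natl.
  by move=> y _; rewrite [RHS](reindex_inj (@f_inj y)).
have E2 : \sum_s \sum_y c (f s y) * c s = #|Y|%:R * \sum_s c s ^+ 2.
  transitivity (\sum_s' c s' * \sum_s \sum_y (f s y == s')%:R * c s).
    under [RHS]eq_bigr => s' _ do rewrite mulr_sumr.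
    rewrite [RHS]exchange_big /=; apply: eq_bigr => s _.
    under [RHS]eq_bigr => s' _ do rewrite mulr_sumr.
    rewrite [RHS]exchange_big /=; apply: eq_bigr => y _.
    rewrite (bigD1 (f s y))//= eqxx mul1r big1 ?addr0// => s' /negbTE ns.
    by rewrite eq_sym ns mul0r mulr0.
  rewrite mulr_sumr; apply: eq_bigr => s' _; rewrite cst expr2; ring.
have : \sum_s \sum_y (c (f s y) - c s) ^+ 2 = 0.
  transitivity (\sum_s \sum_y c (f s y) ^+ 2 - 2 * (\sum_s \sum_y c (f s y) * c s) +
    \sum_s \sum_(y : Y) c s ^+ 2).
    rewrite mulr_sumr -sumrB -big_split /=; apply: eq_bigr => s _.
    rewrite mulr_sumr -sumrB -big_split /=; apply: eq_bigr => y _; ring.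
  rewrite E1 E2 [X in _ + X](eq_bigr (fun s => #|Y|%:R * c s ^+ 2)) => [|s _].
    by rewrite -mulr_sumr; ring.
  by rewrite sumr_const mulr_natl.
move=> E0 s y.
have sge0 (s' : S) : true -> 0 <= \sum_y' (c (f s' y') - c s') ^+ 2.
  by move=> _; apply: sumr_ge0 => y' _; exact: sqr_ge0.
have /eqP := psumr_eq0P sge0 E0 (i := s) isT.
rewrite psumr_eq0 => [/allP /(_ y)|y' _]; last exact: sqr_ge0.
by rewrite mem_index_enum => /(_ isT) /=; rewrite sqrf_eq0 subr_eq0 => /eqP.
Qed.

(** Fredholm alternative. A row vector [D] times [A] is the left-hand side of the equation, so [H]
    has to lie in the row space of [A], that is, to be annihilated by the cokernel. The columns of
    the cokernel are stationary functions, hence constants, and a constant annihilates [H] because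
    [H] has sum 0. *)
Lemma poisson_equation (H : S -> R) : \sum_s H s = 0 ->
  exists g : S -> R, forall s, \sum_y (g (f s y) - g s) = H s.
Proof.
move=> H0.
pose A : 'M[R]_#|S| := \matrix_(j, i)
  (\sum_y (f (enum_val i) y == enum_val j)%:R - #|Y|%:R * (i == j)%:R).
pose hv : 'rV[R]_#|S| := \row_i H (enum_val i).
have AC : A *m cokermx A = 0 by exact: mulmx_coker.
have cE k : exists b, forall i, cokermx A i k = b.
  pose c s := cokermx A (enum_rank s) k.
  have cst s' : \sum_s \sum_y (f s y == s')%:R * c s = #|Y|%:R * c s'.
    move/matrixP: AC => /(_ (enum_rank s') k); rewrite !mxE => /eqP.
    under eq_bigr => i _ do rewrite mxE mulrBl enum_rankK.
    rewrite sumrB subr_eq0 => /eqP E.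
    transitivity (\sum_i (\sum_y (f (enum_val i) y == s')%:R) * cokermx A i k).
      rewrite (reindex (@enum_val _ (mem S))) /=; last exact/onW_bij/enum_val_bij.
      by apply: eq_bigr => i _; rewrite /c enum_valK mulr_suml.
    rewrite E (bigD1 (enum_rank s'))//= eqxx mulr1 big1 ?addr0// => i /negbTE ->.
    by rewrite mulr0 mul0r.
  have inv := f_conn (stationary_invariant cst).
  have [s0|noS] := pickP (mem S).
    by move=> _; exists (c s0) => i; rewrite -(inv (enum_val i) s0) /c enum_valK.
  by exists 0 => i; have := noS (enum_val i); rewrite inE.
have /submxP[D hD] : (hv <= A)%MS.
  rewrite submxE; apply/eqP/rowP => k; rewrite !mxE.
  have [b bE] := cE k.
  under eq_bigr => i _ do rewrite bE mxE.
  rewrite -mulr_suml [X in X * _](_ : _ = \sum_s H s); first by rewrite H0 mul0r.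
  by rewrite [RHS](reindex (@enum_val _ (mem S))) //=; exact/onW_bij/enum_val_bij.
exists (fun s => D 0 (enum_rank s)) => s.
have /rowP/(_ (enum_rank s)) := hD; rewrite !mxE enum_rankK => ->.
under [RHS]eq_bigr => j _ do rewrite mxE mulrBr enum_rankK.
rewrite !sumrB; congr (_ - _).
  under [RHS]eq_bigr => j _ do rewrite mulr_sumr.
  rewrite exchange_big /=; apply: eq_bigr => y _.
  rewrite (bigD1 (enum_rank (f s y)))//= enum_rankK eqxx mulr1 big1 ?addr0// => j nj.
  case: eqP => [e|_]; last by rewrite mulr0.
  by rewrite e enum_valK eqxx in nj.
rewrite sumr_const (bigD1 (enum_rank s))//= eqxx mulr1 big1 ?addr0 => [|j].
  by rewrite mulrC mulr_natl.
by rewrite eq_sym => /negbTE ->; rewrite !mulr0.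
Qed.

Variable h : S -> Y -> bool.

Definition hit_rate : R := (\sum_s \sum_y (h s y)%:R) / (#|S|%:R * #|Y|%:R).

Lemma Y_gt0 : (0 < #|Y|)%N. Proof. by apply/card_gt0P; exists y0. Qed.

(* [g] solves Poisson's equation, so that [hits - hit_rate * T + g (trajectory T)]
   is a martingale with bounded increments. *)
Lemma hits_variance : exists C : R, 0 < C /\ forall (T : nat) (s : S),
  \sum_(x : {ffun 'I_T -> Y}) ((hits f h s (extend y0 x) T)%:R - hit_rate * T%:R) ^+ 2
    <= C * T.+1%:R * #|{ffun 'I_T -> Y}|%:R.
Proof.
have [s0 _|noS] := pickP (mem S); last first.
  by exists 1; split=> // T s; have := noS s; rewrite inE.
have S0 : #|S|%:R != 0 :> R by rewrite pnatr_eq0 -lt0n; apply/card_gt0P; exists s0.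
have Y0 : #|Y|%:R != 0 :> R by rewrite pnatr_eq0 -lt0n Y_gt0.
set q := hit_rate.
have [g gE] : exists g : S -> R, forall s,
    \sum_y (g (f s y) - g s) = #|Y|%:R * q - \sum_y (h s y)%:R.
  apply: poisson_equation; rewrite sumrB sumr_const -[_ *+ _]mulr_natl /q /hit_rate.
  rewrite -mulr_natl; field.
  by rewrite S0 Y0.
pose D s y := (h s y)%:R - q + (g (f s y) - g s).
have D0 s : \sum_y D s y = 0.
  rewrite big_split/= gE sumrB sumr_const -[q *+ _]mulr_natl; ring.
pose G := \sum_s `|g s|.
have gG s : `|g s| <= G by rewrite /G (bigD1 s)//= lerDl sumr_ge0.
pose B := 1 + `|q| + 2 * G.
have G0 : 0 <= G by rewrite /G sumr_ge0.
have B0 : 0 <= B by rewrite /B; have := normr_ge0 q; lra.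
have DB s y : `|D s y| <= B.
  rewrite /D /B; have := gG s; have := gG (f s y).
  have h01 : `|(h s y)%:R : R| <= 1 by case: (h s y); rewrite ?normr1 ?normr0.
  have := ler_normD ((h s y)%:R - q) (g (f s y) - g s).
  have := ler_normB ((h s y)%:R) q; have := ler_normB (g (f s y)) (g s); lra.
pose mart s x T : R := (hits f h s x T)%:R - q * T%:R + (g (trajectory f s x T) - g s).
have martS s x T : mart s x T.+1 = mart s x T + D (trajectory f s x T) (x T).
  by rewrite /mart /D /= natrD -[T.+1]addn1 natrD; ring.
have eq_mart s x x' T : (forall i, (i < T)%N -> x i = x' i) -> mart s x T = mart s x' T.
  by move=> e; rewrite /mart (eq_hits _ _ _ e) (eq_trajectory _ _ e).
have mart2 T s : \sum_(x : {ffun 'I_T -> Y}) (mart s (extend y0 x) T) ^+ 2 <=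
    B ^+ 2 * T%:R * #|{ffun 'I_T -> Y}|%:R.
  elim: T => [|T ih].
    rewrite mulr0 mul0r big1// => x _.
    by rewrite /mart /= mulr0 !subrr addr0 expr0n.
  (* The last input is summed first: given the past it is uniform, so [D0] removes the cross term
     and the squares of the increments add up. *)
  rewrite sum_ffun_rcons.
  have step (x : {ffun 'I_T -> Y}) :
      \sum_y (mart s (extend y0 (ffun_rcons x y)) T.+1) ^+ 2 <=
      #|Y|%:R * (mart s (extend y0 x) T) ^+ 2 + #|Y|%:R * B ^+ 2.
    set a := mart s _ T; set s' := trajectory f s (extend y0 x) T.
    rewrite (eq_bigr (fun y => a ^+ 2 + (2 * a * D s' y + D s' y ^+ 2))) => [|y _].
      rewrite big_split/= sumr_const -[_ *+ _]mulr_natl lerD2l big_split/= -mulr_sumr D0.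
      rewrite mulr0 add0r mulr_natl -sumr_const; apply: ler_sum => y _.
      by rewrite -real_normK ?num_real// lerXn2r ?nnegrE.
    have e i : (i < T)%N -> extend y0 (ffun_rcons x y) i = extend y0 x i.
      exact: extend_rcons_lt.
    rewrite martS (eq_mart _ _ _ _ e) (eq_trajectory _ _ e) extend_rcons_last.
    by rewrite -/a -/s'; ring.
  apply: le_trans (ler_sum _ (fun x _ => step x)) _.
  rewrite big_split/= sumr_const -mulr_sumr -[(_ * B ^+ 2) *+ _]mulr_natl.
  move: ih; rewrite !card_ffun !card_ord expnS natrM -[T.+1]addn1 natrD.
  set K := (#|Y| ^ T)%:R; set V := \sum_x _ => ih.
  have : 0 <= #|Y|%:R :> R by [].
  by nra.
(* The count differs from the martingale by [gg], at most 2G in absolute value, and (a - b)^2 <= 2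
   a^2 + 2 b^2; the final 1 makes the constant positive. *)
exists (2 * B ^+ 2 + 8 * G ^+ 2 + 1); split.
  by have := sqr_ge0 B; have := sqr_ge0 G; lra.
move=> T s.
have bnd (x : {ffun 'I_T -> Y}) :
    ((hits f h s (extend y0 x) T)%:R - q * T%:R) ^+ 2 <=
    2 * mart s (extend y0 x) T ^+ 2 + 8 * G ^+ 2.
  rewrite /mart; set a := _ - q * _; set gg := g _ - g s.
  have : `|gg| <= 2 * G.
    by apply: le_trans (ler_normB _ _) _; have := gG s;
       have := gG (trajectory f s (extend y0 x) T); lra.
  rewrite ler_norml => /andP[l1 l2]; have : gg ^+ 2 <= 4 * G ^+ 2 by nra.
  by have := sqr_ge0 (a + 2 * gg); nra.
apply: le_trans (ler_sum _ (fun x _ => bnd x)) _.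
rewrite big_split/= sumr_const -mulr_sumr -[(8 * _) *+ _]mulr_natl.
have := mart2 T s; set K := #|_|%:R; set V := \sum_x _.
have K0 : 0 <= K by []. have T0 : 0 <= T%:R :> R by [].
rewrite -[T.+1]addn1 natrD; have := sqr_ge0 B; have := sqr_ge0 G.
set b := B ^+ 2; set c := G ^+ 2 => c0 b0 h1.
have : 0 <= T%:R * K by rewrite mulr_ge0.
have : 0 <= c * (T%:R * K) by rewrite !mulr_ge0.
have : 0 <= b * K by rewrite !mulr_ge0.
have : 0 <= c * K by rewrite !mulr_ge0.
by nra.
Qed.

(** A relative deviation has probability O(1 / T), summable along powers of 2, with a constant
    independent of the initial state. *)
Lemma hits_chebyshev : exists C : R, 0 < C /\ forall (T : nat) (s : S) (eps : R),
  0 < eps -> (0 < T)%N ->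
  #|[set x : {ffun 'I_T -> Y} |
     eps * T%:R < `|(hits f h s (extend y0 x) T)%:R - hit_rate * T%:R|%R]%SET|%:R
    <= C / (eps ^+ 2 * T%:R) * #|{ffun 'I_T -> Y}|%:R.
Proof.
have [C [C0 hC]] := hits_variance; exists (2 * C); split; first by rewrite mulr_gt0.
move=> T s eps e0 T0.
have T0' : 0 < T%:R :> R by rewrite ltr0n.
set A := [set x | _]%SET.
have : #|A|%:R * (eps * T%:R) ^+ 2 <= C * T.+1%:R * #|{ffun 'I_T -> Y}|%:R.
  apply: le_trans (hC T s); rewrite [leRHS](bigID (mem A))/=.
  apply: ler_wpDr; first by apply: sumr_ge0 => x _; exact: sqr_ge0.
  rewrite mulr_natl -sumr_const; apply: ler_sum => x; rewrite inE => hx.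
  rewrite -[leRHS]real_normK ?num_real// lerXn2r ?nnegrE ?(ltW hx)//.
  by rewrite mulr_ge0// ltW.
move=> h1; rewrite mulrAC ler_pdivlMr ?mulr_gt0 ?exprn_gt0//.
rewrite -(ler_pM2r T0').
have : T.+1%:R <= 2 * T%:R :> R by rewrite -natrM ler_nat; lia.
move: h1; set a := #|A|%:R; set K := #|_|%:R => h1 T2.
have K0 : 0 <= K by [].
have : C * K * T.+1%:R <= C * K * (2 * T%:R) by rewrite ler_wpM2l// mulr_ge0// ltW.
have -> : a * (eps ^+ 2 * T%:R) * T%:R = a * (eps * T%:R) ^+ 2 by ring.
by move: h1; rewrite [C * _ * K]mulrAC => /le_trans h1 /h1/le_trans; apply; lra.
Qed.
End Ergodic.

(** * Spherical geometry *)

Section Trig.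
Variable R : realType.
Implicit Types x y p q r : R.

Lemma sin_lipschitz x y : `|sin x - sin y| <= `|x - y|.
Proof.
wlog xy : x y / x <= y.
  by move=> h; have [/h//|/ltW/h] := leP x y; rewrite distrC [`|y - x|]distrC.
have cs : {within `[x, y], continuous (@sin R)}.
  by apply: continuous_subspaceT => z; exact: continuous_sin.
have [c _ e] := MVT_segment xy (fun z _ => is_derive_sin z) cs.
by rewrite distrC e normrM [`|x - y|]distrC ler_piMl// cos_max.
Qed.

Lemma cos_lipschitz x y : `|cos x - cos y| <= `|x - y|.
Proof.
rewrite -!sinDpihalf; apply: le_trans (sin_lipschitz _ _) _.
by rewrite (_ : _ - _ = x - y)//; ring.
Qed.

Lemma sin_le_id x : 0 <= x -> `|sin x| <= x.
Proof. by move=> x0; have := sin_lipschitz x 0; rewrite sin0 !subr0 [`|x|]ger0_norm. Qed.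

Lemma cos_ge_quad x : 1 - x ^+ 2 / 2 <= cos x.
Proof.
have -> : cos x = 1 - 2 * sin (x / 2) ^+ 2.
  by rewrite -[x in LHS](_ : (x / 2) *+ 2 = x) ?cos_mulr2n ?cos2sin2; [ring|field].
have := sin_lipschitz (x / 2) 0; rewrite sin0 !subr0 => h.
have : sin (x / 2) ^+ 2 <= (x / 2) ^+ 2.
  by rewrite -[leLHS]real_normK ?num_real// -[leRHS]real_normK ?num_real// lerXn2r ?nnegrE.
by move=> h2; rewrite lerD2l lerNr opprK; move: h2; rewrite expr_div_n; lra.
Qed.

Lemma sin_ge_half x : 0 <= x <= 1 -> x / 2 <= sin x.
Proof.
case/andP=> x0 x1.
have cs : {within `[0, x], continuous (@sin R)}.
  by apply: continuous_subspaceT => z; exact: continuous_sin.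
have [c c0x e] := MVT_segment x0 (fun z _ => is_derive_sin z) cs.
move: e; rewrite sin0 !subr0 => ->; rewrite mulrC ler_wpM2r//.
apply: le_trans (cos_ge_quad c).
by move: c0x; rewrite in_itv/= => /andP[c0 cx]; nra.
Qed.

Lemma acos_le p x : -1 <= p <= 1 -> 0 <= x <= pi -> (acos p <= x) = (cos x <= p).
Proof.
move=> p1 x0.
have a0 : acos p \in `[0, pi]%R by rewrite in_itv/= acos_ge0// acos_lepi.
rewrite -{2}(acosK p1) !leNgt; congr (~~ _).
by rewrite ltr_cos// in_itv.
Qed.

Lemma acos_cos_le x : acos (cos x) <= `|x|.
Proof.
have cx : -1 <= cos x <= 1 by rewrite cos_geN1 cos_le1.
have [xpi|/ltW xpi] := leP `|x| pi; last exact: le_trans (acos_lepi cx) xpi.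
by rewrite acos_le// ?cos_norm// normr_ge0.
Qed.

Lemma polar_angle a b : a ^+ 2 + b ^+ 2 = 1 -> exists x, [/\ 0 <= x <= 2 * pi, a = cos x & b = sin x :> R].
Proof.
move=> ab; have a1 : -1 <= a <= 1 by apply/andP; split; nra.
have ca : cos (acos a) = a by apply: acosK.
have s2 : sin (acos a) = `|b|.
  by rewrite sin_acos// -ab addrAC subrr add0r sqrtr_sqr.
have a0 := acos_ge0 a1; have ap := acos_lepi a1.
have [b0|b0] := leP 0 b.
  by exists (acos a); rewrite ca s2 ger0_norm// a0; split=> //; lra.
exists (2 * pi - acos a); split; first by apply/andP; split; lra.
  by rewrite addrC [2 * pi]mulr_natl cosD2pi cosN ca.
by rewrite addrC [2 * pi]mulr_natl sinD2pi sinN s2 ltr0_norm// opprK.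
Qed.

End Trig.

(** * Scalar and vector products, angles between unit vectors *)

Section Vectors.
Variable R : realType.
Implicit Types a b c x y z : vec R.

Lemma vdotC a b : vdot a b = vdot b a.
Proof. by rewrite /vdot; ring. Qed.

Lemma vdotZl s a b : vdot (vscale s a) b = s * vdot a b.
Proof. by rewrite /vdot /vscale /= /vx /vy /vz /=; ring. Qed.

Lemma vdotZr s a b : vdot b (vscale s a) = s * vdot b a.
Proof. by rewrite vdotC vdotZl vdotC. Qed.

Lemma vdotDl a b c : vdot (vadd a b) c = vdot a c + vdot b c.
Proof. by rewrite /vdot /vadd /= /vx /vy /vz /=; ring. Qed.

Lemma vdotDr a b c : vdot c (vadd a b) = vdot c a + vdot c b.
Proof. by rewrite vdotC vdotDl !(vdotC c). Qed.

Lemma vdot_cross_l a b : vdot (vcross a b) a = 0.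
Proof. by rewrite /vdot /vcross /= /vx /vy /vz /=; ring. Qed.

Lemma vdot_cross_r a b : vdot (vcross a b) b = 0.
Proof. by rewrite /vdot /vcross /= /vx /vy /vz /=; ring. Qed.

Lemma vdot_ge0 a : 0 <= vdot a a.
Proof. by rewrite /vdot -!expr2 !addr_ge0 ?sqr_ge0. Qed.

Lemma vcross_norm a b :
  vdot (vcross a b) (vcross a b) = vdot a a * vdot b b - vdot a b ^+ 2.
Proof. by rewrite /vdot /vcross /= /vx /vy /vz /=; ring. Qed.

(** The squared triple product is the Gram determinant; its nonnegativity is what [gram_unit]
    extracts. *)
Lemma gram_det a b c :
  vdot a (vcross b c) ^+ 2 = vdot a a * vdot b b * vdot c c
    + 2 * (vdot a b * vdot a c * vdot b c) - vdot a a * vdot b c ^+ 2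
    - vdot b b * vdot a c ^+ 2 - vdot c c * vdot a b ^+ 2.
Proof. by rewrite /vdot /vcross /= /vx /vy /vz /=; ring. Qed.

Lemma cauchy_schwarz a b : vdot a b ^+ 2 <= vdot a a * vdot b b.
Proof. by rewrite -subr_ge0 -vcross_norm vdot_ge0. Qed.

Lemma vdot_unit_itv a b : vdot a a = 1 -> vdot b b = 1 -> -1 <= vdot a b <= 1.
Proof.
by move=> a1 b1; have := cauchy_schwarz a b; rewrite a1 b1 mul1r => h; apply/andP; split; nra.
Qed.

Lemma gram_unit a b c : vdot a a = 1 -> vdot b b = 1 -> vdot c c = 1 ->
  (vdot a b - vdot a c * vdot c b) ^+ 2 <= (1 - vdot a c ^+ 2) * (1 - vdot c b ^+ 2).
Proof.
move=> a1 b1 c1; have := gram_det a b c; rewrite a1 b1 c1 !mul1r (vdotC b c).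
by have := sqr_ge0 (vdot a (vcross b c)); nra.
Qed.

(** If the two angles on the right add up to at most pi, the addition formula for the cosine turns
    the claim into [gram_unit]; otherwise every angle is at most pi. *)
Lemma acos_triangle a b c : vdot a a = 1 -> vdot b b = 1 -> vdot c c = 1 ->
  acos (vdot a b) <= acos (vdot a c) + acos (vdot c b).
Proof.
move=> a1 b1 c1; have ab := vdot_unit_itv a1 b1; have ac := vdot_unit_itv a1 c1.
have cb := vdot_unit_itv c1 b1.
have ac0 := acos_ge0 ac; have cb0 := acos_ge0 cb.
have [s1|/ltW s1] := leP (acos (vdot a c) + acos (vdot c b)) pi; last first.
  exact: le_trans (acos_lepi ab) s1.
rewrite acos_le ?s1 ?addr_ge0// cosD !acosK// !sin_acos//.
rewrite -sqrtrM ?subr_ge0; last by have := andP ac => -[? ?]; nra.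
rewrite lerBlDr -lerBlDl.
apply: le_trans (ler_norm _) _; rewrite -[`|_|]sqrtr_sqr; apply: ler_wsqrtr.
by rewrite -[leLHS]sqrrN opprB; exact: gram_unit.
Qed.
End Vectors.

(** * Geodesic distance and strips around great circles *)

Section Sphere.
Variable R : realType.
Local Notation rad := (@Defs.rad R).
Implicit Types a b c x y z : vec R.

Lemma rad_gt0 : 0 < rad.
Proof. by rewrite /Defs.rad divr_gt0// mulr_gt0// sqrtr_gt0 pi_gt0. Qed.

Let rad_neq0 : rad != 0. Proof. by rewrite gt_eqF ?rad_gt0. Qed.

Definition on_sphere a := vdot a a = rad ^+ 2.
Definition unitize a : vec R := vscale rad^-1 a.

Lemma unitize1 a : on_sphere a -> vdot (unitize a) (unitize a) = 1.
Proof.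
by rewrite /on_sphere /unitize vdotZl vdotZr => ->; field; exact: rad_neq0.
Qed.

Lemma sdistE a b : sdist a b = rad * acos (vdot (unitize a) (unitize b)).
Proof.
rewrite /sdist /unitize vdotZl vdotZr; congr (_ * acos _); field.
exact: rad_neq0.
Qed.

Lemma sdistC a b : sdist a b = sdist b a.
Proof. by rewrite /sdist vdotC. Qed.

Lemma sdist_triangle a b c : on_sphere a -> on_sphere b -> on_sphere c ->
  sdist a b <= sdist a c + sdist c b.
Proof.
move=> /unitize1 a1 /unitize1 b1 /unitize1 c1; rewrite !sdistE -mulrDr.
by rewrite ler_pM2l ?rad_gt0//; exact: acos_triangle.
Qed.

(** Think of [x] as a pole and of [y] as a point of its great circle: [gram_unit] bounds the scalar
    product of [x] and [z] by the sine of the angle between [y] and [z]. *)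
Lemma strip_of_close x y z (t : R) : vdot x x = 1 -> vdot y y = 1 -> vdot z z = 1 ->
  vdot x y = 0 -> acos (vdot y z) <= t -> `|vdot x z| <= t.
Proof.
move=> x1 y1 z1 xy yzt; have yz := vdot_unit_itv y1 z1.
have := gram_unit x1 z1 y1; rewrite xy mul0r subr0 expr0n subr0 mul1r.
rewrite -[vdot y z in X in _ <= X]acosK// -sin2cos2 => h.
have a0 := acos_ge0 yz.
apply: le_trans yzt; apply: le_trans (sin_le_id a0).
by rewrite -[leLHS]sqrtr_sqr -[leRHS]sqrtr_sqr; exact: ler_wsqrtr.
Qed.

(** The point is the normalized projection of [z] on the plane orthogonal to [x]; the sine of its
    angle with [z] is the absolute value of [p]. The factor 2 is lost in the bound t / 2 <= sin
    t. *)
Lemma close_of_strip x z (t : R) : vdot x x = 1 -> vdot z z = 1 ->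
  0 < t <= 1 -> `|vdot x z| <= t / 2 ->
  exists y, [/\ vdot y y = 1, vdot y x = 0 & acos (vdot y z) <= t].
Proof.
move=> x1 z1 /andP[t0 t1] h; set p := vdot x z in h.
have p2 : p ^+ 2 <= (t / 2) ^+ 2.
  by rewrite -[leLHS]real_normK ?num_real// lerXn2r ?nnegrE//; lra.
have t2 : (t / 2) ^+ 2 <= 1 / 4 by nra.
have q0 : 0 < 1 - p ^+ 2 by lra.
set w := Num.sqrt (1 - p ^+ 2); have w0 : 0 < w by rewrite sqrtr_gt0.
have w2 : w ^+ 2 = 1 - p ^+ 2 by rewrite sqr_sqrtr// ltW.
have wn : w != 0 by rewrite gt_eqF.
exists (vscale w^-1 (vadd z (vscale (- p) x))).
have e1 : vdot (vadd z (vscale (- p) x)) x = 0.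
  by rewrite vdotDl vdotZl x1 vdotC -/p; ring.
have e2 : vdot (vadd z (vscale (- p) x)) z = w ^+ 2.
  by rewrite vdotDl vdotZl z1 -/p w2; ring.
split.
- rewrite vdotZl vdotZr vdotDr vdotZr e1 e2; field.
  exact: wn.
- by rewrite vdotZl e1 mulr0.
rewrite vdotZl e2 (_ : _ * _ = w); last by field.
have tpi : t <= pi / 2 by have := pi_ge2 R; lra.
have pi2 := pi_ge2 R.
have w1 : -1 <= w <= 1.
  apply/andP; split; first by lra.
  by rewrite -sqrtr1; apply: ler_wsqrtr; have := sqr_ge0 p; lra.
have tpi' : 0 <= t <= pi by apply/andP; split; lra.
rewrite acos_le//.
have c0 : 0 <= cos t by apply: cos_ge0_pihalf; apply/andP; split; lra.
rewrite -[leLHS]ger0_norm// -sqrtr_sqr; apply: ler_wsqrtr.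
rewrite cos2sin2 lerD2l lerNr opprK; apply: le_trans p2 _.
have := @sin_ge_half R t; rewrite (ltW t0) t1 => /(_ isT) s0.
by rewrite lerXn2r ?nnegrE//; lra.
Qed.

End Sphere.

Lemma card_ord_itv (n a b : nat) :
  (#|[set x : 'I_n | (a <= x < b)%N]%SET| <= b - a)%N.
Proof.
rewrite cardE -(size_map val) -(size_iota a (b - a)).
apply: uniq_leq_size; first by rewrite (map_inj_uniq val_inj) enum_uniq.
by move=> _ /mapP[x xin ->]; move: xin; rewrite mem_enum inE mem_iota /=; lia.
Qed.

(** * Lattice points, meeting points and interference distances *)

Section Config.
Variables (R : realType) (e : R * R -> vec R) (k : nat) (u : label -> R).
Local Notation rad := (@Defs.rad R).
Local Notation m := (msz k).
Hypothesis e_ok : frame_ok e.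
Hypothesis u01 : forall i : node k,
  0 <= u (tag_z, val i, 0, 0)%N <= 1 /\ 0 <= u (tag_phi, val i, 0, 0)%N <= 1.
Hypothesis poles_indep : forall i j : node k, i != j ->
  vdot (vcross (pole u i) (pole u j)) (vcross (pole u i) (pole u j)) != 0.

Implicit Types (i j : node k) (z : vec R).

Let rad0 : 0 < rad. Proof. exact: rad_gt0. Qed.
Let radn0 : rad != 0. Proof. by rewrite gt_eqF. Qed.

Definition spacing : R := Num.sqrt (pi / (nn k)%:R).

Lemma msz_gt0 : (0 < m)%N. Proof. by rewrite /msz -addnn. Qed.

Let m0 : 0 < m%:R :> R. Proof. by rewrite ltr0n msz_gt0. Qed.
Let mn0 : m%:R != 0 :> R. Proof. by rewrite gt_eqF. Qed.

Lemma sqrt_nn : Num.sqrt (nn k)%:R = m%:R :> R.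
Proof. by rewrite /nn natrM -expr2 sqrtr_sqr ger0_norm// ltW. Qed.

Lemma spacingE : spacing = rad * (2 * pi / m%:R).
Proof.
rewrite /spacing sqrtrM ?pi_ge0// sqrtrV ?ler0n// sqrt_nn /Defs.rad.
have p0 : 0 < Num.sqrt pi :> R by rewrite sqrtr_gt0 pi_gt0.
rewrite -[X in _ = _ * (2 * X / _)](@sqr_sqrtr R pi) ?pi_ge0//.
by field; rewrite mn0 gt_eqF.
Qed.

Lemma spacing_gt0 : 0 < spacing.
Proof. by rewrite spacingE mulr_gt0// divr_gt0// mulr_gt0// pi_gt0. Qed.

Lemma on_sphere_pt s s' : 0 <= s <= 1 -> on_sphere (sphere_pt s s' : vec R).
Proof.
move=> s01; rewrite /on_sphere /sphere_pt vdotZl vdotZr.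
set w := Num.sqrt _; have w2 : w ^+ 2 = 1 - (2 * s - 1) ^+ 2.
  by rewrite sqr_sqrtr//; case/andP: s01 => ? ?; nra.
set c := cos _; set v := sin _; have cv : c ^+ 2 + v ^+ 2 = 1 by exact: cos2Dsin2.
rewrite /vdot /mkv /vx /vy /vz /=.
transitivity (rad ^+ 2 * (w ^+ 2 * (c ^+ 2 + v ^+ 2) + (2 * s - 1) ^+ 2)); first by ring.
by rewrite cv w2; ring.
Qed.

Lemma pole_sphere i : on_sphere (pole u i).
Proof. by apply: on_sphere_pt; exact: (u01 i).1. Qed.

Lemma frame11 i : vdot (frame1 e u i) (frame1 e u i) = 1.
Proof. by have [/(_ _ _ (u01 i).1 (u01 i).2) []] := e_ok. Qed.

Lemma frame1_pole i : vdot (frame1 e u i) (pole u i) = 0.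
Proof. by have [/(_ _ _ (u01 i).1 (u01 i).2) []] := e_ok. Qed.

Let npole i := vscale (1 / rad) (pole u i).

Let npole1 i : vdot (npole i) (npole i) = 1.
Proof. rewrite /npole vdotZl vdotZr pole_sphere; field. exact: radn0. Qed.

Let npole_frame1 i : vdot (npole i) (frame1 e u i) = 0.
Proof. by rewrite /npole vdotZl vdotC frame1_pole mulr0. Qed.

Lemma frame22 i : vdot (frame2 e u i) (frame2 e u i) = 1.
Proof.
by rewrite /frame2 -/(npole i) vcross_norm frame11 npole1 npole_frame1; ring.
Qed.

Lemma frame21 i : vdot (frame2 e u i) (frame1 e u i) = 0.
Proof. exact: vdot_cross_r. Qed.

Lemma frame2_pole i : vdot (frame2 e u i) (pole u i) = 0.
Proof.
have : vdot (frame2 e u i) (vscale (1 / rad) (pole u i)) = 0 by exact: vdot_cross_l.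
rewrite vdotZr => /eqP; rewrite mulf_eq0 => /orP[|/eqP//].
by rewrite mul1r invr_eq0 (negbTE radn0).
Qed.

Lemma vdot_lattice i l z : vdot (lattice e u i l) z =
  rad * (cos (2 * pi * l%:R / m%:R) * vdot (frame1 e u i) z +
         sin (2 * pi * l%:R / m%:R) * vdot (frame2 e u i) z).
Proof. by rewrite /lattice vdotZl vdotDl !vdotZl. Qed.

Lemma vdot_lattice2 i l l' : vdot (lattice e u i l) (lattice e u i l') =
  rad ^+ 2 * cos (2 * pi * l%:R / m%:R - 2 * pi * l'%:R / m%:R).
Proof.
rewrite vdot_lattice ![vdot _ (lattice _ _ _ _)]vdotC !vdot_lattice frame11 frame22 frame21.
by rewrite [vdot (frame1 _ _ _) (frame2 _ _ _)]vdotC frame21 cosB; ring.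
Qed.

Lemma lattice_sphere i l : on_sphere (lattice e u i l).
Proof. by rewrite /on_sphere vdot_lattice2 subrr cos0 mulr1. Qed.

Lemma lattice_pole i l : vdot (lattice e u i l) (pole u i) = 0.
Proof. by rewrite vdot_lattice frame1_pole frame2_pole !mulr0 addr0 mulr0. Qed.

Lemma loc_sphere i t : on_sphere (loc e u i t).
Proof. exact: lattice_sphere. Qed.

Lemma circle_coords i z : on_sphere z -> vdot z (pole u i) = 0 ->
  vdot (frame1 e u i) z ^+ 2 + vdot (frame2 e u i) z ^+ 2 = rad ^+ 2.
Proof.
move=> zs zp; have := gram_det z (npole i) (frame1 e u i).
have zn : vdot z (npole i) = 0 by rewrite /npole vdotZr zp mulr0.
rewrite -[vcross _ _]/(frame2 e u i) zs npole1 npole_frame1 frame11 zn.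
by rewrite ![vdot z _]vdotC => ->; ring.
Qed.

Lemma pos_lt i t : (pos u i t < m)%N.
Proof.
case: t => [|t] /=; last by rewrite ltn_mod msz_gt0.
by rewrite /pickidx (leq_ltn_trans (geq_minr _ _))// prednK ?msz_gt0.
Qed.

Lemma nearest_lattice i z : on_sphere z -> vdot z (pole u i) = 0 ->
  exists l : 'I_m, sdist (lattice e u i l) z <= spacing / 2.
Proof.
move=> zs zp; have zc := circle_coords zs zp.
have : (vdot (frame1 e u i) z / rad) ^+ 2 + (vdot (frame2 e u i) z / rad) ^+ 2 = 1.
  transitivity ((vdot (frame1 e u i) z ^+ 2 + vdot (frame2 e u i) z ^+ 2) / rad ^+ 2).
    by field; exact: radn0.
  by rewrite zc divff// expf_neq0.
move=> /polar_angle[x [/andP[x0 x2] ca sa]].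
have tp : 0 < 2 * pi :> R by rewrite mulr_gt0 ?pi_gt0.
(* Adding 1 / 2 before truncation rounds to the nearest lattice index. *)
set v := x * m%:R / (2 * pi) + 1 / 2.
have v0 : 0 <= v.
  apply: addr_ge0 => //; apply: divr_ge0; last exact: ltW.
  by apply: mulr_ge0 => //; exact: ltW.
have vm : v < m%:R + 1.
  have : x * m%:R / (2 * pi) <= m%:R.
    by rewrite ler_pdivrMr// mulrC ler_pM2l.
  by rewrite /v; lra.
pose l0 := Num.truncn v.
have /andP[l1 l2] := truncn_itv v0; rewrite -/l0 in l1 l2.
have l0m : (l0 <= m)%N.
  by rewrite -ltnS -(ltr_nat R); apply: le_lt_trans l1 _; rewrite -[m.+1]addn1 natrD.
have dist : `|2 * pi * l0%:R / m%:R - x| <= pi / m%:R.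
  have -> : 2 * pi * l0%:R / m%:R - x = (2 * pi / m%:R) * (l0%:R - x * m%:R / (2 * pi)).
    have pn : pi != 0 :> R by rewrite gt_eqF ?pi_gt0.
    have fld (M p a b : R) : M != 0 -> p != 0 ->
        2 * p * a / M - b = 2 * p / M * (a - b * M / (2 * p)).
      by move=> M0 p0; field; rewrite p0 M0.
    exact: fld.
  have -> : pi / m%:R = (2 * pi / m%:R) * (1 / 2) :> R by field; exact: mn0.
  rewrite normrM ger0_norm ?divr_ge0 ?(ltW tp) ?(ltW m0)//.
  rewrite ler_pM2l ?divr_gt0// ler_norml.
  by move: l1 l2; rewrite -addn1 natrD /v => ? ?; apply/andP; split; lra.
(* Stated for any index at the same angle as [l0], because rounding may produce [m], which has to be
   replaced by 0. *)
have key l : cos (2 * pi * l%:R / m%:R) = cos (2 * pi * l0%:R / m%:R) :> R ->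
    sin (2 * pi * l%:R / m%:R) = sin (2 * pi * l0%:R / m%:R) :> R ->
    sdist (lattice e u i l) z <= spacing / 2.
  move=> e1 e2; rewrite /sdist vdot_lattice e1 e2.
  have -> : rad * (cos (2 * pi * l0%:R / m%:R) * vdot (frame1 e u i) z +
       sin (2 * pi * l0%:R / m%:R) * vdot (frame2 e u i) z) / rad ^+ 2 =
       cos (2 * pi * l0%:R / m%:R - x).
    rewrite cosB -ca -sa; field.
    exact: radn0.
  rewrite spacingE (_ : _ / 2 = rad * (pi / m%:R)); last by field; exact: mn0.
  by rewrite ler_pM2l//; apply: le_trans (acos_cos_le _) dist.
have [l0lt|l0ge] := ltnP l0 m; first by exists (Ordinal l0lt); exact: key.
have l0E : l0 = m by apply/eqP; rewrite eqn_leq l0m.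
exists (Ordinal msz_gt0); apply: key => /=; rewrite l0E mulr0 mul0r mulfK//.
  by rewrite cos0 mulr_natl cos2pi.
by rewrite sin0 mulr_natl sin2pi.
Qed.

Lemma closest_le i l z : on_sphere z -> vdot z (pole u i) = 0 ->
  closest e u i l z -> sdist (lattice e u i l) z <= spacing / 2.
Proof.
move=> zs zp /forallP h; have [l' hl'] := nearest_lattice zs zp.
exact: le_trans (h l') hl'.
Qed.

Lemma closest_exists i z : exists l : 'I_m, closest e u i l z.
Proof.
pose F (l : 'I_m) := sdist (lattice e u i l) z.
exists [arg min_(l < Ordinal msz_gt0) F l]%O.
by apply/forallP => l'; case: arg_minP => // l _; apply.
Qed.

Lemma sdist_lattice i (l l' : nat) : (l' <= l < m)%N ->
  sdist (lattice e u i l) (lattice e u i l') =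
  spacing * (minn (l - l') (m - (l - l')))%:R.
Proof.
case/andP=> l'l lm; rewrite /sdist vdot_lattice2 [_ / rad ^+ 2]mulrC mulKf ?expf_neq0//.
set d := (l - l')%N; have dm : (d < m)%N by rewrite /d; lia.
have -> : 2 * pi * l%:R / m%:R - 2 * pi * l'%:R / m%:R = 2 * pi / m%:R * d%:R :> R.
  by rewrite natrB//; field; exact: mn0.
rewrite spacingE -[rad * _ * _]mulrA; congr (_ * _).
have tp : 0 < 2 * pi / m%:R :> R by rewrite divr_gt0// mulr_gt0 ?pi_gt0.
have pE : pi = 2 * pi / m%:R * (m%:R / 2) :> R by field; exact: mn0.
have [dle|dgt] := leqP d (m - d)%N.
  apply: cosK; rewrite in_itv/=; apply/andP; split; first by rewrite mulr_ge0// ltW.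
  rewrite [leRHS]pE ler_pM2l// ler_pdivlMr// -natrM ler_nat; lia.
have -> : cos (2 * pi / m%:R * d%:R) = cos (2 * pi / m%:R * (m - d)%:R) :> R.
  have -> : 2 * pi / m%:R * (m - d)%:R = - (2 * pi / m%:R * d%:R) + pi *+ 2 :> R.
    by rewrite natrB ?(ltnW dm)// -[pi *+ 2]mulr_natl; field; exact: mn0.
  by rewrite cosD2pi cosN.
apply: cosK; rewrite in_itv/=; apply/andP; split; first by rewrite mulr_ge0// ltW.
rewrite [leRHS]pE ler_pM2l// ler_pdivlMr// -natrM ler_nat; lia.
Qed.

(** Two lattice points in the disk are at most [D] steps apart on the cycle. Around a fixed one this
    leaves 2D + 1 indices without wrapping and at most [D] at either end of the range. *)
Lemma disk_count i z (rho : R) (D : nat) : on_sphere z -> 2 * rho <= D%:R * spacing ->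
  (#|[set l : 'I_m | (sdist (lattice e u i l) z <= rho)%R]%SET| <= 4 * D + 1)%N.
Proof.
move=> zs rD; set A := [set l : 'I_m | _]%SET.
have [->|[l0 l0A]] := set_0Vmem A; first by rewrite cards0.
have near l : l \in A -> exists x y : nat, [/\ (y <= x < m)%N,
   (minn (x - y) (m - (x - y)) <= D)%N &
   (x = l /\ y = l0) \/ (x = l0 /\ y = l)].
  move=> lA; have : sdist (lattice e u i l) (lattice e u i l0) <= D%:R * spacing.
    apply: le_trans rD; apply: le_trans (sdist_triangle _ _ zs) _ => //; try exact: lattice_sphere.
    by move: lA l0A; rewrite !inE (sdistC z); lra.
  have aux (x y : 'I_m) : (y <= x)%N ->
      sdist (lattice e u i x) (lattice e u i y) <= D%:R * spacing ->
      (minn (x - y) (m - (x - y)) <= D)%N.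
    move=> yx; rewrite sdist_lattice ?yx ?ltn_ord// mulrC ler_pM2r ?spacing_gt0//.
    by rewrite ler_nat.
  have [ll0 h|/ltnW ll0 h] := leqP l0 l.
    by exists l, l0; split; [rewrite ll0 ltn_ord|exact: aux|left].
  by exists l0, l; split; [rewrite ll0 ltn_ord|apply: aux; rewrite // sdistC|right].
have sub : A \subset [set l : 'I_m | (l0 - D <= l < l0 + D.+1)%N]%SET :|:
    ([set l : 'I_m | (0 <= l < D)%N]%SET :|: [set l : 'I_m | (m - D <= l < m)%N]%SET).
  apply/fintype.subsetP => l /near[x [y [h1 h2 h3]]]; rewrite !inE.
  by have := ltn_ord l; have := ltn_ord l0; case: h3 => -[? ?]; subst; lia.
apply: leq_trans (subset_leq_card sub) _.
apply: leq_trans (leq_card_setU _ _) _.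
apply: (@leq_trans ((l0 + D.+1 - (l0 - D)) + ((D - 0) + (m - (m - D))))).
  apply: leq_add; first exact: card_ord_itv.
  by apply: leq_trans (leq_card_setU _ _) _; apply: leq_add; exact: card_ord_itv.
by lia.
Qed.

Lemma zpt_ord_prop i j : i != j ->
  [/\ on_sphere (zpt_ord u i j), vdot (zpt_ord u i j) (pole u i) = 0 &
      vdot (zpt_ord u i j) (pole u j) = 0].
Proof.
move=> ij; rewrite /zpt_ord; set c := vcross _ _; set sg : R := if _ then _ else _.
split; rewrite ?vdotZl ?vdot_cross_l ?vdot_cross_r ?mulr0//.
have c0 : 0 < vdot c c by rewrite lt_neqAle vdot_ge0 andbT eq_sym poles_indep.
rewrite /on_sphere vdotZl vdotZr /vnorm.
have s2 : Num.sqrt (vdot c c) ^+ 2 = vdot c c by rewrite sqr_sqrtr// ltW.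
have sn0 : Num.sqrt (vdot c c) != 0 by rewrite gt_eqF// sqrtr_gt0.
rewrite -[X in _ * (_ * X)]s2.
have -> : rad ^+ 2 = (sg * rad) ^+ 2 by rewrite /sg; case: ifP => _; ring.
by field.
Qed.

Lemma zpt_prop i j : i != j ->
  [/\ on_sphere (zpt u i j), vdot (zpt u i j) (pole u i) = 0 &
      vdot (zpt u i j) (pole u j) = 0].
Proof.
move=> ij; rewrite /zpt; case: ifP => _; first exact: zpt_ord_prop.
by rewrite eq_sym in ij; have [] := zpt_ord_prop ij.
Qed.

Lemma nbr_close t i j : nbr e u t i j ->
  sdist (loc e u i t) (zpt u i j) <= spacing / 2 /\
  sdist (loc e u j t) (zpt u i j) <= spacing / 2.
Proof.
rewrite /nbr => /andP[/andP[ij ci] cj]; have [zs zi zj] := zpt_prop ij.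
by split; apply: closest_le.
Qed.

Variable Delta : R.
Hypothesis Delta0 : 0 < Delta.
Local Notation rho := ((2 + Delta) * spacing).

(** Neighbours are both within half a spacing of their own meeting point, hence within one spacing
    of each other; [l] would then be within 3 / 2 spacings of [z], which is less than [rho]. *)
Lemma far_not_nbr t i (l : node k) z : on_sphere z ->
  sdist (loc e u i t) z <= spacing / 2 -> rho < sdist (loc e u l t) z ->
  ~~ nbr e u t i l.
Proof.
move=> zs iz lz; apply/negP => /[dup] nb /nbr_close[n1 n2].
have il : i != l by move: nb; rewrite /nbr => /andP[/andP[]].
have [ws _ _] := zpt_prop il.
have s0 := spacing_gt0.
have t1 := sdist_triangle (loc_sphere l t) zs (loc_sphere i t).
have t2 := sdist_triangle (loc_sphere l t) (loc_sphere i t) ws.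
rewrite (sdistC (zpt u i l)) in t2.
have : 0 < Delta * spacing by rewrite mulr_gt0.
by lra.
Qed.

(** The transmission has length at most one spacing, whereas [l] is at least 3 / 2 + Delta spacings
    away from [j]. *)
Lemma far_not_interfering t i j (l : node k) z : on_sphere z ->
  sdist (loc e u i t) z <= spacing / 2 -> sdist (loc e u j t) z <= spacing / 2 ->
  rho < sdist (loc e u l t) z ->
  (1 + Delta) * sdist (loc e u i t) (loc e u j t) <= sdist (loc e u l t) (loc e u j t).
Proof.
move=> zs iz jz lz; have s0 := spacing_gt0.
have t1 := sdist_triangle (loc_sphere l t) zs (loc_sphere j t).
have t2 := sdist_triangle (loc_sphere i t) (loc_sphere j t) zs.
rewrite (sdistC z) in t2.
have h : sdist (loc e u i t) (loc e u j t) <= spacing by lra.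
have : (1 + Delta) * sdist (loc e u i t) (loc e u j t) <= (1 + Delta) * spacing.
  by apply: ler_wpM2l => //; rewrite addr_ge0// ltW.
by lra.
Qed.

End Config.

(** * Queues and collision-free slots *)

Section Queue.
Variables (Q arr : nat -> nat) (dep a b : nat -> bool).
Hypothesis Q0 : Q 0 = 0%N.
Hypothesis QS : forall t, Q t.+1 = (Q t + arr t - dep t)%N.
Hypothesis dep_busy : forall t, dep t -> (0 < Q t + arr t)%N.
Hypothesis a_arr : forall t, a t -> (0 < arr t)%N.
Hypothesis b_dep : forall t, b t -> (0 < Q t + arr t)%N -> dep t.

Definition cum (c : nat -> nat) (t : nat) : nat := (\sum_(i < t) c i)%N.

Lemma cumS c t : cum c t.+1 = (cum c t + c t)%N.
Proof. by rewrite /cum big_ord_recr. Qed.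

Lemma leq_cum c : {homo cum c : t t' / (t <= t')%N}.
Proof. by apply: homo_leq => // [y z x' /leq_trans h1 /h1//|t]; rewrite cumS leq_addr. Qed.

(** [dep_busy] makes the truncated subtraction in [QS] exact. *)
Lemma queue_balance t : (Q t + cum dep t = cum arr t)%N.
Proof.
elim: t => [|t ih]; first by rewrite Q0 /cum !big_ord0.
rewrite !cumS QS; have := @dep_busy t; case: (dep t) => /=; lia.
Qed.

(* Either the queue is found empty at a service opportunity after [t1], and
   then everything that arrived before [t1] has left, or every service
   opportunity after [t1] is used. *)
Lemma queue_departures t1 t2 : (t1 <= t2)%N ->
  (minn (cum a t1) (cum b t2 - cum b t1) <= cum dep t2)%N.
Proof.
move=> t12.
have arr_a t : (cum a t <= cum arr t)%N.
  by apply: leq_sum => i _; have := @a_arr i; case: (a i) => //; exact.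
suff : (cum a t1 <= cum dep t2)%N \/ (cum b t2 - cum b t1 + cum dep t1 <= cum dep t2)%N by lia.
rewrite -(subnKC t12); elim: (t2 - t1)%N => [|n ih].
  by right; rewrite addn0 subnn.
rewrite addnS !cumS; set t := (t1 + n)%N in ih *.
case: ih => ih; first by left; lia.
have [bt|] := boolP (b t); last first.
  by move=> _; right; have := @leq_cum b t1 t (leq_addr _ _); lia.
have [dt|/negP dt] := boolP (dep t); first by right; have := @leq_cum b t1 t (leq_addr _ _); lia.
left; have := queue_balance t; have := arr_a t; have := @leq_cum a t1 t (leq_addr _ _).
have [->|q0] := posnP (Q t); first by lia.
by case: dt; apply: b_dep => //; rewrite addn_gt0 q0.
Qed.
End Queue.

Lemma card_classical (T : finType) (b : pred T) : #|[set x | b x]%classic| = #|b|.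
Proof. by apply: eq_card => x; apply/idP/idP => [/set_mem//|h]; exact/mem_set. Qed.

Lemma pickidx1 (R : realType) (x : R) : pickidx 1 x = 0%N.
Proof. by rewrite /pickidx minn0. Qed.

(** * The policy at a clear meeting, and packets delivered through relays *)

Section Dynamics.
Variables (R : realType) (e : R * R -> vec R) (k : nat) (u : label -> R).
Variables (pD alpha Delta : R).
Hypothesis e_ok : frame_ok e.
Hypothesis u01 : forall i : node k,
  0 <= u (tag_z, val i, 0, 0)%N <= 1 /\ 0 <= u (tag_phi, val i, 0, 0)%N <= 1.
Hypothesis poles_indep : forall i j : node k, i != j ->
  vdot (vcross (pole u i) (pole u j)) (vcross (pole u i) (pole u j)) != 0.
Hypothesis Delta0 : 0 < Delta.
Hypothesis keys_inj : forall i j : node k,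
  u (tag_pair, val i, 0, 0)%N = u (tag_pair, val j, 0, 0)%N -> i = j.

Local Notation rho := ((2 + Delta) * spacing R k).
Local Notation rank := (@Defs.rank R k u).

Lemma rankE i : rank i =
  #|[pred j : node k | u (tag_pair, val j, 0, 0)%N < u (tag_pair, val i, 0, 0)%N]|.
Proof. by rewrite /Defs.rank card_classical. Qed.

Lemma rank_ltn i j : u (tag_pair, val i, 0, 0)%N < u (tag_pair, val j, 0, 0)%N ->
  (rank i < rank j)%N.
Proof.
move=> ij; rewrite !rankE; apply/proper_card/properP; split.
  by apply/fintype.subsetP => l; rewrite !inE => /lt_trans; apply.
by exists i; rewrite !inE ?ltxx.
Qed.

Lemma rank_inj : injective rank.
Proof.
move=> i j rij; apply: keys_inj.
case: (ltgtP (u (tag_pair, val i, 0, 0)%N) (u (tag_pair, val j, 0, 0)%N)) => // /rank_ltn;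
  by rewrite rij ltnn.
Qed.

Lemma rank_lt i : (rank i < nn k)%N.
Proof.
have n0 : (0 < nn k)%N by rewrite (leq_ltn_trans _ (ltn_ord i)).
rewrite rankE; apply: (@leq_ltn_trans #|predC1 i|); last first.
  by rewrite cardC1 card_ord prednK.
apply/subset_leq_card/fintype.subsetP => j; rewrite !inE => ji.
by apply: contraTneq ji => ->; rewrite ltxx.
Qed.

Lemma rank_surj r : (r < nn k)%N -> exists i, rank i = r.
Proof.
move=> rn; pose g (i : node k) : node k := Ordinal (rank_lt i).
have gi : injective g by move=> i j /(congr1 val) /=; exact: rank_inj.
have [h _ hK] := injF_bij gi.
by exists (h (Ordinal rn)); have /(congr1 val) := hK (Ordinal rn).
Qed.

(** Once the meeting point is fixed, each clause concerns the position of a single node, so the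
    stationary probability is a product over the nodes. *)
Definition clear_meeting (t : nat) (i j : node k) : Prop :=
  [/\ closest e u i (pos u i t) (zpt u i j), closest e u j (pos u j t) (zpt u i j) &
      forall l, l != i -> l != j -> rho < sdist (loc e u l t) (zpt u i j)].

(** It leaves a single candidate in the random choice of a relay or of a destination. *)
Lemma clear_nbr t i j l : i != j -> clear_meeting t i j -> nbr e u t i l = (l == j).
Proof.
move=> ij [ci cj far]; have [zs zi zj] := zpt_prop poles_indep ij.
have [->|lj] := eqVneq l j; first by rewrite /nbr ij ci cj.
have [->|li] := eqVneq l i; first by rewrite /nbr eqxx.
apply/negbTE/(far_not_nbr e_ok u01 poles_indep Delta0 zs); last exact: far.
exact: closest_le.
Qed.

Lemma clear_success t i j (TX : {set node k}) : i != j -> clear_meeting t i j ->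
  j \notin TX -> success e u Delta t TX i j.
Proof.
move=> ij [ci cj far] jTX; have [zs zi zj] := zpt_prop poles_indep ij.
apply/forallP => l; apply/implyP => /andP[lTX li].
have lj : l != j by apply: contraNneq jTX => <-.
by apply: (far_not_interfering e_ok u01 Delta0 zs); [exact: closest_le|exact: closest_le|exact: far].
Qed.

(** The receiver has to be inactive: if it transmitted, [success] would count it among the
    interferers, at distance zero from itself. *)
Definition clearA t s v : Prop :=
  [/\ clear_meeting t s v, u (tag_actA, t, val s, 0)%N < pD,
      pD <= u (tag_actA, t, val v, 0)%N & u (tag_alpha, t, val s, 0)%N < alpha].

Definition clearB t v d : Prop :=
  [/\ clear_meeting t v d, u (tag_actB, t, val v, 0)%N < pD &
      pD <= u (tag_actB, t, val d, 0)%N].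

Lemma clearA_relay t s v : s != v -> is_source u s -> clearA t s v ->
  relayA e u pD alpha t s = Some v /\ okA e u pD alpha Delta t s.
Proof.
move=> sv ss [cl as_ av al].
have N : nbr_list e u t s = [:: v].
  rewrite /nbr_list (eq_filter (a2 := pred1 v)) => [|l]; last exact: clear_nbr.
  by rewrite filter_pred1_uniq ?enum_uniq ?mem_enum.
have rel : relayA e u pD alpha t s = Some v.
  by rewrite /relayA ss as_ N al (_ : size [:: v] = 1%N)// pickidx1.
split=> //; rewrite /okA rel; apply: clear_success => //.
by rewrite /TXA inE negbK /relayA [_ < pD]ltNge av /= andbF.
Qed.

Lemma clearB_send t v d Q : v != d -> is_dest u d -> clearB t v d ->
  (0 < Q v (pair_of u d))%N ->
  sendB e u pD t Q v = Some d /\ okB e u pD Delta t Q v.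
Proof.
move=> vd dd [cl av ad] q0.
have N : dest_list e u t v = [:: d].
  rewrite /dest_list (eq_filter (a2 := pred1 d)) => [|l].
    by rewrite filter_pred1_uniq ?enum_uniq ?mem_enum.
  by rewrite (clear_nbr l vd cl) /=; case: eqP => // ->; rewrite dd.
have snd : sendB e u pD t Q v = Some d.
  by rewrite /sendB /chooseB av N (_ : size [:: d] = 1%N)// pickidx1 /= q0.
split=> //; rewrite /okB snd; apply: clear_success => //.
by rewrite /TXB inE negbK /sendB /chooseB [_ < pD]ltNge ad /=.
Qed.

Local Notation st := (stateSigma e k u pD alpha Delta).

Definition arrivals t (v : node k) (p : nat) : nat := #|[pred s | okA e u pD alpha Delta t s &&
  (relayA e u pD alpha t s == Some v) && ~~ to_dest u s v && (pair_of u s == p)]|.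

Definition queueA t (v : node k) (p : nat) : nat := ((st t).1 v p + arrivals t v p)%N.

Definition departs t (v : node k) (p : nat) : bool :=
  okB e u pD Delta t (queueA t) v && (targetB e u pD t (queueA t) v == p).

Lemma queue_step t v p : (st t.+1).1 v p = ((st t).1 v p + arrivals t v p - departs t v p)%N.
Proof.
rewrite /= /stepSigma /departs /queueA /arrivals; case: (st t) => Q D /=.
suff -> : (fun v0 p0 => (Q v0 p0 + #|[set s | okA e u pD alpha Delta t s &&
    (relayA e u pD alpha t s == Some v0) && ~~ to_dest u s v0 && (pair_of u s == p0)]%classic|)%N) =
  (fun v0 p0 => (Q v0 p0 + #|[pred s | okA e u pD alpha Delta t s &&
    (relayA e u pD alpha t s == Some v0) && ~~ to_dest u s v0 && (pair_of u s == p0)]|)%N).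
  by rewrite card_classical.
by apply/funext => v'; apply/funext => p'; rewrite card_classical.
Qed.

(** An inequality, because packets handed by the source directly to its destination are left out of
    the account. *)
Lemma delivered_step t p : ((st t).2 p + #|[pred v | departs t v p]| <= (st t.+1).2 p)%N.
Proof.
rewrite /= /stepSigma /departs /queueA /arrivals; case: (st t) => Q D /=.
rewrite -addnA leq_add2l.
suff -> : (fun v0 p0 => (Q v0 p0 + #|[set s | okA e u pD alpha Delta t s &&
    (relayA e u pD alpha t s == Some v0) && ~~ to_dest u s v0 && (pair_of u s == p0)]%classic|)%N) =
  (fun v0 p0 => (Q v0 p0 + #|[pred s | okA e u pD alpha Delta t s &&
    (relayA e u pD alpha t s == Some v0) && ~~ to_dest u s v0 && (pair_of u s == p0)]|)%N).
  by apply: leq_trans (leq_addl _ _); rewrite card_classical.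
by apply/funext => v'; apply/funext => p'; rewrite card_classical.
Qed.

Lemma departs_busy t v p : departs t v p -> (0 < (st t).1 v p + arrivals t v p)%N.
Proof.
rewrite /departs /okB /targetB; case E : (sendB _ _ _ _ _ _) => [d|//] /andP[_ /eqP <-].
by move: E; rewrite /sendB; case: (chooseB _ _ _ _ _) => // d'; case: ifP => // + [<-].
Qed.

Lemma delivered_departs t p : (\sum_v cum (fun i => departs i v p) t <= (st t).2 p)%N.
Proof.
elim: t => [|t ih]; first by rewrite big1 // => v _; rewrite /cum big_ord0.
apply: leq_trans (delivered_step t p).
apply: leq_trans (leq_add ih (leqnn _)).
rewrite -sum1_card [X in (_ <= _ + X)%N]big_mkcond.
rewrite -big_split /=; apply: leq_sum => v _.
by rewrite cumS inE; case: (departs t v p).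
Qed.

(** [queue_departures] is applied to the queue of pair [p] at each relay separately; [a] and [b]
    mark times of guaranteed reception from the source and of guaranteed service opportunities
    towards the destination. *)
Lemma delivered_lower (p : nat) (s d : node k) (a b : node k -> nat -> bool) t1 t2 :
  rank s = p.*2 -> rank d = p.*2.+1 ->
  (forall v t, v != s -> v != d -> a v t -> clearA t s v) ->
  (forall v t, v != s -> v != d -> b v t -> clearB t v d) ->
  (t1 <= t2)%N ->
  (\sum_(v | (v != s) && (v != d)) minn (cum (a v) t1) (cum (b v) t2 - cum (b v) t1)
    <= (st t2).2 p)%N.
Proof.
move=> rs rd ha hb t12; apply: leq_trans (delivered_departs t2 p).
rewrite [leqRHS](bigID (fun v => (v != s) && (v != d)))/=.
apply: leq_trans (leq_addr _ _); apply: leq_sum => v /andP[vs vd].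
have ss : is_source u s by rewrite /is_source rs odd_double.
have dd : is_dest u d by rewrite /is_dest rd /= odd_double.
have ps : pair_of u s = p by rewrite /pair_of rs doubleK.
have pd : pair_of u d = p by rewrite /pair_of rd [_./2]/= uphalf_double.
apply: (queue_departures (Q := fun t => (st t).1 v p) (arr := fun t => arrivals t v p)
  (dep := fun t => departs t v p)) => //.
- by move=> t; exact: queue_step.
- by move=> t; exact: departs_busy.
- move=> t /(ha _ _ vs vd) cl; rewrite eq_sym in vs.
  have [re ok] := clearA_relay vs ss cl.
  apply/card_gt0P; exists s; rewrite inE ok re eqxx ps eqxx andbT /=.
  (* The packet enters the relay queue because [v], having another rank than [d], is not its
     destination. *)
  rewrite /to_dest rs -rd; apply/negP => /eqP /rank_inj vd'.
  by rewrite vd' eqxx in vd.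
- move=> t /(hb _ _ vs vd) cl q0.
  have := @clearB_send t v d (queueA t) vd dd cl; rewrite pd => /(_ q0)[sn ok].
  by rewrite /departs ok /targetB sn pd eqxx.
Qed.
End Dynamics.

(** * Counting grid points of the sphere in a strip *)

Section Counting.
Variable R : realType.
Implicit Types (a b c x y z w r t s q : R) (N : nat).

Lemma count_itv_le N a b : a <= b ->
  \sum_(i < N) (a <= i%:R <= b)%R%:R <= b - a + 1.
Proof.
move=> ab; rewrite -natr_sum; set P := fun i : 'I_N => a <= i%:R <= b.
rewrite (_ : (\sum_i _)%N = #|[set i | P i]%SET|); last first.
  by rewrite -sum1_card [RHS]big_mkcond; apply: eq_bigr => i _; rewrite inE /P; case: ifP.
have [->|[i0 Pi0]] := set_0Vmem [set i | P i]%SET; first by rewrite cards0; lra.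
have [i1 Pi1 lo] := arg_minnP (fun i : 'I_N => val i) Pi0.
have [i2 Pi2 hi] := arg_maxnP (fun i : 'I_N => val i) Pi0.
have sub : [set i | P i]%SET \subset [set i : 'I_N | (i1 <= i < i2.+1)%N]%SET.
  apply/fintype.subsetP => i Pi; rewrite [_ \in _]inE ltnS.
  by apply/andP; split; [exact: lo|exact: hi].
have := leq_trans (subset_leq_card sub) (card_ord_itv _ _ _).
rewrite -(ler_nat R) => h; apply: le_trans h _.
have i12 := lo _ Pi2.
rewrite natrB ?(leqW i12)// -addn1 natrD.
have PE i : mem [set i | P i]%SET i -> P i by rewrite -[mem _ i]/(i \in [set i | P i]%SET) inE.
by have /andP[? ?] := PE _ Pi1; have /andP[? ?] := PE _ Pi2; lra.
Qed.

Lemma count_itv_ge N a b : 0 <= a -> a <= b -> b <= N%:R ->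
  b - a - 2 <= \sum_(i < N) (a <= i%:R <= b)%R%:R.
Proof.
move=> a0 ab bN; rewrite -natr_sum; set P := fun i : 'I_N => a <= i%:R <= b.
have b0 : 0 <= b by exact: le_trans ab.
have /andP[p1 p2] := truncn_itv a0; have /andP[q1 q2] := truncn_itv b0.
set p := Num.truncn a in p1 p2; set q := Num.truncn b in q1 q2.
have qN : (q <= N)%N by rewrite -(ler_nat R); exact: le_trans bN.
rewrite (_ : (\sum_i _)%N = #|[set i | P i]%SET|); last first.
  by rewrite -sum1_card [RHS]big_mkcond; apply: eq_bigr => i _; rewrite inE /P; case: ifP.
have sub : (q - p.+1 <= #|[set i | P i]%SET|)%N.
  rewrite -[X in (X <= _)%N]card_ord.
  have lt (i : 'I_(q - p.+1)) : (p.+1 + i < N)%N by have := ltn_ord i; lia.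
  have inj : injective (fun i : 'I_(q - p.+1) => Ordinal (lt i)).
    by move=> i j [] /addnI/val_inj.
  rewrite -(card_imset predT inj); apply/subset_leq_card/fintype.subsetP.
  move=> _ /imsetP[i _ ->]; rewrite inE /P /=; apply/andP; split.
    by apply: le_trans (ltW p2) _; rewrite ler_nat leq_addr.
  by apply: le_trans q1; rewrite ler_nat; have := ltn_ord i; lia.
rewrite -(ler_nat R) in sub; apply: le_trans sub.
have [pq|pq] := leqP p.+1 q; last first.
  have : q%:R <= p%:R :> R by rewrite ler_nat -ltnS.
  have : 0 <= (q - p.+1)%:R :> R by [].
  by move: p1 q2; rewrite -[q.+1]addn1 natrD; lra.
have e : (q - p.+1)%:R = q%:R - p%:R - 1 :> R by rewrite natrB// -[p.+1]addn1 natrD opprD addrA.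
by rewrite e; move: q2 p1; rewrite -[q.+1]addn1 natrD; lra.
Qed.

Lemma count_disc N (c s : R) x0 : 0 < s -> 0 <= c ->
  \sum_(i < N) (`|i%:R * s - x0| <= c)%R%:R <= 2 * c / s + 1.
Proof.
move=> s0 c0.
have e (i : 'I_N) : (`|i%:R * s - x0| <= c) = ((x0 - c) / s <= i%:R <= (x0 + c) / s).
  rewrite ler_distl ler_pdivrMr// ler_pdivlMr//.
under eq_bigr => i _ do rewrite e.
apply: le_trans (count_itv_le _ _) _.
  by rewrite ler_pM2r ?invr_gt0//; lra.
rewrite lerD2r (_ : _ - _ = 2 * c / s)//; field.
by rewrite gt_eqF.
Qed.

(** The listed centers are the zeros of the sine on the interval. Near a zero, a distance up to 1 is
    controlled by y / 2 <= sin y; beyond that [s] is at least 1 / 2 while the distance stays below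
    2, whence the constant 4. *)
Lemma sin_small_near x s : - (2 * pi) <= x <= 2 * pi -> `|sin x| <= s ->
  exists2 c, c \in [:: 0; pi; - pi; 2 * pi; - (2 * pi)] & `|x - c| <= 4 * s.
Proof.
have pi2 := pi_ge2 R; have pi4 : pi / 2 < 2 :> R := pihalf_lt2 R.
have base y : 0 <= y <= pi / 2 -> `|sin y| <= s -> y <= 4 * s.
  case/andP=> y0 yp /(le_trans (ler_norm _)) h; have [y1|y1] := leP y 1.
    by have := @sin_ge_half R y; rewrite y0 y1 => /(_ isT); lra.
  have s1 : 1 / 2 <= sin (1 : R) by apply: sin_ge_half; rewrite ler01 lexx.
  have : sin 1 < sin y by rewrite ltr_sin// in_itv/=; apply/andP; split; lra.
  by lra.
wlog x0 : x / 0 <= x.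
  move=> H /andP[xl xh] h; have [x0|/ltW x0] := leP 0 x.
    by apply: H => //; rewrite xl xh.
  have [c cin hc] : exists2 c, c \in [:: 0; pi; - pi; 2 * pi; - (2 * pi)] & `|- x - c| <= 4 * s.
    by apply: H; [lra|apply/andP; split; lra|rewrite sinN normrN].
  exists (- c); last by rewrite opprK -normrN opprD.
  move: cin; rewrite !inE => /or4P[/eqP->|/eqP->|/eqP->|/orP[/eqP->|/eqP->]];
    by rewrite ?oppr0 ?opprK eqxx ?orbT.
case/andP=> _ xh h.
have [x1|x1] := leP x (pi / 2).
  exists 0; first by rewrite inE eqxx.
  by rewrite subr0 ger0_norm//; apply: base; rewrite ?x0.
have [x2|x2] := leP x (pi + pi / 2).
  exists pi; first by rewrite !inE eqxx orbT.
  have sx : `|sin (x - pi)| <= s by rewrite -[x - pi]opprB sinN normrN addrC sinDpi sinN opprK.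
  have [x3|/ltW x3] := leP 0 (x - pi).
    by rewrite ger0_norm//; apply: base => //; apply/andP; split; lra.
  rewrite ler0_norm//; apply: base; first by apply/andP; split; lra.
  by rewrite sinN normrN.
exists (2 * pi); first by rewrite !inE eqxx !orbT.
rewrite ler0_norm; last by lra.
apply: base; first by apply/andP; split; lra.
by rewrite opprB addrC [2 * pi]mulr_natl sinD2pi sinN normrN.
Qed.

(** Lower corners of the cells for height and longitude; [wgrid] is the radius of the parallel at
    that height. *)
Definition zgrid N (i : nat) : R := 2 * (i%:R / N%:R) - 1.
Definition wgrid N (i : nat) : R := Num.sqrt (1 - zgrid N i ^+ 2).
Definition pgrid N (j : nat) : R := 2 * pi * (j%:R / N%:R).

Lemma count_sin_small N (th s : R) : (0 < N)%N -> 0 <= th <= 2 * pi -> 0 <= s ->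
  \sum_(j < N) (`|sin (pgrid N j - th)| <= s)%R%:R <= 5 * (4 * s * N%:R + 1).
Proof.
move=> N0 /andP[t0 t1] s0; have Nr : 0 < N%:R :> R by rewrite ltr0n.
have p0 := pi_gt0 R; have pi2 := pi_ge2 R.
have sp : 0 < 2 * pi / N%:R :> R by rewrite divr_gt0// mulr_gt0.
set l := [:: 0; pi; - pi; 2 * pi; - (2 * pi)] : seq R.
apply: (@le_trans _ _ (\sum_(c <- l) \sum_(j < N) (`|j%:R * (2 * pi / N%:R) - (th + c)| <= 4 * s)%R%:R)).
  rewrite exchange_big /=; apply: ler_sum => j _.
  case: (boolP (`|sin (pgrid N j - th)| <= s)) => [h|_]; last by apply: sumr_ge0.
  have [|c cl hc] := @sin_small_near (pgrid N j - th) s _ h.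
    have : 0 <= pgrid N j by rewrite /pgrid mulr_ge0 ?divr_ge0// mulr_ge0// ltW.
    have : pgrid N j <= 2 * pi.
      rewrite /pgrid ler_piMr ?mulr_ge0 ?(ltW p0)// ler_pdivrMr// mul1r ler_nat.
      exact: ltnW.
    by move=> ? ?; apply/andP; split; lra.
  have : `|j%:R * (2 * pi / N%:R) - (th + c)| <= 4 * s.
    rewrite (_ : _ - _ = pgrid N j - th - c)// /pgrid; field.
    by rewrite gt_eqF.
  move=> {}hc; rewrite (big_rem c)//= hc lerDl; exact: sumr_ge0.
apply: (@le_trans _ _ (\sum_(c <- l) (4 * s * N%:R + 1))).
  apply: ler_sum => c _; apply: le_trans (count_disc _ _ sp _) _; first by rewrite mulr_ge0.
  rewrite lerD2r ler_pdivrMr//.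
  rewrite (_ : 4 * s * N%:R * _ = 4 * s * (2 * pi)); last by field; rewrite gt_eqF.
  by nra.
by rewrite !big_cons big_nil; lra.
Qed.

(** If [X] lies between 2^I q and 2^(I+1) q in absolute value, the left-hand side is at most 4^(-I),
    which is the term of index I + 1. *)
Lemma dyadic_layers (q X : R) (I : nat) : 0 < q -> `|X| <= 2 ^+ I * q ->
  q ^+ 2 / (q ^+ 2 + X ^+ 2) <=
  \sum_(i < I.+1) 4 * (4^-1) ^+ i * (`|X| <= 2 ^+ i * q)%R%:R.
Proof.
move=> q0; have q2 : 0 < q ^+ 2 by rewrite exprn_gt0.
have d0 : 0 < q ^+ 2 + X ^+ 2 by rewrite ltr_wpDr ?sqr_ge0.
elim: I => [|I ih] h.
  rewrite big_ord1 h expr0 mulr1 mulr1 ler_pdivrMr//.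
  by have := sqr_ge0 X; lra.
rewrite big_ord_recr /= h mulr1.
have [h'|h'] := leP `|X| (2 ^+ I * q).
  by apply: le_trans (ih h') _; rewrite lerDl mulr_ge0// exprn_ge0.
apply: (@le_trans _ _ (4 * (4^-1) ^+ I.+1)); last first.
  by rewrite lerDr; apply: sumr_ge0 => i _; rewrite !mulr_ge0// exprn_ge0.
rewrite [4^-1 ^+ _]exprS mulrA mulfV// mul1r exprVn ler_pdivrMr// mulrC ler_pdivlMr ?exprn_gt0//.
have : (2 ^+ I * q) ^+ 2 <= X ^+ 2.
  rewrite -[leRHS]real_normK ?num_real// lerXn2r ?nnegrE ?(ltW h')//.
  by rewrite mulr_ge0 ?exprn_ge0// ltW.
rewrite exprMn exprAC (_ : 2 ^+ 2 = 4 :> R); last by ring.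
by move=> h2; rewrite mulrC; lra.
Qed.

(** A discrete form of the fact that the integral of q / (q^2 + x^2) is bounded uniformly in [q].
    Layer [i] contains O(2^i q N) longitudes and contributes O(2^(-i) N), a geometric series; [N]
    layers reach the value 1, since q 2^N >= q N >= 1. *)
Lemma sum_lorentz N (A th q : R) : (0 < N)%N -> 0 <= th <= 2 * pi ->
  1 / 3 <= A <= 1 -> 1 <= q * N%:R -> q <= 1 ->
  \sum_(j < N) q / (q ^+ 2 + (A * sin (pgrid N j - th)) ^+ 2) <= 960 * N%:R.
Proof.
move=> N0 th01 /andP[A1 A2] qN q1; have Nr : 0 < N%:R :> R by rewrite ltr0n.
have q0 : 0 < q by rewrite -(pmulr_lgt0 _ Nr); lra.
pose X j := A * sin (pgrid N j - th).
have X1 j : `|X j| <= 2 ^+ N * q.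
  apply: (@le_trans _ _ 1).
    rewrite /X normrM ger0_norm; last by lra.
    by rewrite mulr_ile1//; [lra|exact: sin_max].
  apply: le_trans qN _; rewrite mulrC ler_pM2r//.
  rewrite -natrX ler_nat; exact/ltnW/ltn_expl.
have cnt t : 0 <= t -> \sum_(j < N) (`|X j| <= t)%R%:R <= 60 * (t * N%:R + 1).
  move=> t0; apply: (@le_trans _ _ (\sum_(j < N) (`|sin (pgrid N j - th)| <= 3 * t)%R%:R)).
    apply: ler_sum => j _; rewrite ler_nat; case: (boolP (`|X j| <= t)) => // h.
    have -> // : `|sin (pgrid N j - th)| <= 3 * t.
    move: h; rewrite /X normrM ger0_norm; last by lra.
    by have := normr_ge0 (sin (pgrid N j - th)); nra.
  apply: le_trans (count_sin_small _ th01 _) _ => //; first by lra.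
  have : 0 <= t * N%:R by exact: mulr_ge0.
  by lra.
apply: (@le_trans _ _ (\sum_(j < N) q^-1 *
    \sum_(i < N.+1) 4 * (4^-1) ^+ i * (`|X j| <= 2 ^+ i * q)%R%:R)).
  apply: ler_sum => j _; rewrite -ler_pdivrMl ?invr_gt0// invrK.
  rewrite mulrA -expr2; exact: dyadic_layers (X1 j).
rewrite -mulr_sumr exchange_big /= -ler_pdivlMl ?invr_gt0// invrK.
apply: (@le_trans _ _ (\sum_(i < N.+1) 480 * (q * N%:R) * (2^-1) ^+ i)).
  apply: ler_sum => i _; rewrite -mulr_sumr.
  have t0 : 0 <= 2 ^+ i * q by rewrite mulr_ge0 ?exprn_ge0// ltW.
  have e4 : (4^-1 : R) ^+ i = (2^-1) ^+ i * (2^-1) ^+ i.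
    by rewrite -exprMn; congr (_ ^+ _); field.
  have e2 : (2^-1 : R) ^+ i * 2 ^+ i = 1 by rewrite -exprMn mulVf// expr1n.
  have h0 : 0 < (2^-1 : R) ^+ i by rewrite exprn_gt0.
  apply: le_trans (ler_wpM2l _ (cnt _ t0)) _; first by rewrite mulr_ge0// exprn_ge0.
  rewrite e4; have g1 : 1 <= (2 : R) ^+ i by rewrite exprn_ege1// ler1n.
  move: h0 e2 g1; set g := (2^-1) ^+ i; set G := 2 ^+ i => h0 e2 g1.
  have -> : 4 * (g * g) * (60 * (G * q * N%:R + 1)) =
    240 * g * ((g * G) * (q * N%:R) + g) by ring.
  have g1' : g <= 1 by rewrite -e2; nra.
  have : 0 <= g * (q * N%:R - g) by apply: mulr_ge0; lra.
  by rewrite e2 mul1r; lra.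
rewrite -mulr_sumr.
have geo : \sum_(i < N.+1) (2^-1 : R) ^+ i <= 2.
  have := subrX1 (2^-1 : R) N.+1; have : 0 <= (2^-1 : R) ^+ N.+1 by rewrite exprn_ge0.
  by set S := \sum_(i < _) _; set G := _ ^+ N.+1; lra.
have qN0 : 0 <= q * N%:R by lra.
by set S := \sum_(i < _) _ in geo *; nra.
Qed.

(** Rotate (w, z) by the direction of (X, b): the coordinates [h] and [g] satisfy h^2 + g^2 = d^2. A
    small [h] forces [g] to within r^2 / d of d or -d, so [z] is close to one of the two roots. *)
Lemma strip_root_near (X b z w r : R) : 0 <= w -> w ^+ 2 + z ^+ 2 = 1 ->
  0 < X ^+ 2 + b ^+ 2 -> `|X * w + b * z| <= r ->
  exists2 x0, x0 \in [:: X / Num.sqrt (X ^+ 2 + b ^+ 2); - (X / Num.sqrt (X ^+ 2 + b ^+ 2))] &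
    `|z - x0| <= r * (`|b| + r) / (X ^+ 2 + b ^+ 2).
Proof.
move=> w0 wz d0 hr; set d2 := X ^+ 2 + b ^+ 2 in d0 *.
set d := Num.sqrt d2; have dp : 0 < d by rewrite sqrtr_gt0.
have dd : d ^+ 2 = d2 by rewrite sqr_sqrtr// ltW.
have dn : d != 0 by rewrite gt_eqF.
pose h := X * w + b * z; pose g := b * w - X * z.
have hg : h ^+ 2 + g ^+ 2 = d ^+ 2.
  by rewrite dd /d2 -[RHS]mulr1 -wz /h /g; ring.
have ze : z = (b * h - X * g) / d ^+ 2.
  have -> : b * h - X * g = z * d ^+ 2 by rewrite dd /h /g /d2; ring.
  by rewrite mulfK// expf_neq0.
have r0 : 0 <= r by exact: le_trans (normr_ge0 _) hr.
have Xd : `|X| <= d.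
  by rewrite -[leLHS]sqrtr_sqr; apply: ler_wsqrtr; rewrite /d2 lerDl sqr_ge0.
have h2 : h ^+ 2 <= r ^+ 2 by rewrite -[leLHS]real_normK ?num_real// lerXn2r ?nnegrE.
have key e : e = 1 \/ e = -1 -> 0 <= e * g -> `|z - (- e * (X / d))| <= r * (`|b| + r) / d2.
  move=> e1 eg; have ee : e ^+ 2 = 1 by case: e1 => ->; ring.
  have ne : `|e| = 1 by case: e1 => ->; rewrite ?normrN normr1.
  have -> : z - (- e * (X / d)) = (b * h + e * X * (d - e * g)) / d ^+ 2.
    rewrite {1}ze; have -> : e * X * (d - e * g) = e * X * d - e ^+ 2 * X * g by ring.
    by rewrite ee; field.
  rewrite -dd normrM normfV [`|d ^+ 2|]ger0_norm ?sqr_ge0// ler_pM2r ?invr_gt0 ?exprn_gt0//.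
  apply: le_trans (ler_normD _ _) _; rewrite [leRHS]mulrDr; apply: lerD.
    by rewrite normrM mulrC ler_wpM2r.
  rewrite !normrM ne mul1r.
  have dg0 : 0 <= d - e * g.
    rewrite subr_ge0 -[leLHS]ger0_norm// -[leRHS]ger0_norm ?(ltW dp)//.
    rewrite -ler_sqr ?nnegrE// !real_normK ?num_real// exprMn ee mul1r.
    by have := sqr_ge0 h; lra.
  have gd : (d - e * g) * d <= r ^+ 2.
    have eg2 : (e * g) ^+ 2 = g ^+ 2 by rewrite exprMn ee mul1r.
    have : 0 <= (d - e * g) * (e * g) by rewrite mulr_ge0.
    have : (d - e * g) * d + (d - e * g) * (e * g) = d ^+ 2 - (e * g) ^+ 2 by ring.
    by lra.
  rewrite [`|d - _|]ger0_norm// mulrC -expr2; apply: le_trans gd.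
  by rewrite ler_wpM2l.
have [g0|/ltW g0] := leP 0 g.
  exists (- (X / d)); first by rewrite !inE eqxx orbT.
  by have := key 1 (or_introl erefl); rewrite mul1r mulN1r; apply.
exists (X / d); first by rewrite !inE eqxx.
by have := key (-1) (or_intror erefl); rewrite opprK mul1r; apply; rewrite mulN1r oppr_ge0.
Qed.


Lemma amplitude_phase (y1 y2 : R) : exists A th, [/\ 0 <= A, 0 <= th <= 2 * pi,
  A ^+ 2 = y1 ^+ 2 + y2 ^+ 2 & forall p, y1 * cos p + y2 * sin p = A * sin (p - th)].
Proof.
have n0 : 0 <= y1 ^+ 2 + y2 ^+ 2 by rewrite addr_ge0 ?sqr_ge0.
set A := Num.sqrt (y1 ^+ 2 + y2 ^+ 2).
have A2 : A ^+ 2 = y1 ^+ 2 + y2 ^+ 2 by rewrite sqr_sqrtr.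
have [A0|An] := eqVneq A 0.
  have y10 : y1 = 0 by have := sqr_ge0 y2; have := sqr_ge0 y1; rewrite A0 in A2; nra.
  have y20 : y2 = 0 by have := sqr_ge0 y2; have := sqr_ge0 y1; rewrite A0 in A2; nra.
  exists 0, 0; split; rewrite ?lexx ?mulr_ge0 ?pi_ge0//; first by rewrite -A2 A0.
  by move=> p; rewrite y10 y20; ring.
have : (y2 / A) ^+ 2 + (- y1 / A) ^+ 2 = 1.
  rewrite (_ : _ + _ = (y1 ^+ 2 + y2 ^+ 2) / A ^+ 2); last by field.
  by rewrite A2 divff// -A2 expf_neq0.
move=> /polar_angle[th [th01 c s]]; exists A, th; split; rewrite ?sqrtr_ge0//.
by move=> p; rewrite sinB -c -s; field.
Qed.

Lemma zgrid_itv N i : (i < N)%N -> -1 <= zgrid N i <= 1.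
Proof.
move=> iN; have N0 : 0 < N%:R :> R by rewrite ltr0n (leq_ltn_trans _ iN).
have l1 : i%:R / N%:R <= 1 :> R by rewrite ler_pdivrMr// mul1r ler_nat ltnW.
have l0 : 0 <= i%:R / N%:R :> R by rewrite divr_ge0.
by rewrite /zgrid; apply/andP; split; lra.
Qed.

Lemma wgrid_ge0 N i : 0 <= wgrid N i. Proof. exact: sqrtr_ge0. Qed.

Lemma wgrid2 N i : (i < N)%N -> wgrid N i ^+ 2 + zgrid N i ^+ 2 = 1.
Proof. by move=> /zgrid_itv/andP[? ?]; rewrite sqr_sqrtr; [ring|nra]. Qed.

(* Scalar product of [(y1, y2, b)] with the unit vector of height [zgrid N i] and
   longitude [pgrid N j]. *)
Definition height N (y1 y2 b : R) (i j : nat) : R :=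
  wgrid N i * (y1 * cos (pgrid N j) + y2 * sin (pgrid N j)) + b * zgrid N i.

(* At a fixed longitude the strip is met near the two roots of [w X + b z = 0]; the
   Lorentzian bound is then summed over the longitudes by [sum_lorentz]. *)
Lemma column_upper N (X b r q : R) : (0 < N)%N -> 0 < r -> q = Num.max `|b| r ->
  \sum_(i < N) (`|wgrid N i * X + b * zgrid N i| <= r)%R%:R <=
  8 * N%:R * r * (q / (q ^+ 2 + X ^+ 2)) + 2.
Proof.
move=> N0 r0 qE; have Nr : 0 < N%:R :> R by rewrite ltr0n.
have q0 : 0 < q by rewrite qE lt_max r0 orbT.
have d0 : 0 < q ^+ 2 + X ^+ 2 by rewrite ltr_wpDr ?sqr_ge0 ?exprn_gt0.
have b2 : `|b| ^+ 2 = b ^+ 2 by rewrite real_normK ?num_real.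
have X2 := sqr_ge0 X; have bn := normr_ge0 b.
have near eps : 0 < X ^+ 2 + b ^+ 2 -> r * (`|b| + r) <= eps * (X ^+ 2 + b ^+ 2) ->
    \sum_(i < N) (`|wgrid N i * X + b * zgrid N i| <= r)%R%:R <= 2 * (eps * N%:R) + 2.
  move=> rho0 he; set l := [:: X / Num.sqrt (X ^+ 2 + b ^+ 2); - (X / Num.sqrt (X ^+ 2 + b ^+ 2))].
  apply: (@le_trans _ _ (\sum_(c <- l) \sum_(i < N) (`|i%:R * (2 / N%:R) - (1 + c)| <= eps)%R%:R)).
    rewrite exchange_big /=; apply: ler_sum => i _.
    case: (boolP (`|_| <= r)) => [h|_]; last by apply: sumr_ge0.
    rewrite [_ * X]mulrC in h.
    have [x0 x0l hx] := strip_root_near (wgrid_ge0 N i) (wgrid2 (ltn_ord i)) rho0 h.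
    have hx' : `|i%:R * (2 / N%:R) - (1 + x0)| <= eps.
      rewrite (_ : _ - _ = zgrid N i - x0); last by rewrite /zgrid; field; rewrite gt_eqF.
      by apply: le_trans hx _; rewrite ler_pdivrMr.
    by rewrite (big_rem x0)//= hx' lerDl; exact: sumr_ge0.
  apply: (@le_trans _ _ (\sum_(c <- l) (eps * N%:R + 1))).
    apply: ler_sum => c _; apply: le_trans (count_disc _ _ _ _) _.
    - by rewrite divr_gt0.
    - have : 0 <= r * (`|b| + r) by rewrite mulr_ge0 ?addr_ge0// ltW.
      by move=> /le_trans/(_ he); rewrite pmulr_lge0.
    rewrite lerD2r (_ : 2 * eps / (2 / N%:R) = eps * N%:R)//; field.
    by rewrite gt_eqF.
  by rewrite !big_cons big_nil; lra.
have fin eps : r * q * 4 = eps * (q ^+ 2 + X ^+ 2) ->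
    2 * (eps * N%:R) + 2 <= 8 * N%:R * r * (q / (q ^+ 2 + X ^+ 2)) + 2.
  move=> he; rewrite lerD2r (_ : q / _ = eps / (4 * r)).
    by rewrite (_ : 8 * N%:R * r * _ = 2 * (eps * N%:R))//; field; rewrite gt_eqF.
  have -> : eps = r * q * 4 / (q ^+ 2 + X ^+ 2) by rewrite he mulfK// gt_eqF.
  by field; rewrite !gt_eqF.
(* The factor 4 covers both r (|b| + r) <= 2 r q and, when |b| < r <= |X|, the comparison of q^2 +
   X^2 with twice X^2 + b^2. *)
pose eps := r * q * 4 / (q ^+ 2 + X ^+ 2).
have epsE : r * q * 4 = eps * (q ^+ 2 + X ^+ 2) by rewrite /eps divfK// gt_eqF.
have [br|rb] := leP r `|b|.
  have qb : q = `|b| by rewrite qE max_l.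
  have q2 : q ^+ 2 = b ^+ 2 by rewrite qb b2.
  have e : X ^+ 2 + b ^+ 2 = q ^+ 2 + X ^+ 2 by rewrite q2 addrC.
  apply: le_trans (near eps _ _) (fin _ epsE); rewrite e // -epsE -qb.
  have : 0 <= r * (q - r) by rewrite mulr_ge0 ?subr_ge0 ?qb// ltW.
  by have := mulr_gt0 r0 q0; lra.
have qr : q = r by rewrite qE max_r// ltW.
have [Xr|Xr] := leP (r ^+ 2) (X ^+ 2).
  have r2 : 0 < r ^+ 2 by rewrite exprn_gt0.
  apply: le_trans (near eps _ _) (fin _ epsE); first by have := sqr_ge0 b; lra.
  have e0 : 0 < eps by rewrite /eps divr_gt0// !mulr_gt0.
  have : eps * (q ^+ 2 + X ^+ 2) <= 2 * (eps * (X ^+ 2 + b ^+ 2)).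
    rewrite mulrCA ler_pM2l// qr; have := sqr_ge0 b; lra.
  have : r * (`|b| + r) <= 2 * r ^+ 2 by nra.
  by rewrite -epsE qr; lra.
(* Now |b| and |X| are both below [r] and the whole column may lie in the strip; the trivial count
   [N] fits, because q^2 / (q^2 + X^2) >= 1 / 2. *)
apply: (@le_trans _ _ N%:R).
  have l1 (i : 'I_N) : (`|wgrid N i * X + b * zgrid N i| <= r)%R%:R <= 1 :> R.
    by rewrite lern1 leq_b1.
  by apply: le_trans (ler_sum _ (fun i _ => l1 i)) _; rewrite sumr_const card_ord.
have : 1 / 2 <= q * (q / (q ^+ 2 + X ^+ 2)).
  by rewrite mulrA -expr2 ler_pdivlMr// qr; lra.
set f := q / _; rewrite -qr; nra.
Qed.

(** If the horizontal amplitude [A] is at least 1 / 3, the column bounds are summed by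
    [sum_lorentz]; otherwise |b| >= 1 / 3 and each Lorentzian is at most 3. The norm is only bounded
    below by 1 / 4 because the direction will be a rounded unit vector. The constant 8000 exceeds 8
    * 960 plus 2 for the boundary terms. *)
Lemma height_upper N (y1 y2 b r : R) : 1 / 4 <= y1 ^+ 2 + y2 ^+ 2 + b ^+ 2 <= 1 ->
  0 < r <= 1 -> 1 <= r * N%:R ->
  \sum_(i < N) \sum_(j < N) (`|height N y1 y2 b i j| <= r)%R%:R <= 8000 * r * N%:R ^+ 2.
Proof.
move=> /andP[y_ge y_le] /andP[r0 r1] rN.
have Nr : 0 < N%:R :> R by rewrite -(pmulr_rgt0 _ r0); lra.
have N0 : (0 < N)%N by rewrite -(ltr0n R).
have [A [th [A0 th01 A2 hA]]] := amplitude_phase y1 y2.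
pose q := Num.max `|b| r.
have q0 : 0 < q by rewrite lt_max r0 orbT.
have b2 : `|b| ^+ 2 = b ^+ 2 by rewrite real_normK ?num_real.
have bn := normr_ge0 b.
have q1 : q <= 1.
  by rewrite ge_max r1 andbT; have := sqr_ge0 y1; have := sqr_ge0 y2; nra.
have qr : r <= q by rewrite le_max lexx orbT.
have qb : `|b| <= q by rewrite le_max lexx.
have qN : 1 <= q * N%:R by apply: le_trans rN _; rewrite ler_pM2r.
rewrite exchange_big /=.
have col j := @column_upper N (A * sin (pgrid N j - th)) b r q N0 r0 erefl.
under eq_bigr => j _ do under eq_bigr => i _ do rewrite /height hA.
apply: le_trans (ler_sum _ (fun j _ => col (val j))) _.
rewrite big_split/= -mulr_sumr sumr_const card_ord -[2 *+ _]mulr_natl.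
set S := \sum_(j < N) _.
suff hS : S <= 960 * N%:R.
  have : 8 * N%:R * r * S <= 8 * N%:R * r * (960 * N%:R).
    by rewrite ler_wpM2l// !mulr_ge0// ltW.
  have : N%:R <= N%:R * (r * N%:R) by rewrite ler_peMr// ltW.
  have : 0 < N%:R * (r * N%:R) by rewrite !mulr_gt0.
  by rewrite expr2; nra.
have [A1|A1] := leP (1 / 3) A.
  apply: sum_lorentz => //; rewrite A1.
  by have := sqr_ge0 b; nra.
have q3 : 1 / 3 <= q by nra.
apply: (@le_trans _ _ (\sum_(j < N) 3)); last first.
  by rewrite sumr_const card_ord -[3 *+ _]mulr_natl; lra.
apply: ler_sum => j _; set X := A * _.
have d0 : 0 < q ^+ 2 + X ^+ 2 by rewrite ltr_wpDr ?sqr_ge0 ?exprn_gt0.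
by rewrite ler_pdivrMr//; have := sqr_ge0 X; nra.
Qed.

(** Only one half of the arc around [p] is used, on the side that stays inside [0, 2 pi]; 2 pi < 8
    gives the constant. *)
Lemma count_arc N (p r : R) : (0 < N)%N -> 0 <= p <= 2 * pi -> 0 <= r <= 1 ->
  r * N%:R / 8 - 2 <= \sum_(j < N) (`|pgrid N j - p| <= r)%R%:R.
Proof.
move=> N0 /andP[p0 p2] /andP[r0 r1]; have Nr : 0 < N%:R :> R by rewrite ltr0n.
have pi2 := pi_ge2 R; have pi4 : pi / 2 < 2 :> R := pihalf_lt2 R; have pp := pi_gt0 R.
have tp : 0 < 2 * pi :> R by lra.
have [a [a0 ap ar]] : exists a, [/\ 0 <= a, a + r <= 2 * pi & a <= p <= a + r].
  have [pl|pl] := leP p pi.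
    by exists p; split; rewrite ?lexx//=; lra.
  by exists (p - r); split; [lra|lra|apply/andP; split; lra].
pose f x := x * (N%:R / (2 * pi)).
have ff (x y : R) : x <= y -> f x <= f y.
  by move=> xy; rewrite /f ler_wpM2r// divr_ge0// ltW.
have f0 : 0 <= f a by rewrite /f mulr_ge0// divr_ge0// ltW.
have fN : f (a + r) <= N%:R.
  by apply: le_trans (ff _ _ ap) _; rewrite /f mulrC divfK ?gt_eqF.
have far : f a <= f (a + r) by apply: ff; lra.
apply: (@le_trans _ _ (f (a + r) - f a - 2)).
  rewrite lerD2r (_ : f (a + r) - f a = r * N%:R * (2 * pi)^-1); last first.
    by rewrite /f -mulrBl addrAC subrr add0r mulrA.
  rewrite ler_wpM2l ?mulr_ge0// lef_pV2 ?posrE//; lra.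
apply: le_trans (count_itv_ge f0 far fN) _; apply: ler_sum => j _.
rewrite ler_nat; case: (boolP (f a <= j%:R <= f (a + r))) => // /andP[j1 j2].
have fld (x y P : R) : x != 0 -> P != 0 -> y = 2 * P * (y / x) * (x / (2 * P)).
  by move=> x0 P0; field; rewrite P0 x0.
have pE : j%:R = f (pgrid N j) by apply: fld; rewrite gt_eqF.
have finv x y : f x <= f y -> x <= y by rewrite /f ler_pM2r// divr_gt0.
rewrite pE in j1 j2; move/finv: j1 => j1; move/finv: j2 => j2.
have -> // : `|pgrid N j - p| <= r.
by case/andP: ar => ? ?; rewrite ler_norml; apply/andP; split; lra.
Qed.

Lemma count_rows N (x r : R) : (0 < N)%N -> -1 <= x - r -> 0 <= r -> x + r <= 1 ->
  r * N%:R - 2 <= \sum_(i < N) (`|zgrid N i - x| <= r)%R%:R.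
Proof.
move=> N0 l1 r0 l2; have Nr : 0 < N%:R :> R by rewrite ltr0n.
have h1 : 0 <= (x - r + 1) / 2 * N%:R by apply: mulr_ge0; [lra|exact: ltW].
have h2 : (x - r + 1) / 2 * N%:R <= (x + r + 1) / 2 * N%:R by rewrite ler_wpM2r//; lra.
have h3 : (x + r + 1) / 2 * N%:R <= N%:R by rewrite ler_piMl//; lra.
have -> : r * N%:R - 2 = (x + r + 1) / 2 * N%:R - (x - r + 1) / 2 * N%:R - 2 by field.
apply: le_trans (count_itv_ge h1 h2 h3) _; apply: ler_sum => i _.
rewrite ler_nat; case: (boolP (_ <= i%:R <= _)) => // /andP[].
have -> : i%:R = (zgrid N i + 1) / 2 * N%:R by rewrite /zgrid; field; rewrite gt_eqF.
rewrite !ler_pM2r// => i1 i2.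
have -> // : `|zgrid N i - x| <= r by rewrite ler_norml; apply/andP; split; lra.
Qed.

(** Away from the poles of the sphere [w] is 2-Lipschitz in [z], so moving [z] by r / 4 from the
    root changes the height by at most 3 r / 4. *)
Lemma strip_root_stable (X b z0 w0 z w r : R) : `|X| <= 1 -> `|b| <= 1 ->
  X * w0 + b * z0 = 0 -> 4 / 5 <= w0 -> 0 <= w ->
  w0 ^+ 2 + z0 ^+ 2 = 1 -> w ^+ 2 + z ^+ 2 = 1 -> 0 < r <= 1 / 2 -> `|z - z0| <= r / 4 ->
  `|X * w + b * z| <= r.
Proof.
move=> X1 b1 h0 w45 wp e0 e1 /andP[r0 r1] hz.
have -> : X * w + b * z = X * (w - w0) + b * (z - z0) by rewrite -[LHS]subr0 -h0; ring.
have w32 : `|w - w0| <= 2 * `|z - z0|.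
  have fac : (w - w0) * (w + w0) = - ((z - z0) * (z + z0)).
    have -> : (w - w0) * (w + w0) = w ^+ 2 - w0 ^+ 2 by ring.
    have -> : - ((z - z0) * (z + z0)) = z0 ^+ 2 - z ^+ 2 by ring.
    by lra.
  have := congr1 Num.norm fac; rewrite normrN !normrM [`|w + w0|]ger0_norm; last by lra.
  have z35 : `|z0| <= 3 / 5.
    by rewrite -ler_sqr ?nnegrE// real_normK ?num_real//; nra.
  have zz : `|z + z0| <= 3 / 2.
    have -> : z + z0 = (z - z0) + (z0 + z0) by ring.
    by apply: le_trans (ler_normD _ _) _; have := ler_normD z0 z0; lra.
  have := normr_ge0 (w - w0); have := normr_ge0 (z - z0).
  set u := `|w - w0|; set v := `|z - z0|; set c := `|z + z0| in zz *; nra.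
apply: le_trans (ler_normD _ _) _; rewrite !normrM.
have := normr_ge0 X; have := normr_ge0 b; have := normr_ge0 (w - w0); have := normr_ge0 (z - z0).
set u := `|w - w0| in w32 *; set v := `|z - z0| in hz w32 *.
set p := `|X| in X1 *; set q := `|b| in b1 * => v0 u0 q0 p0.
have : p * u <= u by rewrite ler_piMl.
have : q * v <= v by rewrite ler_piMl.
by lra.
Qed.

(** When |X| <= |b| / 2 the column crosses the plane at a height [z0] with [w0] at least 4 / 5, and
    every row within r / 4 of [z0] lies in the strip. [ee] is the sign of [b]. *)
Lemma column_lower N (X b r : R) : (0 < N)%N -> `|X| <= 1 -> `|b| <= 1 ->
  X ^+ 2 <= b ^+ 2 / 4 -> 0 < b ^+ 2 -> 0 < r <= 1 / 2 -> 256 <= r * N%:R ->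
  r * N%:R / 8 <= \sum_(i < N) (`|wgrid N i * X + b * zgrid N i| <= r)%R%:R.
Proof.
move=> N0 X1 b1 X2 b0 /andP[r0 r1] rN.
set d := Num.sqrt (X ^+ 2 + b ^+ 2).
have dd : d ^+ 2 = X ^+ 2 + b ^+ 2 by rewrite sqr_sqrtr// addr_ge0 ?sqr_ge0.
have dp : 0 < d by rewrite sqrtr_gt0; have := sqr_ge0 X; lra.
have dn : d != 0 by rewrite gt_eqF.
have [ee e1] : exists e, e * b = `|b| /\ e ^+ 2 = 1.
  have [h|h] := leP 0 b.
    by exists 1; split; [rewrite mul1r ger0_norm|ring].
  by exists (-1); split; [rewrite mulN1r ltr0_norm|ring].
have bb2 : `|b| ^+ 2 = b ^+ 2 by rewrite real_normK ?num_real.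
pose z0 := - ee * X / d; pose w0 := `|b| / d.
have wz0 : w0 ^+ 2 + z0 ^+ 2 = 1.
  rewrite /w0 /z0 (_ : _ + _ = (`|b| ^+ 2 + ee ^+ 2 * X ^+ 2) / d ^+ 2); last by field.
  by rewrite e1.2 bb2 dd mul1r addrC divff// gt_eqF//; have := sqr_ge0 X; lra.
have h0 : X * w0 + b * z0 = 0.
  rewrite /w0 /z0 (_ : _ + _ = X / d * (`|b| - ee * b)); last by field.
  by rewrite e1.1 subrr mulr0.
have w00 : 0 <= w0 by rewrite divr_ge0// ltW.
have w45 : 4 / 5 <= w0.
  have : 4 / 5 <= w0 ^+ 2.
    rewrite /w0 expr_div_n bb2 dd ler_pdivlMr; first by lra.
    by have := sqr_ge0 X; lra.
  by nra.
have z35 : `|z0| <= 3 / 5.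
  by rewrite -ler_sqr ?nnegrE// real_normK ?num_real//; nra.
move: (z35); rewrite ler_norml => /andP[z1 z2].
apply: (@le_trans _ _ (r / 4 * N%:R - 2)); first by nra.
apply: le_trans (count_rows (x := z0) (r := r / 4) N0 _ _ _) _; try by lra.
apply: ler_sum => i _; rewrite ler_nat.
case: (boolP (`|zgrid N i - z0| <= r / 4)) => // hz.
have -> // : `|wgrid N i * X + b * zgrid N i| <= r.
rewrite [_ * X]mulrC.
apply: (strip_root_stable X1 b1 h0 w45 (wgrid_ge0 N i) wz0 (wgrid2 (ltn_ord i)) _ hz).
by rewrite r0.
Qed.

Lemma sin_phase_surj (th v : R) : 0 <= th <= 2 * pi -> -1 <= v <= 1 ->
  exists p, 0 <= p <= 2 * pi /\ sin (p - th) = v.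
Proof.
move=> /andP[t0 t1] v1.
have pi0 := pi_gt0 R.
have s0 : sin (asin v) = v by apply: asinK.
have a1 := asin_geNpi2 v1; have a2 := asin_lepi2 v1.
have [c1|c1] := ltP (th + asin v) 0.
  exists (th + asin v + 2 * pi); split; first by apply/andP; split; lra.
  by rewrite addrAC [th + _]addrC addrK [2 * pi]mulr_natl sinD2pi.
have [c2|c2] := leP (th + asin v) (2 * pi).
  by exists (th + asin v); split; [rewrite c1|rewrite addrAC subrr add0r].
exists (th + asin v - 2 * pi); split; first by apply/andP; split; lra.
rewrite -[RHS]s0 -(sinD2pi (th + _ - _ - _)) -[pi *+ 2]mulr_natl.
by congr sin; ring.
Qed.

(** When |b| <= A, a row with |z| <= 1 / 2 meets the plane: the required sine [v] lies in [-1, 1],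
    and an arc of longitudes around the solution stays in the strip. *)
Lemma row_lower N (A th b r : R) (i : 'I_N) : 0 < A -> A <= 1 -> b ^+ 2 <= A ^+ 2 ->
  0 <= th <= 2 * pi -> 0 < r <= 1 / 2 -> 256 <= r * N%:R -> `|zgrid N i| <= 1 / 2 ->
  r * N%:R / 16 <= \sum_(j < N)
    (`|wgrid N i * (A * sin (pgrid N j - th)) + b * zgrid N i| <= r)%R%:R.
Proof.
move=> Ap A1 bA th01 /andP[r0 r1] rN hz; have N0 : (0 < N)%N by exact: leq_ltn_trans (ltn_ord i).
set z := zgrid N i in hz *; set w := wgrid N i.
have wz : w ^+ 2 + z ^+ 2 = 1 := wgrid2 (ltn_ord i).
have w0 : 0 <= w := wgrid_ge0 N i.
have z2 : z ^+ 2 <= 1 / 4 by rewrite -[z ^+ 2]real_normK ?num_real//; have := normr_ge0 z; nra.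
have wp : 0 < w by nra.
have w1 : w <= 1 by have := sqr_ge0 z; nra.
pose v := - (b * z) / (A * w).
have Aw : 0 < A * w by rewrite mulr_gt0.
have v1 : -1 <= v <= 1.
  rewrite -ler_norml -(expr_le1 (n := 2))// real_normK ?num_real//.
  rewrite /v expr_div_n sqrrN !exprMn ler_pdivrMr ?mulr_gt0 ?exprn_gt0// mul1r.
  have : b ^+ 2 * z ^+ 2 <= A ^+ 2 * z ^+ 2 by rewrite ler_wpM2r ?sqr_ge0//.
  have : A ^+ 2 * z ^+ 2 <= A ^+ 2 * w ^+ 2 by rewrite ler_wpM2l ?sqr_ge0//; lra.
  by lra.
have [p [p01 hp]] := sin_phase_surj th01 v1.
apply: (@le_trans _ _ (r * N%:R / 8 - 2)); first by lra.
have rr : 0 <= r <= 1 by apply/andP; split; lra.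
apply: le_trans (count_arc N0 p01 rr) _.
apply: ler_sum => j _; rewrite ler_nat; case: (boolP (`|_ - p| <= r)) => // hj.
have -> // : `|w * (A * sin (pgrid N j - th)) + b * z| <= r.
have -> : w * (A * sin (pgrid N j - th)) + b * z =
    A * w * (sin (pgrid N j - th) - sin (p - th)).
  by rewrite hp /v; field; rewrite !gt_eqF.
rewrite normrM ger0_norm ?(ltW Aw)//; apply: le_trans hj.
have := sin_lipschitz (pgrid N j - th) (p - th).
rewrite (_ : pgrid N j - th - (p - th) = pgrid N j - p); last by ring.
apply: le_trans; rewrite ler_piMl//.
by rewrite mulr_ile1// ltW.
Qed.

(** If |b| >= A / 4, the columns near the phase [th] are used, where X is at most A / 8; there are
    at least N / 128 of them. Otherwise the plane is steep and the rows with |z| <= 1 / 2 are used,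
    at least N / 4 of them. The first case gives the constant 1024 = 128 * 8. *)
Lemma height_lower N (y1 y2 b r : R) : 1 / 4 <= y1 ^+ 2 + y2 ^+ 2 + b ^+ 2 <= 1 ->
  0 < r <= 1 / 2 -> 256 <= r * N%:R ->
  r * N%:R ^+ 2 / 1024 <= \sum_(i < N) \sum_(j < N) (`|height N y1 y2 b i j| <= r)%R%:R.
Proof.
move=> /andP[y_ge y_le] /andP[r0 r1] rN.
have Nr : 0 < N%:R :> R by rewrite -(pmulr_rgt0 _ r0); lra.
have N0 : (0 < N)%N by rewrite -(ltr0n R).
have N256 : 512 <= N%:R :> R by nra.
have [A [th [A0 th01 A2 hA]]] := amplitude_phase y1 y2.
have b1 : `|b| <= 1.
  by rewrite -(expr_le1 (n := 2))// real_normK ?num_real//; have := sqr_ge0 y1; have := sqr_ge0 y2; lra.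
have A1 : A <= 1 by have := sqr_ge0 b; nra.
under eq_bigr => i _ do under eq_bigr => j _ do rewrite /height hA.
have [steep|flat] := leP (A ^+ 2 / 16) (b ^+ 2).
  rewrite exchange_big /=.
  have col (j : 'I_N) : `|pgrid N j - th| <= 1 / 8 ->
      r * N%:R / 8 <= \sum_(i < N)
        (`|wgrid N i * (A * sin (pgrid N j - th)) + b * zgrid N i| <= r)%R%:R.
    move=> hj; set X := A * sin _.
    have sX : `|X| <= A / 8.
      have s8 : `|sin (pgrid N j - th)| <= 1 / 8.
        apply: le_trans hj.
        by have := sin_lipschitz (pgrid N j - th) 0; rewrite sin0 !subr0.
      by rewrite /X normrM ger0_norm//; have := ler_wpM2l A0 s8; lra.
    have X2 : X ^+ 2 <= b ^+ 2 / 4.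
      rewrite -[X ^+ 2]real_normK ?num_real//; have := normr_ge0 X; nra.
    by apply: column_lower; rewrite ?r0//; [apply: le_trans sX _|]; lra.
  apply: (@le_trans _ _ (\sum_(j < N) (`|pgrid N j - th| <= 1 / 8)%R%:R * (r * N%:R / 8))).
    rewrite -mulr_suml.
    have e8 : 0 <= (1 / 8 : R) <= 1 by apply/andP; split; lra.
    have := count_arc N0 th01 e8; set S := \sum_(j < N) _ => hS.
    have : (N%:R / 128) * (r * N%:R / 8) <= S * (r * N%:R / 8).
      by rewrite ler_wpM2r//; [rewrite divr_ge0 ?mulr_ge0// ltW|lra].
    by rewrite expr2; lra.
  apply: ler_sum => j _; case: (boolP (`|pgrid N j - th| <= 1 / 8)) => [/col|_].
    by rewrite mul1r.
  by rewrite mul0r sumr_ge0.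
have A417 : 4 / 17 <= A ^+ 2 by lra.
have Ap : 0 < A by nra.
have row (i : 'I_N) : `|zgrid N i - 0| <= 1 / 2 ->
    r * N%:R / 16 <= \sum_(j < N)
      (`|wgrid N i * (A * sin (pgrid N j - th)) + b * zgrid N i| <= r)%R%:R.
  rewrite subr0 => hz; apply: row_lower; rewrite ?r0//.
  by have := sqr_ge0 A; lra.
apply: (@le_trans _ _ (\sum_(i < N) (`|zgrid N i - 0| <= 1 / 2)%R%:R * (r * N%:R / 16))).
  rewrite -mulr_suml.
  have := @count_rows N 0 (1 / 2) N0.
  set S := \sum_(j < N) _ => hS.
  have {}hS : 1 / 2 * N%:R - 2 <= S by apply: hS; lra.
  have : (N%:R / 4) * (r * N%:R / 16) <= S * (r * N%:R / 16).
    by rewrite ler_wpM2r//; [rewrite divr_ge0 ?mulr_ge0// ltW|lra].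
  have : 0 <= r * (N%:R * N%:R) by rewrite !mulr_ge0 ?ltW.
  by rewrite expr2; lra.
apply: ler_sum => i _; case: (boolP (`|zgrid N i - 0| <= 1 / 2)) => [/row|_].
  by rewrite mul1r.
by rewrite mul0r sumr_ge0.
Qed.
End Counting.

(** * Typical configurations *)

Section Chernoff.
Variables (R : realType) (I Y : finType) (A : pred Y).

Definition occupation (x : {ffun I -> Y}) : nat := #|[pred i | A (x i)]|.

(** The moment generating function of a binomial count, as a sum over all placements of the
    nodes. *)
Lemma mgf (theta : R) :
  \sum_(x : {ffun I -> Y}) theta ^+ occupation x =
  (#|Y|%:R + (theta - 1) * #|A|%:R) ^+ #|I|.
Proof.
have e (x : {ffun I -> Y}) : theta ^+ occupation x =
    \prod_i (if A (x i) then theta else 1).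
  rewrite -big_mkcond /= /occupation -sum1_card.
  elim/big_rec2: _ => [|i n y _ <-]; first by rewrite expr0.
  by rewrite add1n exprS.
under eq_bigr => x _ do rewrite e.
rewrite -(bigA_distr_bigA (fun (i : I) y => if A y then theta else 1)) /=.
rewrite prodr_const; congr (_ ^+ _).
rewrite (bigID A) /= (eq_bigr (fun=> theta)) => [|y ->//].
rewrite [X in _ + X](eq_bigr (fun=> 1)) => [|y /negbTE ->//].
rewrite !sumr_const -[theta *+ _]mulr_natl -[1 *+ _]mulr_natl mulr1.
have <- : (#|A| + #|[predC A]|)%N = #|Y| by rewrite cardC.
by rewrite natrD (_ : #|[pred i | ~~ A i]| = #|[predC A]|)//; ring.
Qed.

Lemma expR_half_le2 : expR (1 / 2) <= 2 :> R.
Proof.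
have := expR_ge1Dx (- (1 / 2) : R); rewrite expRN => h.
have p := expR_gt0 (1 / 2 : R).
by move: h; rewrite -(ler_pM2r p) mulVf ?gt_eqF//; lra.
Qed.

(** Markov's inequality for 2^occupation; since exp(1/2) <= 2, the threshold costs at least exp(K /
    2). *)
Lemma chernoff_upper (u K : R) : #|A|%:R <= u * #|Y|%:R ->
  #|[set x | (K < (occupation x)%:R)%R]%SET|%:R <=
    expR (#|I|%:R * u - K / 2) * #|{ffun I -> Y}|%:R.
Proof.
move=> Au; set B := [set x | _]%SET.
have : #|B|%:R * expR (K / 2) <= \sum_(x : {ffun I -> Y}) 2 ^+ occupation x.
  rewrite [leRHS](bigID (mem B))/=.
  apply: ler_wpDr; first by apply: sumr_ge0 => x _; exact: exprn_ge0.
  rewrite mulr_natl -sumr_const; apply: ler_sum => x; rewrite inE => hx.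
  apply: (@le_trans _ _ (expR (1 / 2) ^+ occupation x)).
    by rewrite -expRM_natl ler_expR; lra.
  by rewrite lerXn2r ?nnegrE ?expR_ge0// expR_half_le2.
rewrite mgf => h; rewrite expRD expRN mulrAC ler_pdivlMr ?expR_gt0//.
apply: le_trans h _; rewrite card_ffun natrX expRM_natl -exprMn.
have Y0 : 0 <= #|Y|%:R :> R by [].
have A0 : 0 <= #|A|%:R :> R by [].
have h1 : 0 <= #|Y|%:R + (2 - 1) * #|A|%:R :> R by lra.
have h2 : #|Y|%:R + (2 - 1) * #|A|%:R <= expR u * #|Y|%:R.
  by have := expR_ge1Dx u; nra.
by apply: lerXn2r => //; rewrite nnegrE (le_trans h1).
Qed.

(** Markov's inequality for (1/2)^occupation; since exp(-1) <= 1/2, the threshold costs at least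
    exp(-K). *)
Lemma chernoff_lower (l K : R) : l * #|Y|%:R <= #|A|%:R ->
  #|[set x | ((occupation x)%:R < K)%R]%SET|%:R <=
    expR (K - #|I|%:R * (l / 2)) * #|{ffun I -> Y}|%:R.
Proof.
move=> Al; set B := [set x | _]%SET.
have AY : #|A|%:R <= #|Y|%:R :> R by rewrite ler_nat max_card.
have : #|B|%:R * expR (- K) <= \sum_(x : {ffun I -> Y}) (1 / 2) ^+ occupation x.
  rewrite [leRHS](bigID (mem B))/=.
  apply: ler_wpDr; first by apply: sumr_ge0 => x _; exact: exprn_ge0.
  rewrite mulr_natl -sumr_const; apply: ler_sum => x; rewrite inE => hx.
  apply: (@le_trans _ _ (expR (-1) ^+ occupation x)).
    by rewrite -expRM_natl ler_expR; lra.
  rewrite lerXn2r ?nnegrE ?expR_ge0// expRN mul1r lef_pV2 ?posrE ?expR_gt0//.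
  by have := expR_ge1Dx (1 : R); lra.
rewrite mgf => h; rewrite expRD -mulrA -ler_pdivrMl ?expR_gt0// mulrC -expRN.
apply: le_trans h _; rewrite card_ffun natrX -mulrN expRM_natl -exprMn.
have Y0 : 0 <= #|Y|%:R :> R by [].
have A0 : 0 <= #|A|%:R :> R by [].
have h1 : 0 <= #|Y|%:R + (1 / 2 - 1) * #|A|%:R :> R by lra.
have h2 : #|Y|%:R + (1 / 2 - 1) * #|A|%:R <= expR (- (l / 2)) * #|Y|%:R.
  by have := expR_ge1Dx (- (l / 2)); nra.
by apply: lerXn2r => //; rewrite nnegrE (le_trans h1).
Qed.
End Chernoff.

(** * Replacing poles by grid points and directions by a net *)

Section Discretization.
Variable R : realType.
Local Notation rad := (@Defs.rad R).
Implicit Types x s t : R.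

Lemma cell_near M x : 0 <= x <= 1 ->
  (cell M x)%:R / M.+1%:R <= x <= ((cell M x)%:R + 1) / M.+1%:R.
Proof.
case/andP=> x0 x1; rewrite val_cell /pickidx.
have N0 : 0 < M.+1%:R :> R by [].
have y0 : 0 <= M.+1%:R * x by rewrite mulr_ge0.
have /andP[t1 t2] := truncn_itv y0.
set t := Num.truncn _ in t1 t2 *.
rewrite ler_pdivrMr// ler_pdivlMr// [x * _]mulrC; apply/andP; split.
  by apply: le_trans t1; rewrite ler_nat geq_minl.
have [tM|Mt] := leqP t M.
  by rewrite natr1 ltW.
by rewrite natr1 ler_piMr.
Qed.

Lemma vdot_sphere_pt s t (y1 y2 b : R) :
  vdot (unitize (sphere_pt s t)) (mkv y1 y2 b) =
  Num.sqrt (1 - (2 * s - 1) ^+ 2) * (y1 * cos (2 * pi * t) + y2 * sin (2 * pi * t)) +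
  b * (2 * s - 1).
Proof.
rewrite /unitize /sphere_pt !vdotZl mulKf ?gt_eqF ?rad_gt0//.
by rewrite /vdot /mkv /vx /vy /vz /=; ring.
Qed.

(** The loss comes from the radius [w], which is only Hölder continuous of exponent 1 / 2 at the
    poles of the sphere: |w - w'|^2 <= |w^2 - w'^2| <= 4 / N. Each trigonometric term then costs at
    most 10 / G. *)
Lemma height_approx (N i j : nat) (G s t y1 y2 b : R) : (i < N)%N -> (j < N)%N ->
  N%:R = G ^+ 2 -> 1 <= G -> 0 <= s <= 1 ->
  i%:R / N%:R <= s <= (i%:R + 1) / N%:R -> j%:R / N%:R <= t <= (j%:R + 1) / N%:R ->
  `|y1| <= 1 -> `|y2| <= 1 -> `|b| <= 1 ->
  `|vdot (unitize (sphere_pt s t)) (mkv y1 y2 b) - height N y1 y2 b i j| <= 30 / G.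
Proof.
move=> iN jN NG G1 s01 /andP[s1 s2] /andP[t1 t2] y11 y21 b1.
have Gp : 0 < G by lra.
have N0 : 0 < N%:R :> R by rewrite NG exprn_gt0.
have Gi : G^-1 ^+ 2 <= G^-1.
  have g1 : G^-1 <= 1 by rewrite invf_le1.
  by rewrite expr2 ler_piMr// invr_ge0 ltW.
have Gi0 : 0 < G^-1 by rewrite invr_gt0.
have ni : N%:R^-1 = G^-1 ^+ 2 by rewrite NG exprVn.
rewrite vdot_sphere_pt /height; set z := 2 * s - 1; set z' := zgrid R N i.
set w := Num.sqrt _; set w' := wgrid R N i.
set p := 2 * pi * t; set p' := pgrid R N j.
have dz : `|z - z'| <= 2 * G^-1 ^+ 2.
  rewrite /z /z' /zgrid -ni ler_norml; move: s1 s2; rewrite mulrDl div1r.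
  by move=> ? ?; apply/andP; split; lra.
have dp : `|p - p'| <= 8 * G^-1 ^+ 2.
  have pi4 : pi / 2 < 2 :> R := pihalf_lt2 R; have pp := pi_gt0 R.
  rewrite /p /p' /pgrid -mulrBr normrM ger0_norm; last by lra.
  have h : `|t - j%:R / N%:R| <= G^-1 ^+ 2.
    rewrite -ni ler_norml; move: t1 t2; rewrite mulrDl div1r.
    by move=> ? ?; apply/andP; split; lra.
  by have := normr_ge0 (t - j%:R / N%:R); nra.
have w0 : 0 <= w by exact: sqrtr_ge0.
have w0' : 0 <= w' by exact: wgrid_ge0.
have z1 : -1 <= z <= 1 by move/andP: s01 => [? ?]; rewrite /z; apply/andP; split; lra.
have ww : w ^+ 2 = 1 - z ^+ 2 by rewrite sqr_sqrtr//; case/andP: z1 => ? ?; nra.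
have ww' := wgrid2 R iN; have zz' := zgrid_itv R iN.
rewrite -/w' -/z' in ww' zz'.
have dw : `|w - w'| <= 2 * G^-1.
  rewrite -ler_sqr ?nnegrE ?mulr_ge0 ?(ltW Gi0)//.
  have : `|w - w'| ^+ 2 <= `|w ^+ 2 - w' ^+ 2|.
    rewrite subr_sqr normrM expr2 ler_wpM2l// [`|w + w'|]ger0_norm ?addr_ge0//.
    by rewrite ler_norml; apply/andP; split; lra.
  move=> /le_trans; apply.
  have -> : w ^+ 2 - w' ^+ 2 = - ((z - z') * (z + z')) by rewrite ww; move: ww'; set a := w' ^+ 2; lra.
  rewrite normrN normrM exprMn; have : `|z + z'| <= 2.
    by case/andP: z1 => ? ?; case/andP: zz' => ? ?; rewrite ler_norml; apply/andP; split; lra.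
  by have := normr_ge0 (z - z'); have := normr_ge0 (z + z'); nra.
have w1 : `|w'| <= 1 by rewrite ger0_norm//; have := sqr_ge0 z'; nra.
have trig (f : R -> R) : (forall x, `|f x| <= 1) -> (forall x y, `|f x - f y| <= `|x - y|) ->
    `|w * f p - w' * f p'| <= 10 * G^-1.
  move=> f1 fl; have -> : w * f p - w' * f p' = (w - w') * f p + w' * (f p - f p') by ring.
  apply: le_trans (ler_normD _ _) _; rewrite !normrM.
  have := f1 p; have := fl p p'; have := normr_ge0 (f p); have := normr_ge0 (w - w').
  have := normr_ge0 w'; have := normr_ge0 (f p - f p').
  set a := `|w - w'| in dw *; set c := `|f p|; set c2 := `|w'| in w1 *; set d := `|f p - f p'|.
  move=> d0 c20 a0 c0 dl c1.
  have : a * c <= a by rewrite ler_piMr.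
  have : c2 * d <= d by rewrite ler_piMl.
  by lra.
have tc := trig (@cos R) (@cos_max R) (@cos_lipschitz R).
have ts := trig (@sin R) (@sin_max R) (@sin_lipschitz R).
have -> : w * (y1 * cos p + y2 * sin p) + b * z -
    (w' * (y1 * cos p' + y2 * sin p') + b * z') =
    y1 * (w * cos p - w' * cos p') + (y2 * (w * sin p - w' * sin p') + b * (z - z')) by ring.
apply: le_trans (ler_normD _ _) _.
apply: le_trans (lerD (lexx _) (ler_normD _ _)) _; rewrite !normrM.
have shrink (a x B : R) : `|a| <= 1 -> `|x| <= B -> `|a| * `|x| <= B.
  by move=> a1 xB; apply: le_trans xB; rewrite ler_piMl.
have := shrink _ _ _ y11 tc; have := shrink _ _ _ y21 ts; have := shrink _ _ _ b1 dz.
by lra.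
Qed.

(** The multiples of 1 / (8 m) in [-1, 1], indexed from 0 by the shift 8 m. *)
Definition net_coord (m q : nat) : R := (q%:R - 8 * m%:R) / (8 * m%:R).

(** Rounding goes towards 0, so that a rounded unit vector has norm at most 1. *)
Lemma net_round (m : nat) x : (0 < m)%N -> -1 <= x <= 1 ->
  exists q : 'I_(16 * m).+1, `|x - net_coord m q| <= (8 * m%:R)^-1 /\ `|net_coord m q| <= `|x|.
Proof.
move=> m0 x1; have Mp : 0 < 8 * m%:R :> R by rewrite mulr_gt0// ltr0n.
set y := 8 * m%:R * `|x|; have y0 : 0 <= y by rewrite mulr_ge0// ltW.
have /andP[t1 t2] := truncn_itv y0; set t := Num.truncn y in t1 t2.
have t8 : (t <= 8 * m)%N.
  rewrite -(ler_nat R) natrM; apply: le_trans t1 _; rewrite /y ler_piMr ?(ltW Mp)//.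
  by rewrite ler_norml.
have t2' : y - t%:R <= 1 by move: t2; rewrite -natr1; lra.
have tx : t%:R / (8 * m%:R) <= `|x| by rewrite ler_pdivrMr// mulrC.
have xt : `|x| - t%:R / (8 * m%:R) <= (8 * m%:R)^-1.
  rewrite -[`|x|](_ : y / (8 * m%:R) = _); last by rewrite /y mulrC mulKf// gt_eqF.
  by rewrite -mulrBl ler_piMl ?invr_ge0 ?(ltW Mp).
have t0 : 0 <= t%:R / (8 * m%:R) :> R by rewrite divr_ge0// ltW.
have [xp|xn] := leP 0 x.
  have h : (8 * m + t < (16 * m).+1)%N by clear -t8; lia.
  exists (Ordinal h); rewrite /net_coord /= natrD natrM addrAC subrr add0r.
  rewrite (ger0_norm xp) in tx xt *; rewrite !ger0_norm ?subr_ge0//.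
have h : (8 * m - t < (16 * m).+1)%N by clear -t8; lia.
exists (Ordinal h); rewrite /net_coord /= natrB// natrM addrAC subrr add0r mulNr opprK.
rewrite normrN (ger0_norm t0); rewrite (ltr0_norm xn) in tx xt *.
by rewrite ler0_norm; [split => //; lra|lra].
Qed.
End Discretization.

(** * From finitely many strips to all disks *)

Section Typicality.
Variables (R : realType) (k : nat) (u : label -> R) (Delta c1 c2 : R).
Local Notation rad := (@Defs.rad R).
Local Notation m := (msz k).
Hypothesis u01 : forall i : node k,
  0 <= u (tag_z, val i, 0, 0)%N <= 1 /\ 0 <= u (tag_phi, val i, 0, 0)%N <= 1.
Hypothesis poles_indep : forall i j : node k, i != j ->
  vdot (vcross (pole u i) (pole u j)) (vcross (pole u i) (pole u j)) != 0.
Hypothesis Delta0 : 0 < Delta.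

(* angular radius of a disk C_ij, times [m] *)
Definition disk_angle : R := 2 * pi * (2 + Delta).
Local Notation beta := disk_angle.
Hypothesis beta_m : beta <= m%:R.

Let m0 : 0 < m%:R :> R. Proof. by rewrite ltr0n msz_gt0. Qed.
Let radn0 : rad != 0. Proof. by rewrite gt_eqF ?rad_gt0. Qed.

Lemma disk_angle_ge8 : 8 <= beta.
Proof.
have := pi_ge2 R; have : 0 < pi * Delta by rewrite mulr_gt0 ?pi_gt0.
by rewrite /disk_angle; lra.
Qed.

Lemma disk_radiusE : (2 + Delta) * Num.sqrt (pi / (nn k)%:R) = rad * (beta / m%:R).
Proof. by rewrite -/(spacing R k) spacingE /disk_angle; ring. Qed.

Lemma crosses_strip (l : node k) z : on_sphere z ->
  crosses u l z ((2 + Delta) * Num.sqrt (pi / (nn k)%:R)) ->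
  `|vdot (unitize (pole u l)) (unitize z)| <= beta / m%:R.
Proof.
move=> zs [y [ys [yp]]]; rewrite disk_radiusE sdistE ler_pM2l ?rad_gt0// => yz.
apply: (strip_of_close _ _ _ _ yz); try exact: unitize1.
  exact/unitize1/(pole_sphere u01).
by rewrite /unitize vdotZl vdotZr vdotC yp !mulr0.
Qed.

Lemma strip_crosses (l : node k) z : on_sphere z ->
  `|vdot (unitize (pole u l)) (unitize z)| <= beta / m%:R / 2 ->
  crosses u l z ((2 + Delta) * Num.sqrt (pi / (nn k)%:R)).
Proof.
move=> zs h; have b8 := disk_angle_ge8.
have t01 : 0 < beta / m%:R <= 1.
  by rewrite divr_gt0 ?ler_pdivrMr ?mul1r//; lra.
have [y [y1 yp yz]] := close_of_strip (unitize1 (pole_sphere u01 l)) (unitize1 zs) t01 h.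
exists (vscale rad y); split; last split.
- by rewrite vdotZl vdotZr y1; ring.
- move: yp; rewrite /unitize vdotZr => /eqP; rewrite mulf_eq0 invr_eq0 (negbTE radn0)/=.
  by move=> /eqP yp; rewrite vdotZl yp mulr0.
rewrite disk_radiusE sdistE ler_pM2l ?rad_gt0//.
by rewrite {1}/unitize !vdotZl mulKf.
Qed.

(* The square root in [wgrid] turns a mesh [1 / N] into an error of order [1 / sqrt N],
   whence [N] of order [m ^ 2]. *)
Definition ncells : nat := (120 * m * (120 * m))%N.

Lemma ncells_gt0 : (0 < ncells)%N. Proof. by rewrite /ncells !muln_gt0 msz_gt0. Qed.

Definition strip_height (q1 q2 q3 : nat) (i j : nat) : R :=
  height ncells (net_coord R m q1) (net_coord R m q2) (net_coord R m q3) i j.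

Definition zcell (l : node k) := cell ncells.-1 (u (tag_z, val l, 0, 0)%N).
Definition pcell (l : node k) := cell ncells.-1 (u (tag_phi, val l, 0, 0)%N).

Definition net_norm2 (q1 q2 q3 : nat) : R :=
  net_coord R m q1 ^+ 2 + net_coord R m q2 ^+ 2 + net_coord R m q3 ^+ 2.

(** The outer strip is wider and the inner strip thinner than those attached to a disk, which
    absorbs the errors of discretization on either side. *)
Definition net_typical : Prop := forall q1 q2 q3 : 'I_(16 * m).+1,
  1 / 4 <= net_norm2 q1 q2 q3 <= 1 ->
  (#|[pred l | (`|strip_height q1 q2 q3 (zcell l) (pcell l)| <= (beta + 1) / m%:R)%R]|%:R
    <= c2 * m%:R) /\
  (c1 * m%:R <=
   #|[pred l | (`|strip_height q1 q2 q3 (zcell l) (pcell l)| <= (8 * m%:R)^-1)%R]|%:R).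

(** The error is 3 / (8 m) from rounding three coordinates of [z] plus 30 / (120 m) from the cells
    of the pole. *)
Lemma strip_height_approx z : on_sphere z -> exists q1 q2 q3 : 'I_(16 * m).+1,
  1 / 4 <= net_norm2 q1 q2 q3 <= 1 /\
  forall l : node k, `|vdot (unitize (pole u l)) (unitize z) -
    strip_height q1 q2 q3 (zcell l) (pcell l)| <= 5 / 8 / m%:R.
Proof.
move=> zs; have z1 := unitize1 zs; set y := unitize z in z1 *.
have m2 : 2 <= m%:R :> R by rewrite ler_nat /msz -addnn addSn addnS.
have [a [b [c yE]]] : exists a b c, y = (a, b, c) by case: (y) => [[a b] c]; exists a, b, c.
rewrite yE in z1 *; have {}z1 : a * a + b * b + c * c = 1 := z1.
have coord (x : R) : x ^+ 2 <= 1 -> -1 <= x <= 1 by move=> h; apply/andP; split; nra.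
have a1 : -1 <= a <= 1 by apply: coord; have := sqr_ge0 b; have := sqr_ge0 c; lra.
have b1 : -1 <= b <= 1 by apply: coord; have := sqr_ge0 a; have := sqr_ge0 c; lra.
have c1' : -1 <= c <= 1 by apply: coord; have := sqr_ge0 b; have := sqr_ge0 a; lra.
have [q1 [qa qa']] := net_round (msz_gt0 k) a1.
have [q2 [qb qb']] := net_round (msz_gt0 k) b1.
have [q3 [qc qc']] := net_round (msz_gt0 k) c1'.
exists q1, q2, q3; rewrite /net_norm2 /strip_height.
set a' := net_coord R m q1 in qa qa' *; set b' := net_coord R m q2 in qb qb' *.
set c' := net_coord R m q3 in qc qc' *; set e := (8 * m%:R)^-1 in qa qb qc.
have e0 : 0 < e by rewrite invr_gt0 mulr_gt0.
have e16 : e <= 1 / 16.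
  by rewrite /e mul1r lef_pV2 ?posrE ?mulr_gt0//; lra.
have sq (x x' : R) : `|x'| <= `|x| -> x' ^+ 2 <= x ^+ 2.
  by move=> h; rewrite -[x' ^+ 2]real_normK ?num_real// -[leRHS]real_normK ?num_real// lerXn2r ?nnegrE.
have low (x x' : R) : -1 <= x <= 1 -> `|x'| <= `|x| -> `|x - x'| <= e -> x ^+ 2 - 2 * e <= x' ^+ 2.
  move=> /andP[x1 x2] h h2; have := sq _ _ h.
  have : `|x ^+ 2 - x' ^+ 2| <= 2 * e.
    rewrite subr_sqr normrM mulrC.
    have h3 : `|x + x'| <= 2.
      apply: le_trans (ler_normD _ _) _; have : `|x| <= 1 by rewrite ler_norml x1.
      by lra.
    have := normr_ge0 (x - x'); have := normr_ge0 (x + x'); nra.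
  by rewrite ler_norml => /andP[]; lra.
have sa := sq _ _ qa'; have sb := sq _ _ qb'; have sc := sq _ _ qc'.
split.
  have := low _ _ a1 qa' qa; have := low _ _ b1 qb' qb; have := low _ _ c1' qc' qc.
  by move=> ? ? ?; apply/andP; split; lra.
move=> l; set px := unitize (pole u l).
have NG : ncells%:R = (120 * m%:R) ^+ 2 :> R by rewrite /ncells !natrM expr2.
have G1 : 1 <= 120 * m%:R :> R by lra.
have nrm (x : R) : -1 <= x <= 1 -> `|x| <= 1 by rewrite ler_norml.
have h := @height_approx R ncells (zcell l) (pcell l) (120 * m%:R)
  (u (tag_z, val l, 0, 0)%N) (u (tag_phi, val l, 0, 0)%N) a' b' c' _ _ NG G1 (u01 l).1.
have cN := prednK ncells_gt0.
have {}h : `|vdot px (mkv a' b' c') - height ncells a' b' c' (zcell l) (pcell l)|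
    <= 30 / (120 * m%:R).
  apply: h.
  - by rewrite -[X in (_ < X)%N]cN ltn_ord.
  - by rewrite -[X in (_ < X)%N]cN ltn_ord.
  - by rewrite -{2 4}cN; apply: cell_near; exact: (u01 l).1.
  - by rewrite -{2 4}cN; apply: cell_near; exact: (u01 l).2.
  - exact: le_trans qa' (nrm _ a1).
  - exact: le_trans qb' (nrm _ b1).
  - exact: le_trans qc' (nrm _ c1').
have h2 : `|vdot px (a, b, c) - vdot px (mkv a' b' c')| <= 3 * e.
  have p1 : vdot px px = 1 by exact/unitize1/(pole_sphere u01).
  move: p1; rewrite /vdot /mkv; case: px {h} => [[x1 x2] x3]; rewrite /vx /vy /vz /= => p1.
  have -> : x1 * a + x2 * b + x3 * c - (x1 * a' + x2 * b' + x3 * c') =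
    x1 * (a - a') + (x2 * (b - b') + x3 * (c - c')) by ring.
  have n1 : `|x1| <= 1 by apply/nrm/coord; have := sqr_ge0 x2; have := sqr_ge0 x3; lra.
  have n2 : `|x2| <= 1 by apply/nrm/coord; have := sqr_ge0 x1; have := sqr_ge0 x3; lra.
  have n3 : `|x3| <= 1 by apply/nrm/coord; have := sqr_ge0 x2; have := sqr_ge0 x1; lra.
  apply: le_trans (ler_normD _ _) _.
  apply: le_trans (lerD (lexx _) (ler_normD _ _)) _; rewrite !normrM.
  have shrink (v x B : R) : `|v| <= 1 -> `|x| <= B -> `|v| * `|x| <= B.
    by move=> v1 xB; apply: le_trans xB; rewrite ler_piMl.
  have := shrink _ _ _ n1 qa; have := shrink _ _ _ n2 qb; have := shrink _ _ _ n3 qc.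
  by lra.
have -> : 5 / 8 / m%:R = 3 * e + 30 / (120 * m%:R).
  by rewrite /e; field; rewrite gt_eqF.
apply: le_trans (lerD h2 h); set A1 := vdot px _; set A2 := vdot px _; set A3 := height _ _ _ _ _ _.
have -> : A1 - A3 = (A1 - A2) + (A2 - A3) by ring.
exact: ler_normD.
Qed.

(** With the error 5 / (8 m), a circle through the disk has strip height at most (beta + 1) / m;
    conversely 1 / 8 + 5 / 8 <= beta / 2 because beta >= 8. *)
Lemma typical_of_net : net_typical -> typical k u Delta c1 c2.
Proof.
move=> H i j ij; rewrite card_classical sqrt_nn.
have [zs _ _] := zpt_prop poles_indep ij.
have [q1 [q2 [q3 [qn happ]]]] := strip_height_approx zs.
have [up low] := H _ _ _ qn; have b8 := disk_angle_ge8.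
apply/andP; split.
  apply: le_trans low _; rewrite ler_nat; apply/subset_leq_card/fintype.subsetP => l.
  rewrite inE /= => hl; rewrite -topredE /=; apply/asboolP/strip_crosses => //.
  have := happ l; set v := vdot _ _; set h := strip_height _ _ _ _ _ in hl *.
  move=> hv; have : `|v| <= 5 / 8 / m%:R + (8 * m%:R)^-1.
    by rewrite -[v](subrK h); apply: le_trans (ler_normD _ _) _; exact: lerD.
  move=> /le_trans; apply.
  have -> : 5 / 8 / m%:R + (8 * m%:R)^-1 = 3 / 4 / m%:R :> R by field; rewrite gt_eqF.
  by rewrite [beta / _ / 2]mulrAC ler_pM2r ?invr_gt0//; lra.
apply: le_trans up; rewrite ler_nat; apply/subset_leq_card/fintype.subsetP => l.
rewrite -topredE /= => /asboolP/(crosses_strip zs) hl; rewrite inE /=.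
have := happ l; set v := vdot _ _ in hl *; set h := strip_height _ _ _ _ _.
rewrite distrC => hv; have : `|h| <= 5 / 8 / m%:R + beta / m%:R.
  by rewrite -[h](subrK v); apply: le_trans (ler_normD _ _) _; exact: lerD.
move=> /le_trans; apply; rewrite -mulrDl ler_pM2r ?invr_gt0//; lra.
Qed.
End Typicality.

(** * Throughput on a typical configuration *)

(** The subdivision into c * K cells refines the one into [c] cells, so the fine cell determines the
    uniform choice. *)
Lemma pickidx_cell (R : realType) (c K : nat) (x : R) : (0 < c)%N -> (0 < K)%N ->
  pickidx c x = (cell (c * K).-1 x %/ K)%N.
Proof.
move=> c0 K0; have cK0 : (0 < c * K)%N by rewrite muln_gt0 c0.
rewrite val_cell prednK// /pickidx.
have e : Num.truncn (c%:R * x) = (Num.truncn ((c * K)%:R * x) %/ K)%N.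
  have [x0|x0] := leP 0 x; last first.
    have tr0 (y : R) : y < 0 -> Num.truncn y = 0%N.
      by move=> y0; apply/eqP; rewrite -leqn0 truncn_le_nat; lra.
    by rewrite !tr0 ?div0n// pmulr_rlt0 ?ltr0n.
  have y0 : 0 <= (c * K)%:R * x by rewrite mulr_ge0.
  have /andP[t1 t2] := truncn_itv y0; set t := Num.truncn _ in t1 t2 *.
  apply: truncn_def; have Kp : 0 < K%:R :> R by rewrite ltr0n.
  have xE : c%:R * x = (c * K)%:R * x / K%:R by rewrite natrM; field; rewrite gt_eqF.
  rewrite xE ler_pdivlMr// ltr_pdivrMr//; apply/andP; split.
    by apply: le_trans t1; rewrite -natrM ler_nat leq_divM.
  apply: lt_le_trans t2 _; rewrite -natrM ler_nat; exact: ltn_ceil.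
rewrite e; have c1 : c.-1 = ((c * K).-1 %/ K)%N.
  case: c c0 {cK0 e} => // c _; have -> : ((c.+1 * K).-1 = c * K + K.-1)%N by rewrite mulSn; lia.
  by rewrite divnMDl// divn_small ?addn0// prednK.
rewrite c1; set a := Num.truncn _; set b := (c * K).-1.
have [ab|/ltnW ba] := leqP a b; first by rewrite (minn_idPl _)// leq_div2r.
by rewrite (minn_idPr _)// leq_div2r.
Qed.

(** * The joint walk of all nodes as a finite chain driven by cells *)

Section Chain.
Variables (k K : nat).
Hypothesis K0 : (0 < K)%N.
Local Notation m := (msz k).
Local Notation M := (3 * K).-1.
Local Notation S := {ffun node k -> 'I_(msz k)}.
Local Notation Y := {ffun node k * 'I_4 -> 'I_((3 * K).-1).+1}.

Let m0 : (0 < m)%N := msz_gt0 k.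

Definition walk_step (s : S) (y : Y) : S :=
  [ffun i => Ordinal (ltn_pmod (s i + (y (i, ord0) %/ K) + m.-1) m0)].

Lemma walk_step_inj y : injective (walk_step^~ y).
Proof.
move=> s s' /ffunP e; apply/ffunP => i; have := e i; rewrite !ffunE => /(congr1 val)/=.
rewrite -!addnA => /eqP; rewrite eqn_modDr => /eqP.
by rewrite !modn_small ?ltn_ord// => /val_inj.
Qed.

(** All nodes move forward together, each stopping at its target after [D i] steps. Cell 2K encodes
    the step +1 and cell K the step 0. *)
Lemma walk_step_connected (T : Type) (c : S -> T) :
  (forall s y, c (walk_step s y) = c s) -> forall s s', c s = c s'.
Proof.
move=> inv s s'; pose D i := ((s' i + m - s i) %% m)%N.
pose st (t : nat) : S := [ffun i => Ordinal (ltn_pmod (s i + minn t (D i)) m0)].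
have cst t : c (st t) = c s.
  elim: t => [|t <-].
    congr c; apply/ffunP => i; apply: val_inj.
    by rewrite ffunE /= min0n addn0 modn_small.
  pose y : Y := [ffun j => inord (if (t < D j.1)%N then (2 * K)%N else K)].
  rewrite -(inv (st t) y); congr c; apply/ffunP => i; apply: val_inj.
  rewrite !ffunE /= inordK; last by case: ifP => _; lia.
  have -> : k.*2.+1 = m.-1 by [].
  rewrite -addnA modnDml; have [tD|Dt] := ltnP t (D i).
    rewrite mulnK// (minn_idPl tD).
    have -> : (s i + t + (2 + m.-1) = s i + t.+1 + m)%N by move: m0; lia.
    by rewrite modnDr.
  rewrite divnn K0 (minn_idPr (leqW Dt)).
  have -> : (s i + D i + (1 + m.-1) = s i + D i + m)%N by move: m0; lia.
  by rewrite modnDr.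
rewrite -(cst m); congr c; apply/ffunP => i; apply: val_inj; rewrite ffunE /=.
have Dm : (D i < m)%N by rewrite ltn_mod.
rewrite (minn_idPr (ltnW Dm)) /D modnDmr.
have -> : (s i + (s' i + m - s i) = s' i + m)%N by have := ltn_ord (s i); lia.
by rewrite modnDr modn_small.
Qed.

(** The seeds of a slot that drive the walks and decide whether a clear meeting is used; the choice
    among neighbours is then a choice from one candidate. *)
Definition slot_label (t : nat) (j : node k * 'I_4) : label :=
  match val j.2 with
  | 0 => (tag_step, val j.1, t, 0)
  | 1 => (tag_actA, t, val j.1, 0)
  | 2 => (tag_alpha, t, val j.1, 0)
  | _ => (tag_actB, t, val j.1, 0)
  end%N.

Lemma slot_label_inj T : injective (fun p : 'I_T * (node k * 'I_4) => slot_label (val p.1) p.2).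
Proof.
move=> [[t tT] [i [q q4]]] [[t' tT'] [i' [q' q4']]] /=; rewrite /slot_label /=.
case: q q4 => [|[|[|[|//]]]] q4; case: q' q4' => [|[|[|[|//]]]] q4' // [] e1 e2;
  by (congr (_, (_, _)); [exact: val_inj|exact: val_inj|exact: val_inj]).
Qed.

Section Rate.
Variables (R : realFieldType) (B : {ffun node k -> {set 'I_(msz k)}}).
Variable (C : {ffun node k * 'I_4 -> {set 'I_((3 * K).-1).+1}}).

(** Positions and coins are constrained coordinate by coordinate, so the stationary frequency
    factors completely. *)
Definition box_hit (s : S) (y : Y) : bool :=
  [forall i, s i \in B i] && [forall j, y j \in C j].

Lemma sum_forall_prod (I T : finType) (A : I -> {set T}) :
  \sum_(f : {ffun I -> T}) ([forall i, f i \in A i])%:R = \prod_i #|A i|%:R :> R.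
Proof.
have e (i : I) : #|A i|%:R = \sum_(x : T) (x \in A i)%:R :> R.
  by rewrite -natr_sum -sum1_card big_mkcond; congr (_%:R); apply: eq_bigr => x _; case: ifP.
under eq_bigr => i _ do rewrite e.
rewrite bigA_distr_bigA /=; apply: eq_bigr => f _.
case: (boolP [forall i, f i \in A i]) => [/forallP h|/forallPn[i hi]].
  by rewrite big1// => i _; rewrite h.
by rewrite (bigD1 i)//= (negbTE hi) mul0r.
Qed.

Lemma box_hit_rate : hit_rate R box_hit =
  (\prod_i (#|B i|%:R / m%:R)) * (\prod_j (#|C j|%:R / (M.+1)%:R)).
Proof.
rewrite /hit_rate.
have -> : \sum_(s : S) \sum_(y : Y) (box_hit s y)%:R =
    (\prod_i #|B i|%:R) * (\prod_j #|C j|%:R) :> R.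
  rewrite -(sum_forall_prod B) -(sum_forall_prod C) mulr_suml; apply: eq_bigr => s _.
  by rewrite mulr_sumr; apply: eq_bigr => y _; rewrite /box_hit -natrM mulnb.
by rewrite !big_split /= !prodr_const !exprVn !card_ffun !card_ord !natrX invfM; ring.
Qed.
End Rate.

Section Path.
Variables (R : realType) (u : label -> R).

Definition seed_path (t : nat) : Y := [ffun j => cell M (u (slot_label t j))].

Definition start : S := [ffun i => Ordinal (pos_lt u i 0)].

Lemma trajectory_pos t i : trajectory walk_step start seed_path t i = pos u i t :> nat.
Proof.
elim: t => [|t ih]; first by rewrite /= ffunE.
by rewrite /= ffunE /= ih ffunE /= -pickidx_cell.
Qed.
End Path.
End Chain.

(** * Almost sure frequencies along powers of 2 *)

Section ErgodicEvent.
Variables (R : realType) (d : measure_display) (Omega : measurableType d).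
Variables (P : probability Omega R) (U : label -> Omega -> R).
Hypothesis iidU : iid_uniform_seeds P U.

Lemma probability_bigcap_fin (T : finType) (A : T -> set Omega) :
  (forall t, measurable (A t)) -> (forall t, P (A t) = 1%E) ->
  measurable (\bigcap_(t in [set: T]) A t) /\ P (\bigcap_(t in [set: T]) A t) = 1%E.
Proof.
move=> mA PA.
have mI : measurable (\bigcap_(t in [set: T]) A t) by apply: fin_bigcap_measurable.
split=> //; rewrite -[\bigcap_(t in _) _]setCK probability_setC; last exact: measurableC.
rewrite setC_bigcap (_ : P _ = 0%E) ?sube0//.
have mC t : measurable (~` A t) by exact: measurableC.
have PC t : P (~` A t) = 0%E by rewrite probability_setC// PA subee.
apply/eqP; rewrite eq_le measure_ge0 andbT.
apply: le_trans (@content_sub_fsum _ _ _ _ _ setT _ (fun t => ~` A t) _ _ _ _) _ => //.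
- exact: finite_finset.
- exact: fin_bigcup_measurable.
rewrite (@fsbigE _ _ _ _ _ (enum T)) ?enum_uniq//; last by move=> t _; rewrite mem_enum.
by rewrite big1// => t _; exact: PC.
Qed.

(* Chebyshev along the times [2 ^ j] and Borel-Cantelli. *)
Lemma hits_event (k K : nat) (K0 : (0 < K)%N)
    (B : {ffun node k -> {set 'I_(msz k)}})
    (C : {ffun node k * 'I_4 -> {set 'I_((3 * K).-1).+1}})
    (s : {ffun node k -> 'I_(msz k)}) :
  exists E : set Omega, [/\ measurable E, P E = 1%E &
    forall w, E w -> 0 < hit_rate R (box_hit B C) ->
    exists j0, forall j, (j0 <= j)%N ->
      `|(hits (@walk_step k K) (box_hit B C) s (seed_path k K (U^~ w)) (2 ^ j))%:R -
        hit_rate R (box_hit B C) * (2 ^ j)%:R| <=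
        hit_rate R (box_hit B C) / 4 * (2 ^ j)%:R].
Proof.
set q := hit_rate R (box_hit B C).
have [q0|q0] := ltP 0 q; last first.
  by exists setT; split=> //; rewrite ?probability_setT.
pose Y := {ffun node k * 'I_4 -> 'I_((3 * K).-1).+1}.
pose y0 : Y := [ffun=> ord0].
have [c [c0 hc]] := @hits_chebyshev R _ Y (@walk_step k K) y0 (@walk_step_inj k K)
  (fun c => @walk_step_connected k K K0 R c) (box_hit B C).
pose bad (T : nat) : {set {ffun 'I_T -> Y}} := [set x : {ffun 'I_T -> Y} |
  (q / 4 * T%:R < `|(hits (@walk_step k K) (box_hit B C) s (extend y0 x) T)%:R - q * T%:R|)%R]%SET.
pose F (j : nat) : set Omega := [set w | cells U ((3 * K).-1)
  (fun (t : 'I_(2 ^ j)) (i : node k * 'I_4) => slot_label (val t) i) w \in bad (2 ^ j)%N].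
have inj j : injective (fun p : 'I_(2 ^ j) * (node k * 'I_4) => slot_label (val p.1) p.2).
  exact: slot_label_inj.
pose lab j (t : 'I_(2 ^ j)) (i : node k * 'I_4) := slot_label (val t) i.
have mF j : measurable (F j).
  exact: (@cells_measurable _ _ _ _ _ iidU _ _ _ (lab j) (inj j) (bad _)).
have PF j : (P (F j) <= (c / (q / 4) ^+ 2 * 2^-1 ^+ j)%:E)%E.
  rewrite /F (@cells_prob _ _ _ _ _ iidU _ _ _ (lab j) (inj j)).
  rewrite lee_fin ler_pdivrMr; last by rewrite ltr0n; apply/card_gt0P; exists [ffun=> y0].
  have q4 : 0 < q / 4 by rewrite divr_gt0.
  have T0 : (0 < 2 ^ j)%N by rewrite expn_gt0.
  apply: le_trans (hc _ s _ q4 T0) _; rewrite ler_wpM2r//.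
  by rewrite natrX exprVn invfM mulrA.
have sumF : (\sum_(0 <= j <oo) P (F j) < +oo)%E.
  apply: (@le_lt_trans _ _ (\sum_(0 <= j <oo) (c / (q / 4) ^+ 2 * 2^-1 ^+ j)%:E)%E).
    by apply: lee_nneseries.
  have a0 : 0 <= c / (q / 4) ^+ 2 by rewrite divr_ge0// ?sqr_ge0// ltW.
  set a := c / _ in a0 *.
  have z1 : `|2^-1 : R| < 1 by rewrite ger0_norm; lra.
  have cv := @cvg_geometric_series R a _ z1.
  rewrite (_ : \sum_(0 <= j <oo) _ = (a / (1 - 2^-1))%:E)%E ?ltry//.
  apply/cvg_lim => //; have e n : (\sum_(0 <= j < n) (a * 2^-1 ^+ j)%:E)%E = (series (geometric a 2^-1) n)%:E.
    by rewrite /series /= sumEFin.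
  apply: cvg_EFin; first by apply: nearW => n; rewrite e.
  by under eq_cvg do rewrite /= e /=.
have N0 := lim_sup_set_cvg0 mF sumF.
have mL : measurable (lim_sup_set F).
  by apply: bigcapT_measurable => n; apply: bigcup_measurable.
exists (~` lim_sup_set F); split.
- exact: measurableC.
- by rewrite probability_setC// N0 sube0.
move=> w nw _; apply: contrapT => H; apply: nw => n _.
have [j [nj hj]] : exists j, (n <= j)%N /\ ~ (`|(hits (@walk_step k K) (box_hit B C) s
   (seed_path k K (U^~ w)) (2 ^ j))%:R - q * (2 ^ j)%:R| <= q / 4 * (2 ^ j)%:R).
  apply: contrapT => H2; apply: H; exists n => j nj; apply: contrapT => hj.
  by apply: H2; exists j.
exists j => //; rewrite /F /= /bad inE.
move/negP: hj; rewrite -ltNge; congr (_ < `|_%:R - _|).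
apply: eq_hits => t tj; rewrite /extend insubT ffunE.
by apply/ffunP => i; rewrite !ffunE.
Qed.

(** There are finitely many boxes and initial states, so one almost sure event serves them all.
    Since [s] is quantified after the outcome, the random initial state can be substituted for
    it. *)
Lemma ergodic_event (k K : nat) : (0 < K)%N ->
  exists E : set Omega, [/\ measurable E, P E = 1%E &
    forall w, E w -> forall B C s, 0 < hit_rate R (box_hit B C) ->
    exists j0, forall j, (j0 <= j)%N ->
      `|(hits (@walk_step k K) (box_hit B C) s (seed_path k K (U^~ w)) (2 ^ j))%:R -
        hit_rate R (box_hit B C) * (2 ^ j)%:R| <=
        hit_rate R (box_hit B C) / 4 * (2 ^ j)%:R].
Proof.
move=> K0; pose T := ({ffun node k -> {set 'I_(msz k)}} *
  {ffun node k * 'I_4 -> {set 'I_((3 * K).-1).+1}} * {ffun node k -> 'I_(msz k)})%type.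
have /choice[A hA] := fun t : T => hits_event K0 t.1.1 t.1.2 t.2.
have [mI PI] := @probability_bigcap_fin T A (fun t => let: And3 h _ _ := hA t in h)
  (fun t => let: And3 _ h _ := hA t in h).
exists (\bigcap_(t in [set: T]) A t); split=> // w Ew B C s q0.
by have [_ _ /(_ w (Ew (B, C, s) I) q0)] := hA (B, C, s).
Qed.
End ErgodicEvent.

Lemma hits_cum (S Y : finType) (f : S -> Y -> S) (h : S -> Y -> bool) s x t :
  hits f h s x t = cum (fun i => h (trajectory f s x i) (x i)) t.
Proof. by elim: t => [|t ih]; rewrite ?cumS -?ih// /cum big_ord0. Qed.

Lemma expRN_le (R : realType) (x : R) : 0 <= x <= 1 / 2 -> expR (- (2 * x)) <= 1 - x.
Proof.
case/andP=> x0 x1; have := expR_ge1Dx (2 * x) => h.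
have e0 := expR_gt0 (2 * x); rewrite expRN -[_^-1]mul1r ler_pdivrMr//.
have : (1 - x) * (1 + 2 * x) <= (1 - x) * expR (2 * x) by rewrite ler_wpM2l//; lra.
by apply: le_trans; nra.
Qed.

Lemma prod_pinned_lower (R : realFieldType) (J T : finType) (A : {set J}) (C : J -> {set T}) :
  (forall j, j \in A -> C j != finset.set0) -> (forall j, j \notin A -> C j = [set: T]%SET) ->
  (0 < #|T|)%N ->
  (#|T|%:R^-1) ^+ #|A| <= \prod_j (#|C j|%:R / #|T|%:R) :> R.
Proof.
move=> CA CN T0; have T0' : 0 < #|T|%:R :> R by rewrite ltr0n.
rewrite -prodr_const big_mkcond /=; apply: ler_prod => j _; case: ifPn => jA.
  rewrite invr_ge0 ltW//= ler_pdivlMr// mulVf ?gt_eqF// ler1n card_gt0; exact: CA.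
by rewrite ler01 CN// cardsT divff ?gt_eqF ?lexx.
Qed.

(** Here [x] is the number of nodes: x - 2 relays with a share 1 / x each retain at least half of
    the total. *)
Lemma relay_share_lower (R : realType) (r x T : R) : 4 <= x -> 0 <= r -> 0 <= T ->
  r / 8 * T <= (x - 2) * (r / x / 4 * T).
Proof.
move=> x4 r0 T0; have -> : (x - 2) * (r / x / 4 * T) = r / 4 * T * ((x - 2) / x).
  by field; lra.
have : 1 / 2 <= (x - 2) / x by rewrite ler_pdivlMr; lra.
by have := mulr_ge0 r0 T0; nra.
Qed.

(* [n] times a lower bound for the stationary probability that two given nodes are alone at
   their meeting point with prescribed coins, each coin being pinned to one of [3 K] cells. *)
Definition relay_rate (R : realType) (c2 : R) (K D : nat) : R :=
  (3 * K)%:R^-1 ^+ 3 * expR (- (2 * (4 * D + 1)%:R * c2)).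

Lemma relay_rate_gt0 (R : realType) (c2 : R) (K D : nat) : (0 < K)%N -> 0 < relay_rate c2 K D.
Proof.
by move=> K0; rewrite mulr_gt0 ?expR_gt0// exprn_gt0// invr_gt0 ltr0n muln_gt0.
Qed.

(** * Stationary rate of clear meetings and linear growth of deliveries *)

Section Throughput.
Variables (R : realType) (e : R * R -> vec R) (k : nat) (u : label -> R).
Variables (pD alpha Delta c1 c2 : R) (K D : nat).
Hypothesis e_ok : frame_ok e.
Hypothesis u01 : forall i : node k,
  0 <= u (tag_z, val i, 0, 0)%N <= 1 /\ 0 <= u (tag_phi, val i, 0, 0)%N <= 1.
Hypothesis poles_indep : forall i j : node k, i != j ->
  vdot (vcross (pole u i) (pole u j)) (vcross (pole u i) (pole u j)) != 0.
Hypothesis Delta0 : 0 < Delta.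
Hypothesis keys_inj : forall i j : node k,
  u (tag_pair, val i, 0, 0)%N = u (tag_pair, val j, 0, 0)%N -> i = j.
Hypothesis typ : typical k u Delta c1 c2.
Hypothesis K0 : (0 < K)%N.
Hypothesis K_pD : (3 * K)%:R^-1 <= pD.
Hypothesis K_1pD : (3 * K)%:R^-1 <= 1 - pD.
Hypothesis K_alpha : (3 * K)%:R^-1 <= alpha.
Hypothesis D_Delta : 2 * (2 + Delta) <= D%:R.
Local Notation m := (msz k).
Local Notation kappa := (4 * D + 1)%N.
Hypothesis m_large : (2 * kappa <= m)%N.
Local Notation rho := ((2 + Delta) * spacing R k).
Local Notation rate := (relay_rate c2 K D).
Local Notation N := ((3 * K).-1).+1.
Local Notation traj := (trajectory (@walk_step k K) (start k u) (seed_path k K u)).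

Let m0 : (0 < m)%N := msz_gt0 k.
Let m0R : 0 < m%:R :> R. Proof. by rewrite ltr0n. Qed.
Let NE : N = (3 * K)%N. Proof. by lia. Qed.
Let N0 : 0 < (3 * K)%:R :> R. Proof. by rewrite ltr0n; lia. Qed.

Definition meeting_box (i j : node k) : {ffun node k -> {set 'I_(msz k)}} :=
  [ffun l => if l \in [set i; j]%SET then [set x : 'I_(msz k) | closest e u l x (zpt u i j)]%SET
    else [set x : 'I_(msz k) | (rho < sdist (lattice e u l x) (zpt u i j))%R]%SET].

Lemma meeting_boxP i j t : (forall l, traj t l \in meeting_box i j l) ->
  clear_meeting e u Delta t i j.
Proof.
move=> h; split=> [||l li lj].
- rewrite -(trajectory_pos K0 u t i); have := h i; rewrite ffunE !inE eqxx.
   by rewrite inE.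
- by rewrite -(trajectory_pos K0 u t j); have := h j; rewrite ffunE !inE eqxx orbT inE.
- by rewrite /loc -(trajectory_pos K0 u t l); have := h l; rewrite ffunE !inE (negbTE li) (negbTE lj) inE.
Qed.

(** A node of the meeting pair has a closest lattice point, of probability 1 / m. Any other node
    avoids the disk with probability at least 1 - kappa / m if its circle crosses the disk, and
    surely otherwise. For the pair itself the exponential is at most 1 and costs nothing. *)
Lemma meeting_box_lower i j l : i != j ->
  (if l \in [set i; j]%SET then m%:R^-1 else 1) *
  (if l \in [set l | `[< crosses u l (zpt u i j) rho >]]%SET then expR (- (2 * (kappa%:R / m%:R))) else 1)
  <= #|meeting_box i j l|%:R / m%:R :> R.
Proof.
move=> ij; have [zs _ _] := zpt_prop poles_indep ij; rewrite ffunE.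
set x : R := kappa%:R / m%:R; have kap : 0 <= x <= 1 / 2.
  by rewrite divr_ge0//= ler_pdivrMr// mulrAC mul1r ler_pdivlMr// -natrM ler_nat mulnC.
case: ifPn => lij.
  have [y hy] := closest_exists e u l (zpt u i j).
  apply: (@le_trans _ _ m%:R^-1).
    rewrite ler_piMr ?invr_ge0//; case: ifP => // _.
    by rewrite (le_trans (expRN_le kap))// gerBl; case/andP: kap.
  rewrite ler_pdivlMr// mulVf ?gt_eqF// ler1n card_gt0; apply/set0Pn; exists y.
  by rewrite inE.
rewrite mul1r; set F := [set x : 'I_m | (sdist (lattice e u l x) (zpt u i j) <= rho)%R]%SET.
have -> : [set x : 'I_(msz k) | (rho < sdist (lattice e u l x) (zpt u i j))%R]%SET = ~: F.
  by apply/setP => y; rewrite !inE ltNge.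
have -> : #|~: F|%:R / m%:R = 1 - #|F|%:R / m%:R :> R.
  have /(congr1 (fun x => x%:R : R)) := cardsC F; rewrite card_ord natrD => h.
  have -> : #|~: F|%:R = m%:R - #|F|%:R :> R by rewrite -h addrAC subrr add0r.
  by rewrite mulrBl divff// gt_eqF.
case: ifPn => [_|]; last first.
  rewrite inE => /asboolPn nc; rewrite (_ : F = finset.set0) ?cards0 ?mul0r ?subr0//.
  apply/setP => y; rewrite !inE; apply/negP => h; apply: nc.
  exists (lattice e u l y); split; first exact: (lattice_sphere e_ok u01).
  by split=> //; exact: (lattice_pole e_ok u01).
apply: le_trans (expRN_le kap) _; rewrite lerD2l lerN2 ler_pM2r ?invr_gt0// ler_nat.
apply: (disk_count e_ok u01 _ zs); rewrite mulrA ler_pM2r//; exact: spacing_gt0.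
Qed.

(** Typicality allows at most c2 * m exponential factors exp(-2 kappa / m), whose product does not
    depend on [m]. *)
Lemma meeting_rate i j : i != j ->
  (nn k)%:R^-1 * expR (- (2 * kappa%:R * c2)) <=
  \prod_l (#|meeting_box i j l|%:R / m%:R) :> R.
Proof.
move=> ij; apply: le_trans; last first.
  apply: ler_prod => l _; apply/andP; split; last exact: meeting_box_lower.
  rewrite mulr_ge0//; case: ifP => // _; rewrite ?invr_ge0// expR_ge0//.
rewrite big_split /= -!big_mkcond /= !prodr_const cards2 ij.
rewrite (_ : _ ^+ true.+1 = (nn k)%:R^-1); last by rewrite exprVn expr2 -natrM.
rewrite ler_pM2l ?invr_gt0 ?ltr0n ?muln_gt0 ?m0//.
rewrite -expRM_natl ler_expR mulrN lerN2.
have /andP[_] := typ ij; rewrite -/(spacing R k) card_classical => h.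
have {h} : (#|[set l : node k | `[< crosses u l (zpt u i j) rho >]]%SET|%:R : R) <= c2 * m%:R.
  by rewrite -(sqrt_nn R k) cardsE.
set c := #|_|%:R => h; have -> : c * (2 * (kappa%:R / m%:R)) = 2 * kappa%:R * (c / m%:R).
  by field; rewrite gt_eqF.
by rewrite ler_wpM2l// ler_pdivrMr.
Qed.

(** The first cell lies below every threshold in use and the last one above [pD], by the choice of
    [K]. *)
Definition coins_box (low high : {set node k * 'I_4}) :
    {ffun node k * 'I_4 -> {set 'I_((3 * K).-1).+1}} :=
  [ffun j => if j \in low then [set ord0]%SET
             else if j \in high then [set ord_max]%SET else [set: _]%SET].

Lemma coins_low (low high : {set node k * 'I_4}) t j : j \in low ->
  seed_path k K u t j \in coins_box low high j -> u (slot_label t j) < (3 * K)%:R^-1.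
Proof.
move=> jl; rewrite !ffunE jl inE => /eqP/(congr1 (@nat_of_ord _)).
rewrite val_cell /pickidx /= NE => h.
have h0 : Num.truncn ((3 * K)%:R * u (slot_label t j)) = 0%N by lia.
rewrite -[_^-1]mul1r ltr_pdivlMr// mulrC.
have := truncnS_gt ((3 * K)%:R * u (slot_label t j)); rewrite h0//.
Qed.

Lemma coins_high (low high : {set node k * 'I_4}) t j : j \notin low -> j \in high ->
  seed_path k K u t j \in coins_box low high j -> 1 - (3 * K)%:R^-1 <= u (slot_label t j).
Proof.
move=> jl jh; rewrite !ffunE (negbTE jl) jh inE => /eqP/(congr1 (@nat_of_ord _)).
rewrite val_cell /pickidx /= NE => h.
have h0 : ((3 * K).-1 <= Num.truncn ((3 * K)%:R * u (slot_label t j)))%N by clear -h K0; lia.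
have x0 : 0 <= (3 * K)%:R * u (slot_label t j).
  rewrite leNgt; apply/negP => x0; have : (Num.truncn ((3 * K)%:R * u (slot_label t j)) <= 0)%N.
    by rewrite truncn_le_nat; lra.
  by clear -h0 K0; lia.
have -> : 1 - (3 * K)%:R^-1 = ((3 * K).-1)%:R / (3 * K)%:R :> R.
  have p : (3 * K)%:R = (3 * K).-1%:R + 1 :> R by rewrite natr1 -NE.
  rewrite (_ : (3 * K).-1%:R = (3 * K)%:R - 1); last by rewrite p addrK.
  by rewrite mulrBl divff ?gt_eqF// mul1r.
rewrite ler_pdivrMr// mulrC; apply: (@le_trans _ _ (Num.truncn ((3 * K)%:R * u (slot_label t j)))%:R).
  by rewrite ler_nat.
by rewrite truncn_le.
Qed.

Lemma coins_rate (low high : {set node k * 'I_4}) : (#|(low :|: high)%SET| <= 3)%N ->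
  (3 * K)%:R^-1 ^+ 3 <= \prod_j (#|coins_box low high j|%:R / N%:R) :> R.
Proof.
move=> c3.
have h1 j : j \in (low :|: high)%SET -> coins_box low high j != finset.set0.
  move=> _; rewrite ffunE; case: ifP => _; first by apply/set0Pn; exists ord0; rewrite inE.
  by case: ifP => _; apply/set0Pn; exists ord_max; rewrite inE.
have h2 j : j \notin (low :|: high)%SET -> coins_box low high j = [set: 'I_N]%SET.
  by rewrite finset.in_setU negb_or ffunE => /andP[/negbTE-> /negbTE->].
have N0' : (0 < #|'I_N|)%N by rewrite card_ord.
have := prod_pinned_lower R h1 h2 N0'; rewrite card_ord; apply: le_trans.
rewrite NE; apply: ler_wiXn2l; rewrite ?invr_ge0 ?(ltW N0)// invf_le1// ler1n.
by clear -K0; lia.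
Qed.

Definition relay_coins (s v : node k) : {ffun node k * 'I_4 -> {set 'I_((3 * K).-1).+1}} :=
  coins_box [set (s, inord 1); (s, inord 2)]%SET [set (v, inord 1)]%SET.
Definition delivery_coins (v d : node k) : {ffun node k * 'I_4 -> {set 'I_((3 * K).-1).+1}} :=
  coins_box [set (v, inord 3)]%SET [set (d, inord 3)]%SET.

Definition relays s v t : bool :=
  box_hit (meeting_box s v) (relay_coins s v) (traj t) (seed_path k K u t).
Definition delivers v d t : bool :=
  box_hit (meeting_box v d) (delivery_coins v d) (traj t) (seed_path k K u t).

Lemma relays_clearA s v t : s != v -> relays s v t -> clearA e u pD alpha Delta t s v.
Proof.
move=> sv /andP[/forallP hB /forallP hC]; split; first exact: meeting_boxP.
- have := coins_low _ (hC (s, inord 1)); rewrite !inE eqxx /slot_label /= inordK// => /(_ isT) h.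
  exact: lt_le_trans K_pD.
- have := coins_high _ _ (hC (v, inord 1)); rewrite !inE !xpair_eqE !eqxx eq_sym (negbTE sv).
  rewrite /slot_label /= inordK// => /(_ isT isT) h.
  by apply: le_trans h; rewrite lerBrDl -lerBrDr.
- have := coins_low _ (hC (s, inord 2)); rewrite !inE eqxx orbT /slot_label /= inordK// => /(_ isT) h.
  exact: lt_le_trans K_alpha.
Qed.

Lemma delivers_clearB v d t : v != d -> delivers v d t -> clearB e u pD Delta t v d.
Proof.
move=> vd /andP[/forallP hB /forallP hC]; split; first exact: meeting_boxP.
- have := coins_low _ (hC (v, inord 3)); rewrite !inE eqxx /slot_label /= inordK// => /(_ isT) h.
  exact: lt_le_trans K_pD.
- have := coins_high _ _ (hC (d, inord 3)); rewrite !inE !xpair_eqE !eqxx eq_sym (negbTE vd).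
  rewrite /slot_label /= inordK// => /(_ isT isT) h.
  by apply: le_trans h; rewrite lerBrDl -lerBrDr.
Qed.

Lemma box_rate_lower i j (low high : {set node k * 'I_4}) : i != j -> (#|(low :|: high)%SET| <= 3)%N ->
  rate / (nn k)%:R <= hit_rate R (box_hit (meeting_box i j) (coins_box low high)).
Proof.
move=> ij c3; rewrite box_hit_rate /relay_rate [_ * expR _]mulrC mulrAC [expR _ * _]mulrC.
rewrite ler_pM ?mulr_ge0 ?exprn_ge0 ?invr_ge0 ?expR_ge0//; first exact: meeting_rate.
exact: coins_rate.
Qed.

Hypothesis ergodic : forall B C s, 0 < hit_rate R (box_hit B C) ->
  exists j0, forall j, (j0 <= j)%N ->
    `|(hits (@walk_step k K) (box_hit B C) s (seed_path k K u) (2 ^ j))%:R -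
      hit_rate R (box_hit B C) * (2 ^ j)%:R| <= hit_rate R (box_hit B C) / 4 * (2 ^ j)%:R.

(** With a relative error 1 / 4 at T and at 2T, the visits in between number at least 2 q T * 3 / 4
    - q T * 5 / 4 = q T / 4. *)
Lemma box_hits_dyadic i j (low high : {set node k * 'I_4}) : i != j ->
  (#|(low :|: high)%SET| <= 3)%N ->
  let visits := cum (fun t => box_hit (meeting_box i j) (coins_box low high) (traj t)
    (seed_path k K u t)) in
  exists j0, forall n, (j0 <= n)%N ->
    rate / (nn k)%:R / 4 * (2 ^ n)%:R <= (visits (2 ^ n)%N)%:R /\
    rate / (nn k)%:R / 4 * (2 ^ n)%:R <= (visits (2 ^ n.+1) - visits (2 ^ n))%N%:R.
Proof.
move=> ij c3 visits; have := box_rate_lower ij c3; set q := hit_rate R _ => q_lower.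
have n0 : 0 < (nn k)%:R :> R by rewrite ltr0n muln_gt0 m0.
have r0 : 0 < rate / (nn k)%:R by rewrite divr_gt0 ?(relay_rate_gt0 c2 D K0).
have [j0 hj0] := ergodic (start k u) (lt_le_trans r0 q_lower).
exists j0 => n jn; have := hj0 _ jn; have := hj0 _ (leqW jn).
rewrite -/q !hits_cum -/visits; set c1' := visits _; set c0' := visits _.
have c01 : (c0' <= c1')%N by apply: leq_cum; rewrite leq_exp2l.
rewrite (natrB _ c01) expnS natrM; have T0 : 0 <= (2 ^ n)%:R :> R by [].
set T := (2 ^ n)%:R in T0 *; rewrite !ler_norml => /andP[h1 _] /andP[h2 h3].
have : (rate / (nn k)%:R) * T <= q * T by rewrite ler_wpM2r.
split; nra.
Qed.

Local Notation st := (@stateSigma R e k u pD alpha Delta).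

(** At time 2^(n+1) the relays together have delivered at least rate / 8 * 2^n packets. The number
    delivered is monotone, and a time between 2^(l+1) and 2^(l+2) is at most 4 * 2^l, whence 32. *)
Lemma delivered_linear p : (p < npairs k)%N ->
  exists t0, forall t, (t0 <= t)%N ->
    rate / 32 * t%:R <= ((st t).2 p)%:R.
Proof.
move=> pn; have n4 : (4 <= nn k)%N.
  by rewrite /nn /msz -!addnn; clear; nia.
have p2n : (p.*2.+1 < nn k)%N.
  by move: pn; rewrite /npairs; clear; lia.
have [s rs] := rank_surj keys_inj (ltnW p2n); have [d rd] := rank_surj keys_inj p2n.
have sd : s != d by apply/eqP => sd; move: rd; rewrite -sd rs; clear; lia.
have hA (v : node k) : exists j0, v != s -> forall n, (j0 <= n)%N ->
    rate / (nn k)%:R / 4 * (2 ^ n)%:R <= (cum (relays s v) (2 ^ n))%:R.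
  have [->|vs] := eqVneq v s; first by exists 0%N.
  have [||j0 hj] := @box_hits_dyadic s v [set (s, inord 1); (s, inord 2)]%SET [set (v, inord 1)]%SET.
  - by rewrite eq_sym.
  - by rewrite (leq_trans (leq_card_setU _ _))// cards1 cards2; case: (_ != _).
  by exists j0 => _ n /hj[].
have hB (v : node k) : exists j0, v != d -> forall n, (j0 <= n)%N ->
    rate / (nn k)%:R / 4 * (2 ^ n)%:R <=
    (cum (delivers v d) (2 ^ n.+1) - cum (delivers v d) (2 ^ n))%:R.
  have [->|vd] := eqVneq v d; first by exists 0%N.
  have [//||j0 hj] := @box_hits_dyadic v d [set (v, inord 3)]%SET [set (d, inord 3)]%SET.
  - by rewrite (leq_trans (leq_card_setU _ _))// !cards1.
  by exists j0 => _ n /hj[].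
have /choice[ja hja] := hA; have /choice[jb hjb] := hB.
pose J := maxn (\max_v ja v) (\max_v jb v).
have dyadic n : (J <= n)%N ->
    rate / 8 * (2 ^ n)%:R <= ((st (2 ^ n.+1)).2 p)%:R.
  move=> Jn; have t12 : (2 ^ n <= 2 ^ n.+1)%N by rewrite leq_exp2l.
  have : (\sum_(v | (v != s) && (v != d)) minn (cum (relays s v) (2 ^ n))
      (cum (delivers v d) (2 ^ n.+1) - cum (delivers v d) (2 ^ n)) <= (st (2 ^ n.+1)).2 p)%N.
    apply: (delivered_lower e_ok u01 poles_indep Delta0 keys_inj rs rd) => // [v t vs _|v t _].
      by apply: relays_clearA; rewrite eq_sym.
    exact: delivers_clearB.
  rewrite -(ler_nat R); apply: le_trans; rewrite natr_sum.
  apply: (@le_trans _ _ (\sum_(v : node k | (v != s) && (v != d)) (rate / (nn k)%:R / 4 * (2 ^ n)%:R))).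
    have c : #|[pred v : node k | (v != s) && (v != d)]| = (nn k - 2)%N.
      have := cardC (mem [set s; d]%SET); rewrite cards2 sd card_ord => hc.
      rewrite (eq_card (B := predC (mem [set s; d]%SET))); first by rewrite -[X in _ = (X - _)%N]hc addKn.
      by move=> v; rewrite !inE negb_or.
    rewrite sumr_const c -[_ *+ (_ - _)]mulr_natl natrB ?(leq_trans _ n4)//.
    have n4R : 4 <= (nn k)%:R :> R by rewrite ler_nat.
    have T0 : 0 <= (2 ^ n)%:R :> R by [].
    by apply: relay_share_lower => //; exact: ltW (relay_rate_gt0 c2 D K0).
  apply: ler_sum => v /andP[vs vd].
  have Ja : (ja v <= n)%N by apply: leq_trans Jn; rewrite /J leq_max leq_bigmax.
  have Jb : (jb v <= n)%N by apply: leq_trans Jn; rewrite /J leq_max leq_bigmax ?orbT.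
  by rewrite /minn; case: ifP => _; [exact: hja|exact: hjb].
have mono : {homo (fun t => (st t).2 p) : t t' / (t <= t')%N}.
  apply: homo_leq => // [y z x' /leq_trans h1 /h1//|t].
  by have := @delivered_step R e k u pD alpha Delta t p; apply: leq_trans; rewrite leq_addr.
exists (2 ^ J.+1)%N => t Jt; have t0 : (0 < t)%N by rewrite (leq_trans _ Jt)// expn_gt0.
have /andP[l1 l2] := trunc_log_bounds (isT : (1 < 2)%N) t0; set l := trunc_log 2 t in l1 l2.
have Jl : (J < l)%N by rewrite -ltnS -(ltn_exp2l _ _ (isT : (1 < 2)%N)) (leq_ltn_trans Jt).
case: l l1 l2 Jl => // l l1 l2 Jl.
apply: (@le_trans _ _ (rate / 8 * (2 ^ l)%:R)); last first.
  by apply: le_trans (dyadic _ Jl) _; rewrite ler_nat; exact: mono.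
have : t%:R <= 4 * (2 ^ l)%:R :> R by rewrite -natrM ler_nat ltnW// -(expnD 2 2).
by have := (relay_rate_gt0 c2 D K0); nra.
Qed.

Lemma throughput_lower W : 0 < W ->
  event_A e k u pD alpha Delta c1 c2 W (W * rate / 32).
Proof.
move=> W0 p pn; have [t0 ht0] := delivered_linear pn.
have r0 := (relay_rate_gt0 c2 D K0); rewrite limn_einf_lim; apply: lime_ge; first exact: is_cvg_einfs.
exists (maxn t0 1) => // n /= tn; apply: le_ereal_inf_tmp => _ [t /= nt <-]; rewrite lee_fin.
have {}tn : (maxn t0 1 <= t)%N by exact: leq_trans nt.
have t1 : 0 < t%:R :> R by rewrite ltr0n; move: tn; rewrite geq_max => /andP[].
rewrite /bits_Pi asboolT// ler_pdivlMr// -[W * _ / _]mulrA -mulrA ler_pM2l//.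
apply: ht0.
by move: tn; rewrite geq_max => /andP[].
Qed.
End Throughput.

(** * The good events *)

(** Parallel poles are equal or antipodal, so their heights 2 s - 1 and 2 s' - 1 are equal or
    opposite. *)
Lemma pole_cross_neq0 (R : realType) (k : nat) (u : label -> R) (i j : node k) :
  0 <= u (tag_z, val i, 0, 0)%N <= 1 -> 0 <= u (tag_z, val j, 0, 0)%N <= 1 ->
  u (tag_z, val i, 0, 0)%N != u (tag_z, val j, 0, 0)%N ->
  u (tag_z, val i, 0, 0)%N + u (tag_z, val j, 0, 0)%N != 1 ->
  vdot (vcross (pole u i) (pole u j)) (vcross (pole u i) (pole u j)) != 0.
Proof.
move=> ui uj; set s := u (tag_z, val i, 0, 0)%N; set s' := u (tag_z, val j, 0, 0)%N.
move=> ss' s1; apply/negP; rewrite vcross_norm => /eqP.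
have r0 := rad_gt0 R.
have pi_ : vdot (pole u i) (pole u i) = @Defs.rad R ^+ 2 by exact: on_sphere_pt.
have pj_ : vdot (pole u j) (pole u j) = @Defs.rad R ^+ 2 by exact: on_sphere_pt.
have zi : vz (pole u i) = @Defs.rad R * (2 * s - 1) by [].
have zj : vz (pole u j) = @Defs.rad R * (2 * s' - 1) by [].
rewrite pi_ pj_ -expr2 subr_sqr => /eqP; rewrite mulf_eq0 => /orP[] /eqP h.
  have : vz (pole u i) - vz (pole u j) == 0.
    rewrite -sqrf_eq0 eq_le sqr_ge0 andbT.
    have : (vx (pole u i) - vx (pole u j)) ^+ 2 + (vy (pole u i) - vy (pole u j)) ^+ 2 +
      (vz (pole u i) - vz (pole u j)) ^+ 2 = 0 by move: pi_ pj_ h; rewrite /vdot; lra.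
    by have := sqr_ge0 (vx (pole u i) - vx (pole u j)); have := sqr_ge0 (vy (pole u i) - vy (pole u j)); lra.
  rewrite zi zj -mulrBr mulf_eq0 gt_eqF//= => /eqP e.
  by move/eqP: ss'; apply; lra.
have : vz (pole u i) + vz (pole u j) == 0.
  rewrite -sqrf_eq0 eq_le sqr_ge0 andbT.
  have : (vx (pole u i) + vx (pole u j)) ^+ 2 + (vy (pole u i) + vy (pole u j)) ^+ 2 +
    (vz (pole u i) + vz (pole u j)) ^+ 2 = 0 by move: pi_ pj_ h; rewrite /vdot; lra.
  by have := sqr_ge0 (vx (pole u i) + vx (pole u j)); have := sqr_ge0 (vy (pole u i) + vy (pole u j)); lra.
rewrite zi zj -mulrDr mulf_eq0 gt_eqF//= => /eqP e.
by move/eqP: s1; apply; lra.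
Qed.

(** The inner strip has relative size at least 1 / (8192 m), so the exponent in [chernoff_lower] is
    m / 16384 before the threshold is subtracted; the threshold m / [density_gap] takes half of
    it. *)
Definition density_gap (R : realType) : R := 128 * 256.

Lemma density_gap_gt0 (R : realType) : 0 < density_gap R.
Proof. by apply: mulr_gt0; rewrite ltr0n. Qed.

Lemma density_gap_ge1 (R : realType) : 1 <= density_gap R.
Proof. by rewrite -[leLHS]mulr1 ler_pM// ler1n. Qed.

Section AlmostSure.
Variables (R : realType) (d : measure_display) (Omega : measurableType d).
Variables (P : probability Omega R) (U : label -> Omega -> R).
Hypothesis iidU : iid_uniform_seeds P U.

Lemma seed_in01 l : measurable [set w | 0 <= U l w <= 1] /\ P [set w | 0 <= U l w <= 1] = 1%E.
Proof.
have e : [set w | 0 <= U l w <= 1] = U l @^-1` `[0, 1].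
  by apply/seteqP; split => w /=; rewrite in_itv.
have mA : measurable [set w | 0 <= U l w <= 1].
  by rewrite e; apply: (seed_measurable iidU); exact: measurable_itv.
split=> //; rewrite -[[set w | _]]setCK probability_setC; last exact: measurableC.
rewrite (_ : P _ = 0%E) ?sube0//; apply/eqP; rewrite eq_le measure_ge0 andbT.
have m1 : measurable (U l @^-1` `]-oo, 0]) by apply: (seed_measurable iidU); exact: measurable_itv.
have m2 : measurable (U l @^-1` `]1, +oo[) by apply: (seed_measurable iidU); exact: measurable_itv.
apply: (@le_trans _ _ (P ((U l @^-1` `]-oo, 0]) `|` (U l @^-1` `]1, +oo[)))).
  apply: le_measure; rewrite ?inE; [exact: measurableC|exact: measurableU|].
  move=> w /=; rewrite !in_itv /= andbT => /negP; rewrite negb_and -!ltNge => /orP[/ltW|]; tauto.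
apply: le_trans (measureU2 _ m1 m2) _.
apply: (@le_trans _ _ (0 + 0)%E); last by rewrite adde0.
by apply: leeD; rewrite le_eqVlt; apply/orP; left; apply/eqP; [exact: seed_le0|exact: seed_gt1].
Qed.

(** For every [M] the cell of one seed leaves at most 3 cells to the other, which bounds the
    probability by 3 / (M + 1). This handles coincidences of two seeds without a joint density. *)
Lemma seed_pair_null (l l' : label) (S : set Omega) (lo : nat -> nat -> nat) : l != l' ->
  measurable S ->
  (forall M w, S w -> (lo M (cell M (U l w)) <= cell M (U l' w) < lo M (cell M (U l w)) + 3)%N) ->
  P S = 0%E.
Proof.
move=> ll' mS hS; apply/eqP; rewrite eq_le measure_ge0 andbT.
have bound M : (P S <= (3 / M.+1%:R)%:E)%E.
  pose lab (_ : unit) (b : bool) := if b then l' else l.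
  have inj : injective (fun p : unit * bool => lab p.1 p.2).
    move=> [[] b] [[] b'] /=; rewrite /lab; case: b b' => -[] // e;
    by move: ll'; rewrite e eqxx.
  pose A : {set {ffun unit -> {ffun bool -> 'I_M.+1}}} :=
    [set x : {ffun unit -> {ffun bool -> 'I_M.+1}} |
      (lo M (x tt false) <= x tt true < lo M (x tt false) + 3)%N]%SET.
  have SA : S `<=` [set w | cells U M lab w \in A].
    by move=> w /hS h /=; rewrite inE !ffunE; exact: h.
  apply: le_trans (le_measure P _ _ SA) _; rewrite ?inE//.
    exact: (@cells_measurable _ _ _ _ _ iidU _ _ _ lab inj A).
  have /eqP := @cells_prob _ _ _ _ _ iidU _ _ _ lab inj A.
  rewrite eq_le => /andP[hp _]; apply: le_trans hp _; rewrite lee_fin.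
  rewrite card_ffun card_unit expn1 card_ffun card_bool card_ord natrX.
  have cA : (#|A| <= M.+1 * 3)%N.
    pose f (x : {ffun unit -> {ffun bool -> 'I_M.+1}}) : 'I_M.+1 * 'I_3 :=
      (x tt false, inord (x tt true - lo M (x tt false))).
    have fi : {in A &, injective f}.
      move=> x y; rewrite !inE => /andP[x1 x2] /andP[y1 y2] [] e1 e2.
      have e3 : x tt true = y tt true.
        have := congr1 (@nat_of_ord _) e2; rewrite !inordK; [|lia|lia].
        by move: x1 x2 y1 y2; rewrite e1 => x1 x2 y1 y2 e; apply: val_inj => /=; lia.
      by apply/ffunP => -[]; apply/ffunP => -[].
    by rewrite -(card_in_imset fi) (leq_trans (max_card _))// card_prod !card_ord.
  rewrite ler_pdivrMr ?exprn_gt0// expr2 mulrA divfK//.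
  by rewrite mulrC -natrM ler_nat.
have fin : P S \is a fin_num by rewrite fin_num_measure.
rewrite -(fineK fin) lee_fin; apply/ler_addgt0Pl => eps e0; rewrite addr0.
have [M hM] : exists M : nat, 3 / M.+1%:R <= eps.
  exists (Num.truncn (3 / eps)); rewrite ler_pdivrMr// mulrC -ler_pdivrMr//.
  by rewrite ltW// truncnS_gt.
by rewrite -lee_fin fineK//; apply: le_trans (bound M) _; rewrite lee_fin.
Qed.

Lemma seeds_neq (l l' : label) : l != l' ->
  measurable [set w | U l w != U l' w] /\ P [set w | U l w != U l' w] = 1%E.
Proof.
move=> ll'; have mS : measurable [set w | U l w = U l' w].
  rewrite (_ : [set w | _] = (U l \- U l') @^-1` [set 0]).
    by rewrite -[_ @^-1` _]setTI; apply: measurable_funB => //; exact: iidU.1.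
  by apply/seteqP; split => w /=; [move=> ->; rewrite subrr|move/subr0_eq].
have -> : [set w | U l w != U l' w] = ~` [set w | U l w = U l' w].
  by apply/seteqP; split => w /= /eqP.
split; first exact: measurableC.
rewrite probability_setC// (@seed_pair_null l l' _ (fun _ a => a)) ?sube0// => M w /= ->.
by rewrite leqnn /= -addn1 leq_add2l.
Qed.

Lemma seeds_sum_neq1 (l l' : label) : l != l' ->
  measurable [set w | 0 <= U l w <= 1 -> 0 <= U l' w <= 1 -> U l w + U l' w != 1] /\
  P [set w | 0 <= U l w <= 1 -> 0 <= U l' w <= 1 -> U l w + U l' w != 1] = 1%E.
Proof.
move=> ll'; pose S := [set w | 0 <= U l w <= 1] `&` [set w | 0 <= U l' w <= 1] `&`
  [set w | U l w + U l' w = 1].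
have mS : measurable S.
  apply: measurableI; first by apply: measurableI; exact: (seed_in01 _).1.
  rewrite (_ : [set w | _] = (U l \+ U l') @^-1` [set 1])//.
  by rewrite -[_ @^-1` _]setTI; apply: measurable_funD => //; exact: iidU.1.
have -> : [set w | 0 <= U l w <= 1 -> 0 <= U l' w <= 1 -> U l w + U l' w != 1] = ~` S.
  apply/seteqP; split => w /=; first by move=> h [[h1 h2] h3]; move/eqP: (h h1 h2).
  by move=> h h1 h2; apply/eqP => h3; apply: h.
split; first exact: measurableC.
(* If the seeds add up to 1, the indices of their cells add up to a number between M - 1 and M +
   1. *)
rewrite probability_setC// (@seed_pair_null l l' _ (fun M a => M.+1 - 2 - a)%N) ?sube0//.
move=> M w [[h1 h2] h3]; have /andP[a1 a2] := @cell_near R M _ h1; have /andP[b1 b2] := @cell_near R M _ h2.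
set a := nat_of_ord _ in a1 a2 *; set b := nat_of_ord _ in b1 b2 *.
have M0 : 0 < M.+1%:R :> R by [].
have e : U l w * M.+1%:R + U l' w * M.+1%:R = M.+1%:R by rewrite -mulrDl h3 mul1r.
have : ((a + b)%:R : R) <= M.+1%:R.
  by rewrite natrD; move: a1 b1; rewrite !ler_pdivrMr//; lra.
have : (M.+1%:R : R) <= (a + b + 2)%:R.
  by rewrite !natrD; move: a2 b2; rewrite !ler_pdivlMr//; lra.
rewrite !ler_nat; have : (a < M.+1)%N by exact: ltn_ord.
by clear; lia.
Qed.

(** The index in 'I_5 selects one of five almost sure conditions for each pair of nodes; the second
    and the last one exclude equal and opposite heights of the poles. *)
Lemma nondegenerate_event (k : nat) : exists E : set Omega, [/\ measurable E, P E = 1%E &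
  forall w, E w -> [/\
   forall i : node k, 0 <= U (tag_z, val i, 0, 0)%N w <= 1 /\ 0 <= U (tag_phi, val i, 0, 0)%N w <= 1,
   forall i j : node k, i != j -> vdot (vcross (pole (U^~ w) i) (pole (U^~ w) j))
     (vcross (pole (U^~ w) i) (pole (U^~ w) j)) != 0 &
   forall i j : node k, U (tag_pair, val i, 0, 0)%N w = U (tag_pair, val j, 0, 0)%N w -> i = j]].
Proof.
pose A (x : node k * node k * 'I_5) : set Omega := let: (i, j, c) := x in match val c with
  | 0 => [set w | 0 <= U (tag_z, val i, 0, 0)%N w <= 1]
  | 1 => [set w | 0 <= U (tag_phi, val i, 0, 0)%N w <= 1]
  | 2 => if i == j then setT else [set w | U (tag_z, val i, 0, 0)%N w != U (tag_z, val j, 0, 0)%N w]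
  | 3 => if i == j then setT else [set w | U (tag_pair, val i, 0, 0)%N w != U (tag_pair, val j, 0, 0)%N w]
  | _ => if i == j then setT else [set w | 0 <= U (tag_z, val i, 0, 0)%N w <= 1 ->
      0 <= U (tag_z, val j, 0, 0)%N w <= 1 -> U (tag_z, val i, 0, 0)%N w + U (tag_z, val j, 0, 0)%N w != 1]
  end.
have hA x : measurable (A x) /\ P (A x) = 1%E.
  case: x => -[i j] [c c5]; rewrite /A /=.
  have [->|ij] := eqVneq i j.
    case: c c5 => [|[|[|[|c]]]] c5; try exact: seed_in01; by rewrite probability_setT.
  have ij' a : (a, val i, 0, 0)%N != (a, val j, 0, 0)%N.
    by apply: contra ij => /eqP[] /val_inj ->.
  case: c c5 => [|[|[|[|c]]]] c5; try exact: seed_in01.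
  - exact: seeds_neq.
  - exact: seeds_neq.
  - exact: seeds_sum_neq1.
have [mI PI] := probability_bigcap_fin (fun x => (hA x).1) (fun x => (hA x).2).
exists (\bigcap_(t in setT) A t); split=> // w Ew.
have h c (c5 : (c < 5)%N) i j : A (i, j, Ordinal c5) w by exact: Ew.
have h0 i : 0 <= U (tag_z, val i, 0, 0)%N w <= 1 := h 0%N isT i i.
split=> [i|i j ij|i j e].
- by split; [exact: h0|exact: (h 1%N isT i i)].
- apply: pole_cross_neq0; try exact: h0.
    by have := h 2%N isT i j; rewrite /A /= (negbTE ij).
  by have := h 4%N isT i j; rewrite /A /= (negbTE ij); apply; exact: h0.
- by have := h 3%N isT i j; rewrite /A /=; case: eqVneq => // _ /=; rewrite e eqxx.
Qed.

Lemma card_bool_ffun (T : finType) (p : T -> T -> bool) :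
  #|[pred y : {ffun bool -> T} | p (y false) (y true)]| = (\sum_i \sum_j p i j)%N.
Proof.
rewrite -sum1_card big_mkcond pair_big /=.
rewrite (reindex (fun x : T * T => [ffun b => if b then x.2 else x.1] : {ffun bool -> T})) /=.
  by apply: eq_bigr => -[i j] _; rewrite inE !ffunE; case: (p i j).
exists (fun y => (y false, y true)) => [[i j]|y] _; first by rewrite !ffunE.
by apply/ffunP => -[]; rewrite ffunE.
Qed.

(** * Probability of an atypical configuration *)

Section Net.
Variables (k : nat) (Delta : R).
Hypothesis Delta0 : 0 < Delta.
Local Notation m := (msz k).
Local Notation beta := (disk_angle Delta).
Local Notation M := (ncells k).-1.
Local Notation Y := {ffun bool -> 'I_((ncells k).-1).+1}.
Local Notation Q := ('I_(16 * m).+1 * 'I_(16 * m).+1 * 'I_(16 * m).+1)%type.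
Hypothesis beta_m : beta + 1 <= m%:R.

Let m0 : 0 < m%:R :> R. Proof. by rewrite ltr0n msz_gt0. Qed.
Let NE : M.+1 = ncells k. Proof. by rewrite prednK// ncells_gt0. Qed.

Definition band (q : Q) (r : R) : pred Y :=
  [pred y : Y | `|strip_height R k q.1.1 q.1.2 q.2 (y false) (y true)| <= r].

(* The mean occupations of the two bands are at most [8000 * (beta + 1) * m] and at least
   [m / 8192]; the margins leave room for the Chernoff bounds. *)
Let c2 : R := 16000 * (beta + 1) + 2.
Let c1 : R := 1 / density_gap R.

Definition crowded (q : Q) : {set {ffun node k -> Y}} :=
  [set x : {ffun node k -> Y} | (c2 * m%:R < (occupation (band q ((beta + 1) / m%:R)) x)%:R)%R]%SET.
Definition sparse (q : Q) : {set {ffun node k -> Y}} :=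
  [set x : {ffun node k -> Y} | ((occupation (band q (8 * m%:R)^-1) x)%:R < c1 * m%:R)%R]%SET.
Definition atypical : {set {ffun node k -> Y}} :=
  (\bigcup_(q : Q | 1 / 4 <= net_norm2 R k q.1.1 q.1.2 q.2 <= 1) (crowded q :|: sparse q))%SET.

Lemma card_band (q : Q) r : (#|band q r|%:R : R) =
  \sum_(i < ncells k) \sum_(j < ncells k) (`|strip_height R k q.1.1 q.1.2 q.2 i j| <= r)%R%:R.
Proof.
rewrite /band (@card_bool_ffun _ (fun i j : 'I_M.+1 => (`|strip_height R k q.1.1 q.1.2 q.2 i j| <= r)%R)).
by rewrite natr_sum NE; apply: eq_bigr => i _; rewrite natr_sum.
Qed.

Lemma ncellsR : (ncells k)%:R = 14400 * m%:R ^+ 2 :> R.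
Proof. by rewrite /ncells !natrM; ring. Qed.

Lemma card_Y : (#|{: Y}|%:R : R) = (ncells k)%:R ^+ 2.
Proof. by rewrite card_ffun card_bool card_ord NE natrX. Qed.

Lemma crowded_le (q : Q) : 1 / 4 <= net_norm2 R k q.1.1 q.1.2 q.2 <= 1 ->
  (#|crowded q|%:R : R) <= expR (- m%:R) * #|{ffun node k -> Y}|%:R.
Proof.
move=> qn; have b8 := disk_angle_ge8 Delta0.
have m1 : 1 <= m%:R :> R by rewrite ler1n msz_gt0.
have r01 : 0 < (beta + 1) / m%:R <= 1 by rewrite divr_gt0 ?ler_pdivrMr ?mul1r//; lra.
have rN : 1 <= (beta + 1) / m%:R * (ncells k)%:R.
  rewrite ncellsR mulrAC ler_pdivlMr// mul1r; nra.
have := @height_upper R (ncells k) _ _ _ _ qn r01 rN; rewrite -(card_band q) -card_Y => hA.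
have := @chernoff_upper R (node k) Y (band q ((beta + 1) / m%:R)) _ (c2 * m%:R) hA.
rewrite card_ord natrM; congr (_ <= expR _ * _); rewrite /c2; field; exact: lt0r_neq0.
Qed.

Lemma sparse_le (q : Q) : 1 / 4 <= net_norm2 R k q.1.1 q.1.2 q.2 <= 1 ->
  (#|sparse q|%:R : R) <= expR (- (m%:R / density_gap R)) * #|{ffun node k -> Y}|%:R.
Proof.
move=> qn; have m1 : 1 <= m%:R :> R by rewrite ler1n msz_gt0.
set r : R := (8 * m%:R)^-1; have r01 : 0 < r <= 1 / 2.
  have h8 : 0 < 8 * m%:R :> R by rewrite mulr_gt0.
  by rewrite /r invr_gt0 h8 -div1r ler_pdivrMr//=; lra.
have rN : 256 <= r * (ncells k)%:R.
  by rewrite ncellsR mulrC ler_pdivlMr ?mulr_gt0//; nra.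
have := @height_lower R (ncells k) _ _ _ _ qn r01 rN; rewrite -(card_band q) -card_Y.
rewrite mulrAC => hA.
have := @chernoff_lower R (node k) Y (band q r) _ (c1 * m%:R) hA.
rewrite card_ord natrM; congr (_ <= expR _ * _); rewrite /c1 /r /density_gap; field; exact: lt0r_neq0.
Qed.

(** Union bound over the (16 m + 1)^3 points of the net; the upper tail exp(-m) is absorbed into the
    weaker lower one. *)
Lemma atypical_le : (#|atypical|%:R : R) <=
  2 * (16 * m).+1%:R ^+ 3 * expR (- (m%:R / density_gap R)) * #|{ffun node k -> Y}|%:R.
Proof.
apply: (@le_trans _ _ (\sum_(q : Q | 1 / 4 <= net_norm2 R k q.1.1 q.1.2 q.2 <= 1)
    (2 * expR (- (m%:R / density_gap R)) * #|{ffun node k -> Y}|%:R))).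
  apply: (@le_trans _ _ (\sum_(q : Q | 1 / 4 <= net_norm2 R k q.1.1 q.1.2 q.2 <= 1)
      #|crowded q :|: sparse q|%SET%:R)).
    rewrite -natr_sum ler_nat /atypical.
    elim/big_rec2: _ => [|q n A qn le]; first by rewrite cards0.
    by apply: leq_trans (leq_card_setU _ _) _; rewrite leq_add2l.
  apply: ler_sum => q qn.
  apply: (@le_trans _ _ (#|crowded q| + #|sparse q|)%N%:R).
    by rewrite ler_nat leq_card_setU.
  rewrite natrD -mulrA mulr2n mulrDl mul1r; apply: lerD; last exact: sparse_le.
  apply: le_trans (crowded_le qn) _; rewrite ler_wpM2r// ler_expR lerN2.
  by rewrite ler_pdivrMr ?density_gap_gt0// ler_peMr ?density_gap_ge1// ltW.
rewrite sumr_const -[leLHS]mulr_natl; set E := expR _; set F := #|{ffun node k -> Y}|%:R.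
have -> : 2 * (16 * m).+1%:R ^+ 3 * E * F = (16 * m).+1%:R ^+ 3 * (2 * E * F) by ring.
have EF0 : 0 <= 2 * E * F by rewrite mulr_ge0 ?mulr_ge0 ?expR_ge0 ?ler0n.
apply: ler_wpM2r => //; rewrite -natrX ler_nat (leq_trans (max_card _))//.
by rewrite !card_prod card_ord !expnS expn0 muln1 mulnA.
Qed.

Let lab (i : node k) (b : bool) : label :=
  ((if b then tag_phi else tag_z), val i, 0, 0)%N.

Let lab_inj : injective (fun p : node k * bool => lab p.1 p.2).
Proof. by move=> [i []] [j []] // [] /val_inj ->. Qed.

Lemma atypical_event : exists E : set Omega, [/\ measurable E,
  (P E <= (2 * (16 * m).+1%:R ^+ 3 * expR (- (m%:R / density_gap R)))%:E)%E &
  forall w, ~ E w -> net_typical k (U^~ w) Delta c1 c2].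
Proof.
exists [set w | cells U M lab w \in atypical]; split.
- exact: (@cells_measurable _ _ _ _ _ iidU _ _ _ lab lab_inj atypical).
- have /eqP := @cells_prob _ _ _ _ _ iidU _ _ _ lab lab_inj atypical.
  rewrite eq_le => /andP[hp _]; apply: le_trans hp _; rewrite lee_fin.
  rewrite ler_pdivrMr; first exact: atypical_le.
  by rewrite ltr0n; apply/card_gt0P; exists [ffun=> [ffun=> ord0]].
move=> w /negP nE q1 q2 q3 qn; move: nE => /bigcupP nE.
have nA : cells U M lab w \notin crowded (q1, q2, q3) :|: sparse (q1, q2, q3).
  by apply/negP => h; apply: nE; exists (q1, q2, q3).
have e r : #|[pred l : node k | `|strip_height R k q1 q2 q3 (zcell (U^~ w) l) (pcell (U^~ w) l)| <= r]| =
    occupation (band (q1, q2, q3) r) (cells U M lab w).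
  by apply: eq_card => l; rewrite !inE /band /= !ffunE.
by move: nA; rewrite !inE negb_or -!leNgt -!e => /andP[].
Qed.
End Net.
End AlmostSure.

(** The exponential dominates the fourth power of x / (4 G), one more than the size of the net
    requires. *)
Lemma cubic_expRN_le (R : realType) (G x : R) : 0 < G -> 1 <= x ->
  2 * (16 * x + 1) ^+ 3 * expR (- (x / G)) <= 2 * 17 ^+ 3 * (4 * G) ^+ 4 / x.
Proof.
move=> G0 x1; have x0 : 0 < x by lra.
have G40 : 0 < 4 * G by rewrite mulr_gt0.
have y0 : 0 < x / (4 * G) by rewrite divr_gt0.
have e : (x / (4 * G)) ^+ 4 <= expR (x / G).
  have -> : x / G = 4%:R * (x / (4 * G)) by field; exact: lt0r_neq0.
  rewrite expRM_natl lerXn2r ?nnegrE ?expR_ge0 ?(ltW y0)//.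
  by apply: le_trans (expR_ge1Dx _); rewrite lerDr.
rewrite expRN ler_pdivrMr ?expR_gt0// -mulrA.
apply: (@le_trans _ _ (2 * (17 * x) ^+ 3)).
  by rewrite ler_pM2l// lerXn2r ?nnegrE; lra.
have -> : 2 * (17 * x) ^+ 3 = 2 * 17 ^+ 3 * (4 * G) ^+ 4 / x * (x / (4 * G)) ^+ 4.
  by field; rewrite !lt0r_neq0.
rewrite -[2 * 17 ^+ 3 * _ * _]mulrA ler_wpM2l// ltW// mulr_gt0 ?divr_gt0 ?exprn_gt0//.
Qed.

Lemma probability_diff_lower (R : realType) (d : measure_display) (Omega : measurableType d)
    (P : probability Omega R) (A B : set Omega) (eps : R) :
  measurable A -> measurable B -> P A = 1%E -> (P B <= eps%:E)%E ->
  ((1 - eps)%:E <= P (A `\` B))%E.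
Proof.
move=> mA mB PA PB.
have mAB : measurable (A `\` B) by exact: measurableD.
have : (P A <= P (A `\` B) + P B)%E.
  apply: le_trans (measureU2 _ mAB mB); apply: le_measure; rewrite ?inE//.
    exact: measurableU.
  by move=> w Aw; have [Bw|nBw] := pselect (B w); [right|left].
rewrite PA => h; rewrite EFinB leeBlDr//; apply: le_trans h _.
by rewrite leeD2l.
Qed.

Lemma ler_nat_exists (R : realType) (x : R) : exists n : nat, x <= n%:R.
Proof. by exists (Num.truncn x).+1; rewrite ltW// truncnS_gt. Qed.

Lemma activity_grain (R : realType) (p a : R) : 0 < p -> p < 1 -> 0 < a ->
  exists K : nat, [/\ (0 < K)%N, (3 * K)%:R^-1 <= p, (3 * K)%:R^-1 <= 1 - p & (3 * K)%:R^-1 <= a].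
Proof.
move=> p0 p1 a0; have [K hK] := ler_nat_exists (p^-1 + (1 - p)^-1 + a^-1).
have i1 : 0 < p^-1 by rewrite invr_gt0.
have i2 : 0 < (1 - p)^-1 by rewrite invr_gt0 subr_gt0.
have i3 : 0 < a^-1 by rewrite invr_gt0.
have grain x : 0 < x -> x^-1 <= p^-1 + (1 - p)^-1 + a^-1 -> (3 * K.+1)%:R^-1 <= x.
  move=> x0 hx; rewrite -[leRHS]invrK lef_pV2 ?posrE ?invr_gt0 ?ltr0n//.
  apply: le_trans hx (le_trans hK _); rewrite ler_nat; clear; lia.
by exists K.+1; split=> //; apply: grain; rewrite ?subr_gt0//; clear -i1 i2 i3; lra.
Qed.

Lemma density_gap_large (R : realType) (x : R) : 1 <= x -> 1 <= x * density_gap R.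
Proof.
by move=> x1; rewrite -[leLHS]mulr1 ler_pM// density_gap_ge1.
Qed.

Theorem theorem1 (R : realType) (pD alpha Delta W : R) :
  0 < pD < 1 -> 0 < alpha < 1 -> 0 < Delta -> 0 < W ->
  (* the constants c1, c2 defining a typical configuration *)
  exists c1 c2 : R, 0 < c1 /\ c1 <= c2 /\
  (* a throughput T_Pi(n) = Theta(1) (n = (2(k+1))^2) *)
  exists T : nat -> R,
    (exists a b : R, 0 < a /\ a <= b /\ forall k, a <= T k <= b) /\
    forall (e : (R * R)%type -> vec R), frame_ok e ->
    forall (d : measure_display) (Omega : measurableType d)
           (P : probability Omega R) (U : label -> Omega -> R),
      iid_uniform_seeds P U ->
      (* P(A_Pi(n)) -> 1, in the sense of inner probability *)
      exists E : nat -> set Omega,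
        (forall k, measurable (E k) /\
           E k `<=` [set w | event_A e k (fun l => U l w) pD alpha Delta c1 c2 W (T k)]) /\
        (P (E k) @[k --> \oo] --> 1%E).
Proof.
move=> /andP[pD0 pD1] /andP[al0 al1] D0 W0.
have b8 := disk_angle_ge8 D0; set beta := disk_angle Delta in b8.
pose c1 : R := 1 / density_gap R; pose c2 : R := 16000 * (beta + 1) + 2.
have [D hD] := ler_nat_exists (2 * (2 + Delta)).
have [K [K0 K_pD K_1pD K_alpha]] := activity_grain pD0 pD1 al0.
have [k1 hk1] := ler_nat_exists (beta + 1).
(* Large enough for the disks to have angle at most 1 and for kappa / m to be at most 1 / 2. *)
pose k0 := maxn k1 (4 * D + 1).
exists c1, c2; split; first by rewrite divr_gt0// density_gap_gt0.
split.
  by rewrite /c1 ler_pdivrMr ?density_gap_gt0// density_gap_large// /c2; lra.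
exists (fun=> W * relay_rate c2 K D / 32); split.
  exists (W * relay_rate c2 K D / 32), (W * relay_rate c2 K D / 32).
  by rewrite !lexx divr_gt0// mulr_gt0// (relay_rate_gt0 _ _ K0).
move=> e e_ok d Omega P U iidU.
pose C : R := 2 * 17 ^+ 3 * (4 * density_gap R) ^+ 4.
have good k : exists E : set Omega, [/\ measurable E,
    E `<=` [set w | event_A e k (U^~ w) pD alpha Delta c1 c2 W (W * relay_rate c2 K D / 32)] &
    (k0 <= k)%N -> ((1 - C / k.+1%:R)%:E <= P E)%E].
  (* For small [k] the empty event satisfies the inclusion, and the limit does not see it. *)
  have [kk|kk] := leqP k0 k; last by exists set0; split=> // ? [].
  have mk : (k.+1 <= msz k)%N by rewrite /msz -addnn leq_addr.
  have m_beta : beta + 1 <= (msz k)%:R.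
    apply: le_trans hk1 _; rewrite ler_nat (leq_trans _ mk)// leqW// (leq_trans _ kk)//.
    by rewrite leq_maxl.
  have beta_m : beta <= (msz k)%:R by apply: le_trans m_beta; rewrite lerDl.
  have m_D : (2 * (4 * D + 1) <= msz k)%N.
    have : (4 * D + 1 <= k)%N by rewrite (leq_trans _ kk)// leq_maxr.
    by rewrite /msz -muln2; clear; lia.
  have [A [mA PA hA]] := nondegenerate_event iidU k.
  have [B [mB PB hB]] := ergodic_event iidU k K0.
  have [N [mN PN hN]] := atypical_event iidU D0 m_beta.
  have [mAB PAB] := @probability_bigcap_fin R d Omega P bool (fun b => if b then A else B)
    (fun b => if b as b0 return measurable (if b0 then A else B) then mA else mB)
    (fun b => if b as b0 return P (if b0 then A else B) = 1%E then PA else PB).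
  exists ((\bigcap_(b in setT) (if b then A else B)) `\` N); split; first exact: measurableD.
    move=> w [ABw nNw] /=; have [u01 indep keys] := hA w (ABw true I).
    have typ := typical_of_net u01 indep D0 beta_m (hN w nNw).
    exact: (throughput_lower e_ok u01 indep D0 keys typ K0 K_pD K_1pD K_alpha hD m_D (hB w (ABw false I)) W0).
  move=> _; apply: le_trans (probability_diff_lower mAB mN PAB PN).
  rewrite lee_fin lerD2l lerN2.
  have m1 : 1 <= (msz k)%:R :> R by rewrite ler1n msz_gt0.
  have := @cubic_expRN_le R _ _ (density_gap_gt0 R) m1.
  rewrite -natrM natr1 => /le_trans; apply.
  rewrite ler_pM2l; last first.
    by rewrite mulr_gt0 ?exprn_gt0// mulr_gt0 ?density_gap_gt0.
  by rewrite lef_pV2 ?posrE ?ltr0n ?msz_gt0// ler_nat.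
have /choice[E hE] := good; exists E; split=> [k|]; first by case: (hE k).
have fin k : P (E k) \is a fin_num by apply: fin_num_measure; case: (hE k).
apply: (@squeeze_cvge _ _ _ _ (fun k => (1 - C / k.+1%:R)%:E) (fun k => P (E k)) (fun=> 1%E)).
- exists k0 => // k /= kk; have [mE _ h] := hE k; rewrite h//=; exact: probability_le1.
- apply: cvg_EFin; first exact: nearW.
  rewrite -[X in _ --> X]subr0 -[X in _ - X](mulr0 C); apply: cvgB; first exact: cvg_cst.
  by apply: cvgMr; exact: cvg_harmonic.
- exact: cvg_cst.
Qed.
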